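(* For every $p$ with $1\le p<\infty$, $p\neq 2$, and every $s\in\mathbb{R}$, there is a sequence $(u_n)_{n\ge 1}$ of (global, real-valued) Schwartz solutions to the focusing modified Korteweg--de Vries equation $$\partial_t u+\partial_x^3 u=-6u^2\,\partial_x u,\qquad u:\mathbb{R}_t\times\mathbb{R}_x\to\mathbb{R},$$ such that $$\lim_{n\to\infty}\|u_n(0)\|_{\mathcal{F}L^p_s(\mathbb{R})}=0\qquad\text{and}\qquad \lim_{n\to\infty}\ \sup_{t\in\mathbb{R}}\|u_n(t)\|_{\mathcal{F}L^p_s(\mathbb{R})}=\infty .$$
   Context: The Fourier transform is $\widehat f(\xi)=\frac1{\sqrt{2\pi}}\int_{\mathbb{R}}e^{-ix\xi}f(x)\,dx$, and $\langle\xi\rangle=(1+\xi^2)^{1/2}$. For $1\le p<\infty$ and $s\in\mathbb{R}$, the Fourier--Lebesgue norm is $\|f\|_{\mathcal{F}L^p_s(\mathbb{R})}=\|\langle\xi\rangle^s\widehat f(\xi)\|_{L^p_\xi(\mathbb{R})}$. A Schwartz solution is a smooth real-valued solution $u(t,x)$ on $\mathbb{R}\times\mathbb{R}$ such that $t\mapsto u(t)=u(t,\cdot)$ is a smooth map into the Schwartz space $\mathcal{S}(\mathbb{R})$. *)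

(* Defs.v *)
From HB Require Import structures.
From mathcomp Require Export all_boot all_order all_algebra.
From mathcomp Require Export all_classical all_reals all_analysis.
From mathcomp Require Export complex.
Export Order.TTheory GRing.Theory Num.Theory.
Export numFieldNormedType.Exports.

Set Implicit Arguments.
Unset Strict Implicit.
Unset Printing Implicit Defensive.

Global Open Scope classical_set_scope.
Global Open Scope complex_scope.
Global Open Scope ring_scope.

Section FourierLebesgue.
Context {R : realType}.
Implicit Types (f : R -> R) (F : R -> R[i]).

Definition expi (theta : R) : R[i] := cos theta +i* sin theta.

Definition cintegral F : R[i] :=
  (\int[lebesgue_measure]_x complex.Re (F x)) +i*
  (\int[lebesgue_measure]_x complex.Im (F x)).

Definition fourier f (xi : R) : R[i] :=
  ((Num.sqrt (2 * pi))^-1)%:C *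
  cintegral (fun x => expi (- (x * xi)) * (f x)%:C).

Definition japanese (xi : R) : R := Num.sqrt (1 + xi ^+ 2).

Definition FLnorm (p s : R) f : \bar R :=
  Lnorm lebesgue_measure p%:E
    (fun xi => ((japanese xi `^ s) * ComplexField.Normc.normc (fourier f xi))%:E).

End FourierLebesgue.

Section Schwartz.
Context {R : realType}.
Implicit Types (f g : R -> R) (c u : R -> R -> R).

Definition schwartz_seminorm (j k : nat) f : \bar R :=
  ereal_sup (range (fun x => `|x ^+ j * derive1n k f x|%:E)).

Definition schwartz f : Prop :=
  (forall k x, derivable (derive1n k f) x 1) /\
  (forall j k, (schwartz_seminorm j k f < +oo)%E).

(* The curve [c] has derivative [g] at time [t] for the Frechet topology of
   the Schwartz space, i.e. in every seminorm. *)
Definition schwartz_is_derive c (t : R) g : Prop :=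
  forall j k,
    schwartz_seminorm j k (fun x => h^-1 * (c (t + h) x - c t x) - g x)
      @[h --> 0^'] --> 0%E.

(* [C m] is the [m]-th derivative of the curve [c]. *)
Definition schwartz_smooth_curve c : Prop :=
  exists C : nat -> R -> R -> R,
    [/\ C 0%N = c,
        forall m t, schwartz (C m t) &
        forall m t, schwartz_is_derive (C m) t (C m.+1 t)].

Definition pd_t u (t x : R) : R := derive1 (fun t' => u t' x) t.
Definition pd_x u (t x : R) : R := derive1 (u t) x.

Fixpoint Ck (k : nat) u : Prop :=
  continuous (fun z : R * R => u z.1 z.2) /\
  if k is k'.+1 then
    [/\ forall t x, derivable (fun t' => u t' x) t 1,
        forall t x, derivable (u t) x 1,
        Ck k' (pd_t u) & Ck k' (pd_x u)]
  else True.

Definition smooth u : Prop := forall k, Ck k u.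

Definition mKdV u : Prop :=
  forall t x, pd_t u t x + pd_x (pd_x (pd_x u)) t x
              = - 6 * u t x ^+ 2 * pd_x u t x.

Definition schwartz_solution u : Prop :=
  [/\ smooth u, schwartz_smooth_curve u & mKdV u].

End Schwartz.

(* Main.v *)
(* The solutions are pure n-solitons.  For distinct k_j > 0 put
   a_j = g_j exp (- k_j x + 4 k_j^3 t), A_ij = a_i a_j / (k_i + k_j), and let
   p - A q = a, q + A p = 0.  Differentiating this linear system shows that p, q
   satisfy the Lax pair of mKdV with potential u = - 2 sum_j (p_j^2 + q_j^2), so
   u is a solution.

   If all k_j are close to one lam <= 1 and the solitons sit at the points L m_j
   with L large, then |u^| is close to 2 |Q^ (xi)| |D (xi)|, where Q is the single
   soliton profile, Q^ lives at frequencies of size lam, and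
   D (xi) = sum_j exp (- i L m_j xi).  As L tends to infinity the averages of |D|^2
   and |D|^4 count coincidences: for m_j = j the sum D is concentrated near few
   frequencies, while for m_j = 4^j the additive energy is minimal and |D| is of
   size n^(1/2) almost everywhere.  Hence the averages of |D|^p for these two
   configurations differ by a power of n as soon as p <> 2, the larger one being
   4^j for p < 2 and j for p > 2.

   The choice k_j^2 = lam^2 (1 + delta (m'_j - m_j)) with delta small makes the
   solitons, whose speeds are 4 k_j^2, move from the points L m_j at time 0 to the
   points L m'_j (up to a common translation) at time T = L / (4 lam^2 delta).
   Taking for m the configuration of small mean, for m' the one of large mean, and
   lam a large multiple of n^(-gamma), where n^gamma is the large mean, gives norm
   inflation; the weight plays no role because lam <= 1. *)
Require Import Defs.
From mathcomp Require Import ring lra zify measurable_realfun.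

Set Implicit Arguments.
Unset Strict Implicit.
Unset Printing Implicit Defensive.

(** * Derivatives of real functions *)

Section Derivatives.
Context {R : realType}.
Implicit Types (f g : R -> R) (x a b : R).

(** The obstacle is to pass from the exact formula to a sum of translated single solitons in a norm
    as strong as FL^p_s. When the centres separate, the linear system converges only locally, near
    each centre, which does not exclude that mass is lost elsewhere. Two trace identities, for the
    integrals of R^2 and of R_2 - 2 R^3 with R = sum_j |p_j + i q_j|^2 and R_2 = sum_j k_j^2 |p_j +
    i q_j|^2, close this gap and give convergence in L^1. The derivatives of R are bounded in L^1
    uniformly in the positions, so interpolation turns L^1 smallness into FL^p_s smallness. No rate
    is obtained, hence the order of choices matters: n, then lam, then the detuning and with it the
    k_j, and the spacing L last. Time only moves the centres: the profile at time T is a profile at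
    time 0 with other phases, so one statement serves both times. *)

Definition der x f a : Prop := is_derive x (1 : R) f a.

Lemma der_derivable x f a : der x f a -> derivable f x 1.
Proof. by move=> [? _]. Qed.

Lemma der_val x f a : der x f a -> derive1 f x = a.
Proof. by move=> h; rewrite derive1E; exact: (@derive_val _ _ _ _ _ _ _ h). Qed.

Lemma der_eq x f a b : der x f a -> a = b -> der x f b.
Proof. by move=> + <-. Qed.

Lemma der_ext x f g a : f =1 g -> der x f a -> der x g a.
Proof. by move=> /funext ->. Qed.

Lemma der_uniq x f a b : der x f a -> der x f b -> a = b.
Proof. by move=> /der_val <- /der_val. Qed.

Lemma der_cst x a : der x (fun=> a) 0.
Proof. exact: is_derive_cst. Qed.

Lemma der_id x : der x (fun y => y) 1.
Proof. exact: is_derive_id. Qed.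

Lemma derD x f g a b : der x f a -> der x g b -> der x (fun y => f y + g y) (a + b).
Proof. exact: is_deriveD. Qed.

Lemma derB x f g a b : der x f a -> der x g b -> der x (fun y => f y - g y) (a - b).
Proof. exact: is_deriveB. Qed.

Lemma derM x f g a b : der x f a -> der x g b ->
  der x (fun y => f y * g y) (a * g x + f x * b).
Proof.
move=> df dg; apply: (der_eq (is_deriveM df dg)).
by rewrite /GRing.scale/= addrC (mulrC (g x)).
Qed.

Lemma derZ x f k a : der x f a -> der x (fun y => k * f y) (k * a).
Proof. by move=> df; apply: der_eq (derM (der_cst x k) df) _; rewrite mul0r add0r. Qed.

Lemma der_sqr x f a : der x f a -> der x (fun y => f y ^+ 2) (2 * f x * a).
Proof.
by move=> h; apply: (@der_ext _ (fun y => f y * f y)) (der_eq (derM h h) _); [move=> y; ring|ring].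
Qed.

Lemma der_sum (I : Type) (s : seq I) (P : pred I) x (h : I -> R -> R) (d : I -> R) :
  (forall i, der x (h i) (d i)) ->
  der x (fun y => \sum_(i <- s | P i) h i y) (\sum_(i <- s | P i) d i).
Proof.
move=> dh; elim: s => [|i s ih].
  by rewrite big_nil; under eq_fun do rewrite big_nil; exact: der_cst.
rewrite big_cons; under eq_fun do rewrite big_cons.
by case: (P i) => //; exact: derD.
Qed.

Lemma der_comp x f g a b : der (g x) f a -> der x g b ->
  der x (fun y => f (g y)) (a * b).
Proof. by move=> df dg; exact: (@is_derive1_comp _ f g x a b df dg). Qed.

Lemma der_exp x g b : der x g b -> der x (fun y => expR (g y)) (expR (g x) * b).
Proof. by move=> dg; apply: der_comp => //; exact: is_derive_expR. Qed.

Lemma der_cont x f a : der x f a -> {for x, continuous f}.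
Proof.
by move=> h; apply/differentiable_continuous/derivable1_diffP; exact: der_derivable h.
Qed.

(** Locating [c] by distances covers increments of either sign. *)
Lemma der_MVT f (df : R -> R) a b : (forall x, der x f (df x)) ->
  exists2 c, `|c - a| <= `|b - a| & f b - f a = df c * (b - a).
Proof.
move=> h.
have cf (A : set R) : {within A, continuous f}.
  by apply: continuous_subspaceT => x; exact: der_cont (h x).
have [ab|ba] := leP a b.
  have [c] := @MVT_segment _ f df a b ab (fun x _ => h x) (cf _).
  rewrite in_itv/= => /andP[ac cb] e; exists c => //.
  by rewrite !ger0_norm ?subr_ge0// lerB.
have [c] := @MVT_segment _ f df b a (ltW ba) (fun x _ => h x) (cf _).
rewrite in_itv/= => /andP[ac cb] e; exists c; last by rewrite -opprB e; ring.
by rewrite !ler0_norm ?subr_le0 ?(ltW ba)// !opprB lerB.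
Qed.

End Derivatives.

(** * Rapidly decreasing functions and their integrals *)

Section Integration.
Context {R : realType}.
Implicit Types f g F : R -> R.
Local Notation mu := (@lebesgue_measure R).

Definition bell (x : R) : R := (1 + x ^+ 2)^-1.

(** Domination by a multiple of the one function [bell] is stable under sums, products with bounded
    functions, translations and dilations, and supplies a ready majorant for dominated
    convergence. *)
Definition tame f := measurable_fun setT f /\
  exists C : R, forall x, `|f x| <= C * bell x.

Definition itg f : R := \int[mu]_x f x.

Lemma bell_gt0 x : 0 < bell x.
Proof. by rewrite invr_gt0; nra. Qed.

Lemma bell_le1 x : bell x <= 1.
Proof. by rewrite invf_le1; nra. Qed.

Lemma continuous_bell : continuous bell.
Proof. exact: continuous_oneDsqrV. Qed.

Lemma integrable_bell : mu.-integrable setT (EFin \o bell).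
Proof.
apply/integrableP; split.
  by apply/measurable_EFinP; apply: continuous_measurable_fun; exact: continuous_bell.
under eq_integral do rewrite /= ger0_norm ?(ltW (bell_gt0 _))//.
rewrite ge0_symfun_integralT; last 3 first.
- by move=> x; exact: ltW (bell_gt0 _).
- exact: continuous_bell.
- by move=> x; rewrite /bell /= sqrrN.
rewrite -set_itvcy integral0y_oneDsqr lte_mul_pinfty//.
by rewrite ltry.
Qed.

Lemma tame_integrable f : tame f -> mu.-integrable setT (EFin \o f).
Proof.
move=> [mf [C fC]].
apply: (@le_integrable _ _ _ mu setT measurableT _ (fun x => C%:E * (EFin \o bell) x)%E).
- exact/measurable_EFinP.
- move=> x _ /=; rewrite lee_fin (le_trans (fC x))// ler_norm//.
- exact: integrableZl integrable_bell.
Qed.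

Lemma tame_cont f C : continuous f -> (forall x, `|f x| <= C * bell x) -> tame f.
Proof. by move=> cf fC; split; [exact: continuous_measurable_fun|exists C]. Qed.

Lemma tameD f g : tame f -> tame g -> tame (fun x => f x + g x).
Proof.
move=> [mf [C fC]] [mg [D gD]]; split; first exact: measurable_funD.
exists (C + D) => x; rewrite mulrDl (le_trans (ler_normD _ _))// lerD//.
Qed.

Lemma tameZ k f : tame f -> tame (fun x => k * f x).
Proof.
move=> [mf [C fC]]; split; first exact: measurable_funM.
by exists (`|k| * C) => x; rewrite normrM -mulrA ler_wpM2l.
Qed.

Lemma tameN f : tame f -> tame (fun x => - f x).
Proof.
by move=> /(tameZ (-1)); under eq_fun do rewrite mulN1r.
Qed.

Lemma tameB f g : tame f -> tame g -> tame (fun x => f x - g x).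
Proof. by move=> tf tg; apply: tameD => //; exact: tameN. Qed.

Lemma tame_sum (I : Type) (s : seq I) (h : I -> R -> R) :
  (forall i, tame (h i)) -> tame (fun x => \sum_(i <- s) h i x).
Proof.
move=> th; elim: s => [|i s ih].
  under eq_fun do rewrite big_nil.
  by split; [exact: measurable_cst|exists 0 => x; rewrite normr0 mul0r].
under eq_fun do rewrite big_cons.
exact: tameD.
Qed.

Lemma tameM f g M : tame f -> measurable_fun setT g -> (forall x, `|g x| <= M) ->
  tame (fun x => f x * g x).
Proof.
move=> [mf [C fC]] mg gM; split; first exact: measurable_funM.
exists (C * M) => x; rewrite normrM mulrAC ler_pM//.
Qed.

Lemma tame_le f g : measurable_fun setT f -> tame g ->
  (forall x, `|f x| <= `|g x|) -> tame f.
Proof.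
move=> mf [_ [C gC]] fg; split => //; exists C => x.
exact: le_trans (fg x) (gC x).
Qed.

Lemma tame_norm f : tame f -> tame (fun x => `|f x|).
Proof.
move=> tf; apply: (tame_le _ tf).
  by apply: measurableT_comp => //; case: tf.
by move=> x; rewrite normr_id.
Qed.

Lemma tame_min f g : tame f -> tame g -> tame (fun x => Num.min (f x) (g x)).
Proof.
move=> tf tg; apply: (tame_le _ (tameD (tame_norm tf) (tame_norm tg))).
  by apply: measurable_minr; [case: tf|case: tg].
move=> x; rewrite [leRHS]ger0_norm ?addr_ge0//.
by rewrite minEle; case: ifP => _; rewrite ?lerDl ?lerDr.
Qed.

Lemma itgD f g : tame f -> tame g -> itg (fun x => f x + g x) = itg f + itg g.
Proof. by move=> tf tg; apply: RintegralD => //; exact: tame_integrable. Qed.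

Lemma itgZ k f : tame f -> itg (fun x => k * f x) = k * itg f.
Proof. by move=> tf; apply: RintegralZl => //; exact: tame_integrable. Qed.

Lemma itgN f : tame f -> itg (fun x => - f x) = - itg f.
Proof.
by move=> tf; rewrite -mulN1r -itgZ//; congr itg; apply/funext => x; rewrite mulN1r.
Qed.

Lemma itgB f g : tame f -> tame g -> itg (fun x => f x - g x) = itg f - itg g.
Proof. by move=> tf tg; rewrite itgD ?itgN//; exact: tameN. Qed.

Lemma itg_sum (I : Type) (s : seq I) (h : I -> R -> R) :
  (forall i, tame (h i)) ->
  itg (fun x => \sum_(i <- s) h i x) = \sum_(i <- s) itg (h i).
Proof.
move=> th; elim: s => [|i s ih].
  rewrite big_nil; under eq_fun do rewrite big_nil.
  by rewrite /itg /Rintegral integral0.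
rewrite big_cons -ih -itgD//; last exact: tame_sum.
by congr itg; apply/funext => x; rewrite big_cons.
Qed.

Lemma le_itg f g : tame f -> tame g -> (forall x, f x <= g x) -> itg f <= itg g.
Proof. by move=> tf tg fg; apply: le_Rintegral => //; exact: tame_integrable. Qed.

Lemma itg_ge0 f : (forall x, 0 <= f x) -> 0 <= itg f.
Proof. by move=> f0; apply: Rintegral_ge0. Qed.

Lemma itg_norm f : tame f -> `|itg f| <= itg (fun x => `|f x|).
Proof. by move=> tf; apply: le_normr_Rintegral => //; exact: tame_integrable. Qed.

Lemma EFin_itg f : tame f -> (itg f)%:E = (\int[mu]_x (f x)%:E)%E.
Proof. by move=> tf; rewrite /itg /Rintegral fineK//; exact/integrable_fin_num/tame_integrable. Qed.

Lemma itg_cvg (h : nat -> R -> R) f C :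
  (forall n, measurable_fun setT (h n)) ->
  (forall n x, `|h n x| <= C * bell x) ->
  (forall x, h n x @[n --> \oo] --> f x) ->
  itg (h n) @[n --> \oo] --> itg f.
Proof.
move=> mh hC hf.
have mf : measurable_fun setT f by apply: (measurable_fun_cvg mh) => x _; exact: hf.
have tf : tame f.
  split => //; exists C => x.
  rewrite -(cvg_lim _ (cvg_norm (hf x)))//; apply: limr_le.
    by apply/cvg_ex; eexists; apply: cvg_norm; exact: hf.
  exact: nearW.
have th n : tame (h n) by split => //; exists C.
have cf x : (EFin \o h n) x @[n --> \oo] --> (EFin \o f) x.
  by apply: cvg_EFin; [exact: nearW|exact: hf].
have mE n : measurable_fun setT (EFin \o h n) by exact/measurable_EFinP.
have fE : measurable_fun setT (EFin \o f) by exact/measurable_EFinP.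
have gE : mu.-integrable setT (fun x => C%:E * (EFin \o bell) x)%E.
  exact: integrableZl integrable_bell.
have [_ _] := @dominated_convergence _ _ R mu setT measurableT
  (fun n => EFin \o h n) (EFin \o f) (fun x => C%:E * (EFin \o bell) x)%E
  mE fE (aeW mu (fun x _ => cf x)) gE (aeW mu (fun x n _ => hC n x)).
rewrite -(EFin_itg tf) (_ : [sequence _]_n = (fun n => (itg (h n))%:E)).
  exact: fine_cvg.
by apply/funext => n; rewrite EFin_itg.
Qed.

Lemma ge0_itg_shift f (a : R) : continuous f -> (forall x, 0 <= f x) ->
  itg (fun x => f (x + a)) = itg f.
Proof.
move=> cf f0; rewrite /itg /Rintegral; congr fine.
have d x : der x (fun x : R => x + a) 1.
  by apply: der_eq (derD (der_id x) (der_cst x a)) _; rewrite addr0.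
have dE : ((fun x : R => x + a)^`() = cst 1)%classic.
  by apply/funext => x; exact: der_val.
rewrite (@increasing_ge0_integration_by_substitutionT _ (fun x => x + a) f)//.
- by apply: eq_integral => x _ /=; rewrite dE /= mulr1.
- by move=> x y xy; rewrite ltrD2r.
- by rewrite dE; exact: cst_continuous.
- by rewrite dE; exact: is_cvg_cst.
- by rewrite dE; exact: is_cvg_cst.
- apply/cvgrNyPle => M; near=> x; rewrite -lerBrDr; near: x; apply: nbhs_ninfty_le; exact: num_real.
- apply/cvgryPge => M; near=> x; rewrite -lerBlDr; near: x; apply: nbhs_pinfty_ge; exact: num_real.
Unshelve. all: by end_near. Qed.

Lemma bell_shift (a : R) : exists2 C, 0 < C & forall x, bell (x + a) <= C * bell x.
Proof.
(* From x = (x + a) - a: x^2 <= 2 (x + a)^2 + 2 a^2. *)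
exists (2 + 2 * a ^+ 2); first by have := sqr_ge0 a; lra.
move=> x; have h0 := sqr_ge0 x; have h1 := sqr_ge0 (x + a); have h2 := sqr_ge0 a.
rewrite /bell ler_pdivlMr; last lra.
rewrite mulrC ler_pdivrMr; last lra.
have h : 0 <= (a * (x + a)) ^+ 2 by exact: sqr_ge0.
have h' : 0 <= (x + 2 * a) ^+ 2 by exact: sqr_ge0.
lra.
Qed.

Lemma tame_shift f (a : R) : tame f -> tame (fun x => f (x + a)).
Proof.
move=> [mf [C fC]]; split.
  apply: measurableT_comp => //; apply: measurable_funD => //.
have [D D0 hD] := bell_shift a.
exists (`|C| * D) => x; rewrite (le_trans (fC _))//.
rewrite (le_trans (ler_wpM2r (ltW (bell_gt0 _)) (ler_norm C)))//.
by rewrite -mulrA ler_wpM2l.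
Qed.

Lemma itg_shift f (a : R) : continuous f -> tame f ->
  itg (fun x => f (x + a)) = itg f.
Proof.
move=> cf tf; have [_ [C fC]] := tf.
have tb : tame (fun x => `|C| * bell x).
  apply: (@tame_cont _ `|C|) => [x|x]; last by rewrite normrM normr_id (gtr0_norm (bell_gt0 x)).
  by apply: cvgM; [exact: cvg_cst|exact: continuous_bell].
have cb : continuous (fun x => `|C| * bell x).
  by move=> x; apply: cvgM; [exact: cvg_cst|exact: continuous_bell].
(* Adding the majorant |C| bell makes the integrand nonnegative, which reduces the claim to
   [ge0_itg_shift]. *)
have h0 : itg (fun x => f (x + a) + `|C| * bell (x + a)) =
          itg (fun x => f x + `|C| * bell x).
  apply: (@ge0_itg_shift (fun x => f x + `|C| * bell x)).
    by move=> x; apply: cvgD; [exact: cf|exact: cb].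
  move=> x; have := fC x; rewrite ler_norml => /andP[+ _].
  have := ler_wpM2r (ltW (bell_gt0 x)) (ler_norm C); lra.
have h1 : itg (fun x => `|C| * bell (x + a)) = itg (fun x => `|C| * bell x).
  apply: (@ge0_itg_shift (fun x => `|C| * bell x)) => // x.
  by rewrite mulr_ge0// ltW// bell_gt0.
move: h0; rewrite itgD//; [|exact: tame_shift|exact: (tame_shift a tb)].
by rewrite itgD// h1 => /addIr.
Qed.

Lemma FTC_segment (f F : R -> R) (a b : R) : a < b -> continuous f ->
  (forall x, der x F (f x)) ->
  \int[mu]_(x in `[a, b]) f x = F b - F a.
Proof.
move=> ab cf dF; rewrite /Rintegral (@continuous_FTC2 _ f F a b)//.
- exact: continuous_subspaceT.
- have cF : continuous F.
    by move=> x; exact: der_cont (dF x).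
  split; [by move=> x _; exact: der_derivable (dF x)| |].
    by apply: cvg_at_right_filter; exact: cF.
  by apply: cvg_at_left_filter; exact: cF.
- by move=> x _; exact: der_val.
Qed.

Lemma itg_FTC (f F : R -> R) (lm lp : R) : continuous f -> tame f ->
  (forall x, der x F (f x)) ->
  F n%:R @[n --> \oo] --> lp -> F (- n%:R) @[n --> \oo] --> lm ->
  itg f = lp - lm.
Proof.
move=> cf [mf [C fC]] dF Fp Fm.
have cv : itg (fun x => f x * \1_(`[- n%:R, n%:R]%classic : set R) x)
    @[n --> \oo] --> itg f.
  apply: (@itg_cvg _ _ C).
  - by move=> n; apply: measurable_funM => //; exact: measurable_indic.
  - move=> n x; rewrite (le_trans _ (fC x))// normrM ler_piMr//.
    by rewrite indicE; case: (_ \in _); rewrite ?normr1 ?normr0.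
  - move=> x; apply: cvg_near_cst; near=> n.
    rewrite indicE mem_set ?mulr1//= in_itv/= -ler_norml.
    by near: n; exact: nbhs_infty_ger.
rewrite -(cvg_lim _ cv)//; apply/cvg_lim => //.
have : F n%:R - F (- n%:R) @[n --> \oo] --> lp - lm by exact: cvgB.
apply: cvg_trans; apply: near_eq_cvg; near=> n.
rewrite -(@FTC_segment f)//; last by rewrite -subr_gt0 opprK -mulr2n mulrn_wgt0// ltr0n; near: n; exists 1%N.
rewrite [RHS]/itg [LHS]Rintegral_mkcond; apply: eq_Rintegral => x _.
by rewrite patchE indicE; case: ifP; rewrite ?mulr1 ?mulr0.
Unshelve. all: by end_near. Qed.

Lemma cvg_natr_atan (c : R) : 0 < c -> atan (c * n%:R) @[n --> \oo] --> pi / 2.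
Proof.
move=> c0; apply: (cvg_comp _ _ _ (@cvgy_atan R)).
by apply/cvgryPge => M; near=> n; rewrite -ler_pdivrMl//; near: n; exact: nbhs_infty_ger.
Unshelve. all: by end_near. Qed.

Lemma tame_bellZ (c : R) : 0 < c -> tame (fun x => bell (c * x)).
Proof.
move=> c0; apply: (@tame_cont _ (1 + c ^- 2)).
  move=> x; apply: continuous_comp; last exact: continuous_bell.
  by apply: cvgM; [exact: cvg_cst|exact: cvg_id].
move=> x; rewrite (gtr0_norm (bell_gt0 _)) /bell.
have h0 := sqr_ge0 x; have h1 := sqr_ge0 (c * x).
have h2 : 0 < c ^- 2 by rewrite invr_gt0 exprn_gt0.
rewrite ler_pdivlMr; last lra.
rewrite mulrC ler_pdivrMr; last lra.
have -> : (1 + c ^- 2) * (1 + (c * x) ^+ 2) = 1 + x ^+ 2 + c ^- 2 + (c * x) ^+ 2.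
  by field; rewrite gt_eqF.
lra.
Qed.

Lemma itg_bellZ (c : R) : 0 < c -> itg (fun x => bell (c * x)) = pi / c.
Proof.
move=> c0; rewrite (@itg_FTC _ (fun x => c^-1 * atan (c * x)) (- (c^-1 * (pi / 2))) (c^-1 * (pi / 2))).
- by field; rewrite gt_eqF.
- move=> x; apply: continuous_comp; last exact: continuous_bell.
  by apply: cvgM; [exact: cvg_cst|exact: cvg_id].
- exact: tame_bellZ.
- move=> x; apply: der_eq (derZ c^-1 (der_comp (is_derive1_atan (c * x)) (derZ c (der_id x)))) _.
  by rewrite /bell; field; have := sqr_ge0 (c * x); lra.
- by apply: cvgM; [exact: cvg_cst|exact: cvg_natr_atan].
- under eq_fun do rewrite mulrN atanN mulrN.
  by apply: cvgN; apply: cvgM; [exact: cvg_cst|exact: cvg_natr_atan].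
Qed.

End Integration.

(** * Parametrized linear systems *)

Section Cramer.
Context {R : realType} (S : Type) (P : (S -> R) -> Prop).
Hypothesis (Pc : forall c, P (fun=> c))
  (PD : forall f g, P f -> P g -> P (fun s => f s + g s))
  (PM : forall f g, P f -> P g -> P (fun s => f s * g s))
  (PV : forall f, P f -> (forall s, f s != 0) -> P (fun s => (f s)^-1)).

Lemma closed_sum (I : Type) (r : seq I) (h : I -> S -> R) :
  (forall i, P (h i)) -> P (fun s => \sum_(i <- r) h i s).
Proof.
move=> Ph; elim: r => [|i r ih].
  by rewrite (_ : (fun s => _) = fun=> 0)//; apply/funext => s; rewrite big_nil.
rewrite (_ : (fun s => _) = fun s => h i s + \sum_(i <- r) h i s); first exact: PD.
by apply/funext => s; rewrite big_cons.
Qed.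

Lemma closed_prod (I : Type) (r : seq I) (h : I -> S -> R) :
  (forall i, P (h i)) -> P (fun s => \prod_(i <- r) h i s).
Proof.
move=> Ph; elim: r => [|i r ih].
  by rewrite (_ : (fun s => _) = fun=> 1)//; apply/funext => s; rewrite big_nil.
rewrite (_ : (fun s => _) = fun s => h i s * \prod_(i <- r) h i s); first exact: PM.
by apply/funext => s; rewrite big_cons.
Qed.

Lemma closed_det m (M : S -> 'M[R]_m) :
  (forall i j, P (fun s => M s i j)) -> P (fun s => \det (M s)).
Proof.
by move=> PMij; apply: closed_sum => s; apply: PM => //; apply: closed_prod.
Qed.

(** Cramer's rule: the solution is a rational expression in the entries, with nonvanishing
    denominator. The class [P] will be differentiability, continuity, and convergence along a
    sequence. *)
Lemma closed_invmx m (M : S -> 'M[R]_m) (f : S -> 'cV[R]_m) i :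
  (forall s, M s \in unitmx) ->
  (forall i j, P (fun s => M s i j)) -> (forall i, P (fun s => f s i 0)) ->
  P (fun s => (invmx (M s) *m f s) i 0).
Proof.
move=> uM PMij Pf.
rewrite (_ : (fun s => _) = fun s => \sum_j (\det (M s))^-1 * \adj (M s) i j * f s j 0).
  apply: closed_sum => j; apply: PM; last exact: Pf.
  apply: PM.
    by apply: PV; [exact: closed_det|move=> s; have := uM s; rewrite unitmxE unitfE].
  under eq_fun do rewrite mxE.
  apply: PM => //; apply: closed_det => i' j'.
  by under eq_fun do rewrite !mxE.
apply/funext => s; rewrite mxE; apply: eq_bigr => j _.
by rewrite /invmx uM mxE.
Qed.
End Cramer.

(** * Complex linear systems in real form *)

Section PairSystem.
Context {R : realType} (n : nat).
Implicit Types (E f : 'I_n -> R) (G : 'I_n -> 'I_n -> R).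

(* Real form of the complex linear system (diag(E) + iG)(p + iq) = f. *)
Definition pairmx E G : 'M[R]_(n + n) :=
  block_mx (\matrix_(i, j) (if i == j then E i else 0)) (- \matrix_(i, j) G i j)
           (\matrix_(i, j) G i j) (\matrix_(i, j) (if i == j then E i else 0)).

Definition pairsol E G f : 'cV[R]_(n + n) :=
  invmx (pairmx E G) *m col_mx (\col_i f i) 0.

Definition repart E G f i := pairsol E G f (lshift n i) 0.
Definition impart E G f i := pairsol E G f (rshift n i) 0.

Definition solves E G f (p q : 'I_n -> R) :=
  (forall i, E i * p i - \sum_j G i j * q j = f i) /\
  (forall i, E i * q i + \sum_j G i j * p j = 0).

Lemma pairmxE E G f (p q : 'I_n -> R) : solves E G f p q <->
  pairmx E G *m col_mx (\col_i p i) (\col_i q i) = col_mx (\col_i f i) 0.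
Proof.
rewrite /pairmx mul_block_col mulNmx.
have dg (v : 'I_n -> R) i :
    ((\matrix_(i, j) (if i == j then E i else 0)) *m (\col_i v i)) i 0 = E i * v i.
  rewrite mxE (bigD1 i)//= big1 ?addr0 ?mxE ?eqxx//.
  by move=> j ji; rewrite !mxE eq_sym (negbTE ji) mul0r.
have gg (v : 'I_n -> R) i :
    ((\matrix_(i, j) G i j) *m (\col_i v i)) i 0 = \sum_j G i j * v j.
  by rewrite mxE; apply: eq_bigr => j _; rewrite !mxE.
split.
- move=> [h1 h2]; congr col_mx; apply/matrixP => i j; rewrite (ord1 j).
    by rewrite [LHS]mxE [X in _ + X]mxE dg gg h1 mxE.
  by rewrite [LHS]mxE dg gg addrC h2 mxE.
- move=> /eq_col_mx[h1 h2]; split=> i.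
    have /matrixP/(_ i 0) := h1.
    by rewrite [LHS]mxE [X in _ + X]mxE dg gg [RHS]mxE.
  have /matrixP/(_ i 0) := h2.
  by rewrite [LHS]mxE dg gg [RHS]mxE addrC.
Qed.

Lemma pairsolP E G f : pairmx E G \in unitmx ->
  solves E G f (repart E G f) (impart E G f).
Proof.
move=> uM; apply/pairmxE.
have -> : col_mx (\col_i repart E G f i) (\col_i impart E G f i) = pairsol E G f.
  apply/matrixP => i j; rewrite (ord1 j) -(@splitK n n i).
  by case: (fintype.split i) => k; rewrite ?col_mxEu ?col_mxEd mxE.
by rewrite mulKVmx.
Qed.

Lemma pairsol_uniq E G f p q : pairmx E G \in unitmx -> solves E G f p q ->
  p =1 repart E G f /\ q =1 impart E G f.
Proof.
move=> uM /pairmxE h.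
have e : col_mx (\col_i p i) (\col_i q i) = pairsol E G f by rewrite /pairsol -h mulKmx.
by split=> i; rewrite /repart /impart -e ?col_mxEu ?col_mxEd mxE.
Qed.

Lemma pairmx_unit E G :
  (forall p q, solves E G (fun=> 0) p q -> (forall i, p i = 0) /\ (forall i, q i = 0)) ->
  pairmx E G \in unitmx.
Proof.
move=> h; rewrite -unitmx_tr -row_free_unit -kermx_eq0; apply/eqP/row_matrixP => i.
rewrite row0; set v := row i _.
have : v *m (pairmx E G)^T = 0 by rewrite -row_mul mulmx_ker row0.
move/(congr1 trmx); rewrite trmx_mul trmxK trmx0 => hv.
have ve : v^T = col_mx (\col_i v 0 (lshift n i)) (\col_i v 0 (rshift n i)).
  apply/matrixP => k j; rewrite (ord1 j) -(@splitK n n k).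
  by case: (fintype.split k) => k'; rewrite ?col_mxEu ?col_mxEd !mxE.
have z : (\col_(i < n) (0 : R)) = 0 by apply/matrixP => k j; rewrite !mxE.
have [h1 h2] : (forall i, v 0 (lshift n i) = 0) /\ (forall i, v 0 (rshift n i) = 0).
  by apply: h; apply/pairmxE; rewrite -ve hv z col_mx0.
apply/matrixP => k j; rewrite (ord1 k) -(@splitK n n j) [RHS]mxE.
by case: (fintype.split j) => j' /=; rewrite ?h1 ?h2.
Qed.

(* The real and imaginary parts of <p + iq, (diag(E) + iG)(p + iq)>. *)
Lemma solves_re E G f p q : (forall i j, G i j = G j i) -> solves E G f p q ->
  \sum_i E i * (p i ^+ 2 + q i ^+ 2) = \sum_i f i * p i.
Proof.
move=> sG [h1 h2].
have e : \sum_i p i * (\sum_j G i j * q j) = \sum_i q i * (\sum_j G i j * p j).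
  under eq_bigr do rewrite big_distrr.
  rewrite exchange_big; apply: eq_bigr => i _; rewrite big_distrr.
  by apply: eq_bigr => j _ /=; rewrite sG; ring.
have -> : \sum_i f i * p i = \sum_i f i * p i + \sum_i q i * 0.
  by rewrite [X in _ + X]big1 ?addr0// => i _; rewrite mulr0.
under eq_bigr do rewrite mulrDr.
rewrite big_split/=.
under [X in _ = _ + X]eq_bigr => i _ do rewrite -(h2 i) mulrDr.
under [X in _ = X + _]eq_bigr => i _ do rewrite -(h1 i) mulrBl (mulrC (\sum_j _)).
rewrite big_split/= [X in _ = _ + X]big_split/= sumrN e addrACA addNr addr0.
by congr (_ + _); apply: eq_bigr => i _; ring.
Qed.

Lemma solves_im E G f p q : solves E G f p q ->
  \sum_i \sum_j G i j * (p i * p j + q i * q j) = - \sum_i f i * q i.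
Proof.
move=> [h1 h2].
have -> : - \sum_i f i * q i = \sum_i (p i * 0 - f i * q i).
  by rewrite -sumrN; apply: eq_bigr => i _; rewrite mulr0 sub0r.
apply: eq_bigr => i _; rewrite -(h1 i) -[X in p i * X](h2 i).
rewrite mulrDr mulrBl opprB addrA (_ : _ + _ = \sum_j G i j * p j * p i + (\sum_j G i j * q j) * q i); last first.
  by rewrite -big_distrl/=; ring.
by rewrite big_distrl/= -big_split/=; apply: eq_bigr => j _; ring.
Qed.
End PairSystem.

(** * Cauchy matrices and the algebra of solitons *)

Section Sums.
Context {R : realType}.

(** Cauchy--Schwarz against the constant vector, from the nonnegativity of the sum of all (x_i -
    x_j)^2. *)
Lemma sqr_sum_le (n : nat) (x : 'I_n -> R) :
  (\sum_i x i) ^+ 2 <= n%:R * \sum_i x i ^+ 2.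
Proof.
have : 0 <= \sum_i \sum_j (x i - x j) ^+ 2.
  by apply: sumr_ge0 => i _; apply: sumr_ge0 => j _; exact: sqr_ge0.
have -> : \sum_i \sum_j (x i - x j) ^+ 2 =
    2 * (n%:R * \sum_i x i ^+ 2 - (\sum_i x i) ^+ 2).
  have e1 : \sum_(i < n) \sum_(j < n) x i ^+ 2 = n%:R * \sum_i x i ^+ 2.
    rewrite big_distrr; apply: eq_bigr => i _.
    by rewrite sumr_const card_ord /= mulr_natl.
  have e2 : \sum_i \sum_j x i * x j = (\sum_i x i) ^+ 2.
    by rewrite expr2 big_distrl; apply: eq_bigr => i _; rewrite big_distrr.
  have e3 : \sum_(i < n) \sum_(j < n) x j ^+ 2 = n%:R * \sum_i x i ^+ 2.
    by rewrite exchange_big e1.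
  have -> : \sum_i \sum_j (x i - x j) ^+ 2 =
    \sum_(i < n) \sum_(j < n) x i ^+ 2 + \sum_(i < n) \sum_(j < n) x j ^+ 2
      - 2 * \sum_i \sum_j x i * x j.
    rewrite -big_split big_distrr -sumrB; apply: eq_bigr => i _ /=.
    rewrite -big_split big_distrr -sumrB; apply: eq_bigr => j _ /=; ring.
  by rewrite e1 e2 e3; ring.
by rewrite pmulr_rge0// subr_ge0.
Qed.

(** The explicit bound 1 / (1 + sum_i 1 / f_i) makes sense for n = 0 too, where there is no
    minimum. *)
Lemma pos_lbound (n : nat) (f : 'I_n -> R) : (forall i, 0 < f i) ->
  exists2 c, 0 < c & forall i, c <= f i.
Proof.
move=> f0; have s0 : 0 <= \sum_i (f i)^-1.
  by apply: sumr_ge0 => i _; rewrite invr_ge0 ltW.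
exists (1 + \sum_i (f i)^-1)^-1; first by rewrite invr_gt0; lra.
move=> i; rewrite -[leRHS]invrK lef_pV2 ?posrE ?invr_gt0//; last lra.
rewrite (bigD1 i)//= addrCA lerDl addr_ge0//.
by apply: sumr_ge0 => j _; rewrite invr_ge0 ltW.
Qed.

Lemma le_sum1 (n : nat) (f : 'I_n -> R) i : (forall j, 0 <= f j) -> f i <= \sum_j f j.
Proof. by move=> f0; rewrite (bigD1 i)//= lerDl sumr_ge0. Qed.

End Sums.

(** * Positivity of Cauchy matrices *)

Section Cauchy.
Context {R : realType}.

Definition cauchy (n : nat) (k : 'I_n -> R) (i j : 'I_n) : R := (k i + k j)^-1.

(* The Schur complement of a Cauchy matrix is a diagonal rescaling of a Cauchy
   matrix: [1/(x+y) = 2z/((x+z)(y+z)) + (x-z)(y-z)/((x+z)(y+z)(x+y))]. *)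
Lemma cauchy_pos (n : nat) (k : 'I_n -> R) : (forall i, 0 < k i) -> injective k ->
  exists2 c, 0 < c &
    forall v, c * \sum_i v i ^+ 2 <= \sum_i \sum_j cauchy k i j * (v i * v j).
Proof.
elim: n k => [|n IH] k k0 kI.
  by exists 1 => // v; rewrite !big_ord0 mulr0.
pose w (i : 'I_n) := widen_ord (leqnSn n) i.
have wI : injective w by move=> i j /(congr1 val) /= ij; exact: val_inj.
have wn i : w i != ord_max by rewrite -val_eqE /= ltn_eqF// ltn_ord.
pose K := k ord_max; pose r (i : 'I_n.+1) := (k i - K) / (k i + K).
have K0 : 0 < K by exact: k0.
have [c c0 hc] := IH (k \o w) (fun i => k0 _) (inj_comp kI wI).
have rw i : 0 < r (w i) ^+ 2.
  rewrite exprn_even_gt0//= mulf_neq0//.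
    by rewrite subr_eq0; apply: contra (wn i) => /eqP/kI/eqP.
  by rewrite invr_neq0// gt_eqF// addr_gt0.
have [d d0 hd] := pos_lbound rw.
(* The inverse of the final constant: (c d)^-1 pays for the first n coordinates, the last product
   for the remaining one. *)
pose B := 1 + (c * d)^-1 + 8 * K ^+ 2 * (1 / (2 * K) + n%:R * K ^- 2 * (c * d)^-1).
have cd0 : 0 < c * d by rewrite mulr_gt0.
have B0 : 0 < B.
  rewrite /B addr_gt0 ?addr_gt0 ?invr_gt0// mulr_gt0//; first by rewrite mulr_gt0// exprn_gt0.
  rewrite ltr_wpDr//; last by rewrite divr_gt0// mulr_gt0.
  by rewrite !mulr_ge0// ?invr_ge0 ?exprn_ge0// ltW.
exists B^-1; first by rewrite invr_gt0.
move=> v; rewrite mulrC ler_pdivrMr// mulrC.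
set q := \sum_i _.
pose S := \sum_i v i / (k i + K).
(* Elimination of the last index: a square plus the smaller Cauchy form in the rescaled vector. *)
have qE : q = 2 * K * S ^+ 2 + \sum_i \sum_j cauchy (k \o w) i j *
    (r (w i) * v (w i) * (r (w j) * v (w j))).
  have -> : q = \sum_i \sum_j (2 * K * (v i / (k i + K) * (v j / (k j + K))) +
      cauchy k i j * (r i * v i * (r j * v j))).
    apply: eq_bigr => i _; apply: eq_bigr => j _; rewrite /cauchy /r; field.
    by rewrite !gt_eqF// addr_gt0.
  have rn : r ord_max = 0 by rewrite /r subrr mul0r.
  under eq_bigr do rewrite big_split/=.
  rewrite big_split/=; congr (_ + _).
    rewrite expr2 /S big_distrl big_distrr; apply: eq_bigr => i _ /=.
    by rewrite !big_distrr.
  rewrite big_ord_recr/= [X in _ + X]big1 ?addr0; last first.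
    by move=> j _; rewrite rn !mul0r mulr0.
  apply: eq_bigr => i _; rewrite big_ord_recr/= rn mul0r !mulr0 addr0.
  exact: eq_bigr.
have W : c * d * \sum_i v (w i) ^+ 2 <= q - 2 * K * S ^+ 2.
  rewrite qE addrC addKr; apply: le_trans (hc _).
  rewrite -mulrA ler_pM2l// big_distrr; apply: ler_sum => i _.
  by rewrite exprMn /= ler_wpM2r ?sqr_ge0.
have W0 : 0 <= \sum_i v (w i) ^+ 2 by apply: sumr_ge0 => i _; exact: sqr_ge0.
have S0 : 0 <= 2 * K * S ^+ 2 by rewrite mulr_ge0 ?sqr_ge0// mulr_ge0// ltW.
have cdW0 : 0 <= c * d * \sum_i v (w i) ^+ 2 by rewrite mulr_ge0// ltW.
have q0 : 0 <= q by lra.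
have W1 : \sum_i v (w i) ^+ 2 <= (c * d)^-1 * q.
  rewrite ler_pdivlMl//; lra.
have S1 : S ^+ 2 <= 1 / (2 * K) * q.
  have K20 : 0 < 2 * K by lra.
  rewrite div1r ler_pdivlMl//; lra.
pose T := \sum_i v (w i) / (k (w i) + K).
have ST : S = T + v ord_max / (2 * K).
  by rewrite /S big_ord_recr/= mulr2n mulrDl !mul1r.
have T1 : T ^+ 2 <= n%:R * K ^- 2 * (c * d)^-1 * q.
  apply: le_trans (sqr_sum_le _) _.
  rewrite -!mulrA ler_wpM2l//.
  apply: le_trans (_ : K ^- 2 * \sum_i v (w i) ^+ 2 <= _).
    rewrite big_distrr; apply: ler_sum => i _ /=.
    rewrite exprMn mulrC ler_wpM2r ?sqr_ge0// exprVn lef_pV2 ?posrE ?exprn_gt0// ?addr_gt0//.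
    by rewrite lerXn2r ?nnegrE ?addr_ge0 ?ltW// ltrDr.
  by rewrite ler_wpM2l// invr_ge0 exprn_ge0// ltW.
(* The last coordinate is recovered from [S] once the contribution [T] of the others, already
   controlled, is removed. *)
have vn : v ord_max = 2 * K * (S - T) by rewrite ST; field; rewrite gt_eqF.
have vn2 : v ord_max ^+ 2 <= 8 * K ^+ 2 * (S ^+ 2 + T ^+ 2).
  by rewrite vn; have := sqr_ge0 (2 * K * (S + T)); lra.
rewrite big_ord_recr/=.
have : 8 * K ^+ 2 * (S ^+ 2 + T ^+ 2) <=
       8 * K ^+ 2 * (1 / (2 * K) + n%:R * K ^- 2 * (c * d)^-1) * q.
  rewrite -[leRHS]mulrA ler_wpM2l ?mulr_ge0 ?sqr_ge0//; lra.
rewrite /B; lra.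
Qed.

(** * Identities satisfied by the solutions of the soliton system *)

Section Algebra.
Context (n : nat) (k : 'I_n -> R).
Hypothesis k0 : forall i, 0 < k i.
Implicit Types a p q : 'I_n -> R.

Definition ones : 'I_n -> R := fun=> 1.
Definition cmx a i j := a i * a j * cauchy k i j.

Definition sys a p q := solves ones (cmx a) a p q.

Lemma cmx_sym a i j : cmx a i j = cmx a j i.
Proof. by rewrite /cmx /cauchy (mulrC (a i)) (addrC (k i)). Qed.

(** The real part of the quadratic form of 1 + i A is the squared norm, because A is real
    symmetric. *)
Lemma hom0 a p q : solves ones (cmx a) (fun=> 0) p q ->
  (forall i, p i = 0) /\ (forall i, q i = 0).
Proof.
move=> /(solves_re (cmx_sym a)); rewrite [RHS]big1 => [|i _]; last by rewrite mul0r.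
move=> e; have {}h i : p i ^+ 2 + q i ^+ 2 = 0.
  have h0 j : true -> 0 <= ones j * (p j ^+ 2 + q j ^+ 2).
    by rewrite mul1r addr_ge0// sqr_ge0.
  by rewrite -[LHS]mul1r; exact: (psumr_eq0P (fun j _ => h0 j isT) e).
by split=> i; have := h i; have := sqr_ge0 (p i); have := sqr_ge0 (q i) => ? ? ?;
  apply/eqP; rewrite -(sqrf_eq0); apply/eqP; lra.
Qed.

Lemma pairmx_ones_unit a : pairmx ones (cmx a) \in unitmx.
Proof. by apply: pairmx_unit => p q; exact: hom0. Qed.

Definition ps a := repart ones (cmx a) a.
Definition qs a := impart ones (cmx a) a.

Lemma ps_sys a : sys a (ps a) (qs a).
Proof. exact/pairsolP/pairmx_ones_unit. Qed.

Lemma sys_uniq a p q : sys a p q -> p =1 ps a /\ q =1 qs a.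
Proof. exact/pairsol_uniq/pairmx_ones_unit. Qed.

Definition mom m a v := \sum_i a i * k i ^+ m * v i.
(** With psi_i = p_i + i q_i this is the sum of k_i^m |psi_i|^2; [Msum] and [Zsum] are the real part
    and half the imaginary part of the sum of k_i^m psi_i^2. *)
Definition Rsum m p q := \sum_i k i ^+ m * (p i ^+ 2 + q i ^+ 2).
Definition Msum m p q := \sum_i k i ^+ m * (p i ^+ 2 - q i ^+ 2).
Definition Zsum m p q := \sum_i k i ^+ m * (p i * q i).

(** Row form of the Sylvester equation K A + A K = a a^T, with K = diag(k): powers of K move through
    A at the price of moments only. *)
Lemma sylvester a v m i : \sum_j cmx a i j * (k j ^+ m.+1 * v j) =
  a i * mom m a v - k i * \sum_j cmx a i j * (k j ^+ m * v j).
Proof.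
rewrite /mom !big_distrr -sumrB; apply: eq_bigr => j _ /=.
rewrite /cmx /cauchy exprS; field.
by rewrite gt_eqF// addr_gt0.
Qed.

Section Identities.
Variables (a p q : 'I_n -> R).
Hypothesis spq : sys a p q.

Let k0E v i : \sum_j cmx a i j * (k j ^+ 0 * v j) = \sum_j cmx a i j * v j.
Proof. by apply: eq_bigr => j _; rewrite expr0 mul1r. Qed.

Let Aq i : \sum_j cmx a i j * (k j ^+ 0 * q j) = p i - a i.
Proof. by rewrite k0E; have [/(_ i) + _] := spq; rewrite /ones mul1r; lra. Qed.

Let Ap i : \sum_j cmx a i j * (k j ^+ 0 * p j) = - q i.
Proof. by rewrite k0E; have [_ /(_ i)] := spq; rewrite /ones mul1r; lra. Qed.

Definition cmxq m i := \sum_j cmx a i j * (k j ^+ m * q j).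
Definition cmxp m i := \sum_j cmx a i j * (k j ^+ m * p j).

Lemma cmxq1 i : cmxq 1 i = a i * mom 0 a q - k i * (p i - a i).
Proof. by rewrite /cmxq sylvester Aq. Qed.
Lemma cmxq2 i : cmxq 2 i = a i * mom 1 a q - k i * cmxq 1 i.
Proof. by rewrite /cmxq sylvester. Qed.
Lemma cmxq3 i : cmxq 3 i = a i * mom 2 a q - k i * cmxq 2 i.
Proof. by rewrite /cmxq sylvester. Qed.
Lemma cmxp1 i : cmxp 1 i = a i * mom 0 a p + k i * q i.
Proof. by rewrite /cmxp sylvester Ap mulrN opprK. Qed.
Lemma cmxp2 i : cmxp 2 i = a i * mom 1 a p - k i * cmxp 1 i.
Proof. by rewrite /cmxp sylvester. Qed.
Lemma cmxp3 i : cmxp 3 i = a i * mom 2 a p - k i * cmxp 2 i.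
Proof. by rewrite /cmxp sylvester. Qed.

Lemma cmxp0 i : cmxp 0 i = - q i. Proof. exact: Ap. Qed.
Lemma cmxq0 i : cmxq 0 i = p i - a i. Proof. exact: Aq. Qed.

(** Symmetry of A. Each quadratic identity below follows by evaluating the two sides of an instance
    with the Sylvester relations. *)
Let swap m l (v w : 'I_n -> R) :
  \sum_i k i ^+ m * v i * \sum_j cmx a i j * (k j ^+ l * w j) =
  \sum_i k i ^+ l * w i * \sum_j cmx a i j * (k j ^+ m * v j).
Proof.
under eq_bigr do rewrite big_distrr.
rewrite exchange_big; apply: eq_bigr => i _; rewrite big_distrr.
by apply: eq_bigr => j _ /=; rewrite cmx_sym; ring.
Qed.

Let sum2 (f g h : 'I_n -> R) x : (forall i, f i = g i * x + h i) ->
  \sum_i f i = (\sum_i g i) * x + \sum_i h i.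
Proof. by move=> e; rewrite big_distrl -big_split; apply: eq_bigr. Qed.

Lemma Rsum0 : Rsum 0 p q = mom 0 a p.
Proof.
rewrite /Rsum /mom; have := solves_re (cmx_sym a) spq.
rewrite (_ : \sum_i _ = \sum_i k i ^+ 0 * (p i ^+ 2 + q i ^+ 2)) => [->|].
  by apply: eq_bigr => i _; rewrite expr0 mulr1.
by apply: eq_bigr => i _; rewrite expr0.
Qed.

(** From <K p, A p> = <p, A K p>. Besides closing the equation for u, this relation yields the
    pointwise bound on R_0 and the second trace identity. *)
Lemma Zsum1 : Zsum 1 p q = - (Rsum 0 p q) ^+ 2 / 2.
Proof.
have e1 := swap 1 0 p p; rewrite Rsum0.
have e2 : \sum_i k i ^+ 1 * p i * cmxp 0 i = - Zsum 1 p q.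
  rewrite /Zsum -sumrN; apply: eq_bigr => i _; rewrite /cmxp Ap; ring.
have e3 : \sum_i k i ^+ 0 * p i * cmxp 1 i = mom 0 a p * mom 0 a p + Zsum 1 p q.
  rewrite /Zsum {1}/mom; apply: sum2 => i; rewrite cmxp1; ring.
have : - Zsum 1 p q = mom 0 a p * mom 0 a p + Zsum 1 p q by rewrite -e2 -e3.
lra.
Qed.

Lemma mom1q : mom 1 a q = - (mom 0 a p ^+ 2 + mom 0 a q ^+ 2) / 2.
Proof.
have e1 := swap 1 0 q q.
have e2 : \sum_i k i ^+ 1 * q i * cmxq 0 i = Zsum 1 p q - mom 1 a q.
  rewrite /Zsum /mom -sumrB; apply: eq_bigr => i _; rewrite cmxq0; ring.
have e3 : \sum_i k i ^+ 0 * q i * cmxq 1 i =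
    mom 0 a q * mom 0 a q + (mom 1 a q - Zsum 1 p q).
  have -> : mom 1 a q - Zsum 1 p q = \sum_i (a i * k i ^+ 1 * q i - k i ^+ 1 * (p i * q i)).
    by rewrite sumrB.
  rewrite {1}/mom; apply: sum2 => i; rewrite cmxq1; ring.
have : Zsum 1 p q - mom 1 a q = mom 0 a q * mom 0 a q + (mom 1 a q - Zsum 1 p q).
  by rewrite -e2 -e3.
rewrite Zsum1 Rsum0; lra.
Qed.

Lemma Msum1 : Msum 1 p q = mom 1 a p + mom 0 a p * mom 0 a q.
Proof.
have e1 := swap 1 0 q p.
have e2 : \sum_i k i ^+ 1 * q i * cmxp 0 i = - \sum_i k i * q i ^+ 2.
  rewrite -sumrN; apply: eq_bigr => i _; rewrite /cmxp Ap; ring.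
have e3 : \sum_i k i ^+ 0 * p i * cmxq 1 i =
    mom 0 a p * mom 0 a q + (mom 1 a p - \sum_i k i * p i ^+ 2).
  have -> : mom 1 a p - \sum_i k i * p i ^+ 2 = \sum_i (a i * k i ^+ 1 * p i - k i * p i ^+ 2).
    by rewrite sumrB.
  rewrite {1}/mom; apply: sum2 => i; rewrite cmxq1; ring.
have -> : Msum 1 p q = \sum_i k i * p i ^+ 2 - \sum_i k i * q i ^+ 2.
  by rewrite -sumrB; apply: eq_bigr => i _; ring.
have : - \sum_i k i * q i ^+ 2 =
  mom 0 a p * mom 0 a q + (mom 1 a p - \sum_i k i * p i ^+ 2) by rewrite -e2 -e3.
lra.
Qed.

Lemma Rsum2 : Rsum 2 p q =
  mom 2 a p + mom 1 a p * mom 0 a q - mom 0 a p * mom 1 a q.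
Proof.
have e1 := swap 2 0 q p.
have e2 : \sum_i k i ^+ 2 * q i * cmxp 0 i = - \sum_i k i ^+ 2 * q i ^+ 2.
  rewrite -sumrN; apply: eq_bigr => i _; rewrite /cmxp Ap; ring.
have e3 : \sum_i k i ^+ 0 * p i * cmxq 2 i = mom 0 a p * mom 1 a q
    + (- (mom 1 a p * mom 0 a q) + (\sum_i k i ^+ 2 * p i ^+ 2 - mom 2 a p)).
  rewrite {1}/mom; under eq_bigr => i _.
    rewrite cmxq2 cmxq1.
    rewrite (_ : _ * _ = a i * k i ^+ 0 * p i * mom 1 a q +
       (a i * k i ^+ 1 * p i * - mom 0 a q + (k i ^+ 2 * p i ^+ 2 - a i * k i ^+ 2 * p i))); last ring.
    over.
  rewrite big_split -big_distrl/= big_split -big_distrl/= sumrB.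
  by rewrite mulrN.
have -> : Rsum 2 p q = \sum_i k i ^+ 2 * p i ^+ 2 + \sum_i k i ^+ 2 * q i ^+ 2.
  by rewrite -big_split; apply: eq_bigr => i _ /=; ring.
have : - \sum_i k i ^+ 2 * q i ^+ 2 = mom 0 a p * mom 1 a q
    + (- (mom 1 a p * mom 0 a q) + (\sum_i k i ^+ 2 * p i ^+ 2 - mom 2 a p)).
  by rewrite -e2 -e3.
lra.
Qed.

(* Evolution of the eigenfunctions [p + iq]: the spatial part and the temporal
   part of the Lax pair with potential [u = - 2 * Rsum 0]. *)
Definition dxp i := - k i * p i - 2 * Rsum 0 p q * q i.
Definition dxq i := k i * q i + 2 * Rsum 0 p q * p i.
Definition dtp i := 4 * k i ^+ 3 * p i + 8 * Rsum 0 p q * k i ^+ 2 * q i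
  + 8 * Rsum 0 p q ^+ 2 * k i * p i + 8 * Msum 1 p q * k i * q i + 8 * Rsum 2 p q * q i.
Definition dtq i := - 4 * k i ^+ 3 * q i - 8 * Rsum 0 p q * k i ^+ 2 * p i
  + 8 * Msum 1 p q * k i * p i - 8 * Rsum 0 p q ^+ 2 * k i * q i - 8 * Rsum 2 p q * p i.

(** For a' = - K a one has A' = - a a^T, so this and [dx_sys2] say that ([dxp], [dxq]) solves the
    system differentiated in x. *)
Lemma dx_sys1 i : dxp i - \sum_j cmx a i j * dxq j =
  - k i * a i + \sum_j (- (a i * a j)) * q j.
Proof.
have -> : \sum_j cmx a i j * dxq j = cmxq 1 i + 2 * Rsum 0 p q * cmxp 0 i.
  rewrite /cmxp /cmxq big_distrr -big_split; apply: eq_bigr => j _.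
  by rewrite /dxq /=; ring.
have -> : \sum_j (- (a i * a j)) * q j = - a i * mom 0 a q.
  by rewrite /mom big_distrr; apply: eq_bigr => j _ /=; ring.
rewrite cmxq1 cmxp0 /dxp; ring.
Qed.

Lemma dx_sys2 i : dxq i + \sum_j cmx a i j * dxp j =
  - \sum_j (- (a i * a j)) * p j.
Proof.
have -> : \sum_j cmx a i j * dxp j = - cmxp 1 i - 2 * Rsum 0 p q * cmxq 0 i.
  rewrite /cmxp /cmxq big_distrr -sumrN -sumrB; apply: eq_bigr => j _.
  by rewrite /dxp /=; ring.
have -> : \sum_j (- (a i * a j)) * p j = - a i * mom 0 a p.
  by rewrite /mom big_distrr; apply: eq_bigr => j _ /=; ring.
rewrite cmxp1 cmxq0 /dxq Rsum0; ring.
Qed.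

Let dtA (v : 'I_n -> R) i :
  \sum_j (4 * a i * a j * (k i ^+ 2 - k i * k j + k j ^+ 2)) * v j =
  4 * a i * (k i ^+ 2 * mom 0 a v - k i * mom 1 a v + mom 2 a v).
Proof.
rewrite /mom !big_distrr -sumrB -big_split big_distrr; apply: eq_bigr => j _ /=; ring.
Qed.

(** The same for the time derivative a' = 4 K^3 a; the matrix on the right is A', by k_i^3 + k_j^3 =
    (k_i + k_j)(k_i^2 - k_i k_j + k_j^2). *)
Lemma dt_sys1 i : dtp i - \sum_j cmx a i j * dtq j = 4 * k i ^+ 3 * a i +
  \sum_j (4 * a i * a j * (k i ^+ 2 - k i * k j + k j ^+ 2)) * q j.
Proof.
have -> : \sum_j cmx a i j * dtq j = - 4 * cmxq 3 i - 8 * Rsum 0 p q * cmxp 2 i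
    + 8 * Msum 1 p q * cmxp 1 i - 8 * Rsum 0 p q ^+ 2 * cmxq 1 i
    - 8 * Rsum 2 p q * cmxp 0 i.
  rewrite /cmxp /cmxq /dtq; move: (Rsum 0 p q) (Rsum 2 p q) (Msum 1 p q) => R0 R2 M1.
  by rewrite !big_distrr -sumrB -big_split -!sumrB; apply: eq_bigr => j _ /=; ring.
rewrite dtA cmxq3 cmxq2 cmxq1 cmxp2 cmxp1 cmxp0 /dtp Rsum0 Rsum2 Msum1; ring.
Qed.

Lemma dt_sys2 i : dtq i + \sum_j cmx a i j * dtp j =
  - \sum_j (4 * a i * a j * (k i ^+ 2 - k i * k j + k j ^+ 2)) * p j.
Proof.
have -> : \sum_j cmx a i j * dtp j = 4 * cmxp 3 i + 8 * Rsum 0 p q * cmxq 2 i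
    + 8 * Rsum 0 p q ^+ 2 * cmxp 1 i + 8 * Msum 1 p q * cmxq 1 i
    + 8 * Rsum 2 p q * cmxq 0 i.
  rewrite /cmxp /cmxq /dtp; move: (Rsum 0 p q) (Rsum 2 p q) (Msum 1 p q) => R0 R2 M1.
  by rewrite !big_distrr -!big_split; apply: eq_bigr => j _ /=; ring.
rewrite dtA cmxp3 cmxp2 cmxp1 cmxq2 cmxq1 cmxq0 /dtq Rsum0 Rsum2 Msum1 mom1q; by field.
Qed.

End Identities.
End Algebra.
End Cauchy.

(** * The soliton solutions *)

Section Clairaut.
Context {R : realType}.

Lemma continuous2_ball (F : R -> R -> R) t x e :
  continuous (fun z : R * R => F z.1 z.2) -> 0 < e ->
  exists2 d, 0 < d & forall s y, `|s - t| <= d -> `|y - x| <= d ->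
    `|F t x - F s y| < e.
Proof.
move=> /(_ (t, x)) /cvgrPdist_lt/(_ e) /[apply] /nbhs_ballP[d /= d0 h].
exists (d / 2); first by rewrite divr_gt0.
move=> s y st yx; apply: (h (s, y)).
by split; rewrite /ball/= distrC; apply: (le_lt_trans st) || apply: (le_lt_trans yx);
  rewrite ltr_pdivrMr// mulr2n mulrDr mulr1 ltrDl.
Qed.

(** The second difference over a square of side h equals h^2 times either mixed derivative at some
    point of the square; continuity then excludes different values at the corner. *)
Lemma clairaut (F Ft Fx Ftx Fxt : R -> R -> R) :
  (forall t x, der t (F^~ x) (Ft t x)) -> (forall t x, der x (F t) (Fx t x)) ->
  (forall t x, der x (Ft t) (Ftx t x)) -> (forall t x, der t (Fx^~ x) (Fxt t x)) ->
  continuous (fun z : R * R => Ftx z.1 z.2) ->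
  continuous (fun z : R * R => Fxt z.1 z.2) ->
  forall t x, Ftx t x = Fxt t x.
Proof.
move=> dt dx dtx dxt c1 c2 t x; apply/eqP/negPn/negP => ne.
have e0 : 0 < `|Ftx t x - Fxt t x| / 2.
  by rewrite divr_gt0// normr_gt0 subr_eq0.
have [d1 d10 h1] := continuous2_ball t x c1 e0.
have [d2 d20 h2] := continuous2_ball t x c2 e0.
pose h := Num.min d1 d2.
have h0 : 0 < h by rewrite lt_min d10.
have nh : `|h| = h by rewrite gtr0_norm.
have [s1] := @der_MVT _ (fun s => F s (x + h) - F s x) (fun s => Ft s (x + h) - Ft s x) t (t + h)
  (fun s => derB (dt s _) (dt s _)).
rewrite addrAC subrr add0r nh => s1h.
have [x1] := @der_MVT _ (Ft s1) (Ftx s1) x (x + h) (dtx s1).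
rewrite addrAC subrr add0r nh => x1h -> E1.
have [x2] := @der_MVT _ (fun y => F (t + h) y - F t y) (fun y => Fx (t + h) y - Fx t y) x (x + h)
  (fun s => derB (dx _ s) (dx _ s)).
rewrite addrAC subrr add0r nh => x2h.
have [s2] := @der_MVT _ (Fx^~ x2) (Fxt^~ x2) t (t + h) (fun s => dxt s x2).
rewrite addrAC subrr add0r nh => s2h -> E2.
have E : Ftx s1 x1 = Fxt s2 x2.
  have hh : h * h != 0 by rewrite mulf_neq0// gt_eqF.
  apply: (mulIf hh); rewrite !mulrA -E1 -E2; ring.
have hd1 : h <= d1 by rewrite ge_min lexx.
have hd2 : h <= d2 by rewrite ge_min lexx orbT.
have a1 := h1 _ _ (le_trans s1h hd1) (le_trans x1h hd1).
have a2 := h2 _ _ (le_trans s2h hd2) (le_trans x2h hd2).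
have : `|Ftx t x - Fxt t x| <= `|Ftx t x - Ftx s1 x1| + `|Fxt t x - Fxt s2 x2|.
  rewrite E -[X in _ <= _ + X]normrN opprB; apply: le_trans (ler_normD _ _).
  by rewrite le_eqVlt; apply/orP; left; apply/eqP; congr `|_|; ring.
lra.
Qed.
End Clairaut.

(** * Eigenfunctions in space and time, and the mKdV equation *)

Section Curves.
Context {R : realType} (n : nat) (k : 'I_n -> R).
Hypothesis k0 : forall i, 0 < k i.

Lemma entry_closed (S : Type) (P : (S -> R) -> Prop) (E : S -> 'I_n -> R)
    (G : S -> 'I_n -> 'I_n -> R) :
  P (fun=> 0) -> (forall c, P (fun=> c)) ->
  (forall f g, P f -> P g -> P (fun s => f s + g s)) ->
  (forall f g, P f -> P g -> P (fun s => f s * g s)) ->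
  (forall i, P (fun s => E s i)) -> (forall i j, P (fun s => G s i j)) ->
  forall i j, P (fun s => pairmx (E s) (G s) i j).
Proof.
move=> P0 Pc PD PM PE PG i j.
have pd i' j' : P (fun s => (\matrix_(a, b) (if a == b then E s a else 0)) i' j' : R).
  rewrite (_ : (fun s => _) = fun s => if i' == j' then E s i' else 0).
    by case: eqP.
  by apply/funext => s; rewrite mxE.
have pg i' j' : P (fun s => (\matrix_(a, b) G s a b) i' j' : R).
  by rewrite (_ : (fun s => _) = fun s => G s i' j')//; apply/funext => s; rewrite mxE.
have pgN i' j' : P (fun s => (- \matrix_(a, b) G s a b) i' j' : R).
  rewrite (_ : (fun s => _) = fun s => (-1) * G s i' j'); first exact: PM.
  by apply/funext => s; rewrite !mxE mulN1r.
rewrite /pairmx -(@splitK n n i) -(@splitK n n j).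
case: (fintype.split i) => i'; case: (fintype.split j) => j' /=.
- by under eq_fun do rewrite block_mxEul.
- by under eq_fun do rewrite block_mxEur.
- by under eq_fun do rewrite block_mxEdl.
- by under eq_fun do rewrite block_mxEdr.
Qed.

Lemma pairsol_closed (S : Type) (P : (S -> R) -> Prop) (E f : S -> 'I_n -> R)
    (G : S -> 'I_n -> 'I_n -> R) :
  (forall c, P (fun=> c)) ->
  (forall f g, P f -> P g -> P (fun s => f s + g s)) ->
  (forall f g, P f -> P g -> P (fun s => f s * g s)) ->
  (forall f, P f -> (forall s, f s != 0) -> P (fun s => (f s)^-1)) ->
  (forall i, P (fun s => E s i)) -> (forall i j, P (fun s => G s i j)) ->
  (forall i, P (fun s => f s i)) ->
  (forall s, pairmx (E s) (G s) \in unitmx) ->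
  forall i, P (fun s => repart (E s) (G s) (f s) i) /\
            P (fun s => impart (E s) (G s) (f s) i).
Proof.
move=> Pc PD PM PV PE PG Pf uM i.
have h j : P (fun s => pairsol (E s) (G s) (f s) j 0).
  apply: (closed_invmx Pc PD PM PV _ uM); first exact: entry_closed.
  move=> {}j; rewrite -(@splitK n n j); case: (fintype.split j) => j' /=.
    by rewrite (_ : (fun s => _) = fun s => f s j')//; apply/funext => s; rewrite col_mxEu mxE.
  by rewrite (_ : (fun s => _) = fun=> 0)//; apply/funext => s; rewrite col_mxEd mxE.
by split; exact: h.
Qed.

(** Cramer's rule gives differentiability. The derivatives and the candidates [P], [Q] then solve
    the same differentiated system, whose matrix is invertible. *)
Lemma ps_der (a a' : R -> 'I_n -> R) (P Q : 'I_n -> R) s :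
  (forall s i, der s (a^~ i) (a' s i)) ->
  let dA i j := (a' s i * a s j + a s i * a' s j) * cauchy k i j in
  (forall i, P i - \sum_j cmx k (a s) i j * Q j = a' s i + \sum_j dA i j * qs k (a s) j) ->
  (forall i, Q i + \sum_j cmx k (a s) i j * P j = - \sum_j dA i j * ps k (a s) j) ->
  forall i, der s (fun s => ps k (a s) i) (P i) /\ der s (fun s => qs k (a s) i) (Q i).
Proof.
move=> da dA hP hQ.
have dcm i j : der s (fun s => cmx k (a s) i j) (dA i j).
  by apply: (der_eq (derM (derM (da s i) (da s j)) (der_cst s _))); rewrite mulr0 addr0.
have cl := @pairsol_closed R (fun f : R -> R => forall s, exists d, der s f d)
  (fun _ => @ones R n) a (fun s => cmx k (a s)).
have {}cl i : (exists d, der s (fun s => ps k (a s) i) d) /\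
              (exists d, der s (fun s => qs k (a s) i) d).
  suff [h1 h2] : (forall s, exists d, der s (fun s => ps k (a s) i) d) /\
       (forall s, exists d, der s (fun s => qs k (a s) i) d) by split.
  apply: cl.
  - by move=> c s'; exists 0; exact: der_cst.
  - move=> f g hf hg s'; have [c ?] := hf s'; have [d ?] := hg s'.
    by exists (c + d); exact: derD.
  - move=> f g hf hg s'; have [c dc] := hf s'; have [d dd] := hg s'.
    by eexists; exact: (derM dc dd).
  - move=> f hf f0 s'; have [c dc] := hf s'; eexists.
    exact: is_deriveV dc.
  - by move=> j s'; exists 0; exact: der_cst.
  - move=> i' j s'; eexists; exact: (derM (derM (da s' i') (da s' j)) (der_cst s' _)).
  - by move=> j s'; eexists; exact: da.
  - by move=> s'; exact: pairmx_ones_unit.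
have [dp hdp] := @choice _ _ _ (fun i => (cl i).1).
have [dq hdq] := @choice _ _ _ (fun i => (cl i).2).
have h1 i : dp i - \sum_j cmx k (a s) i j * dq j = a' s i + \sum_j dA i j * qs k (a s) j.
  have e : der s (fun s => ps k (a s) i - \sum_j cmx k (a s) i j * qs k (a s) j)
    (dp i - \sum_j (dA i j * qs k (a s) j + cmx k (a s) i j * dq j)).
    by apply: derB => //; apply: der_sum => j; exact: derM.
  have e' : der s (fun s => ps k (a s) i - \sum_j cmx k (a s) i j * qs k (a s) j) (a' s i).
    apply: der_ext (da s i) => s'; have [/(_ i) + _] := ps_sys k (a s').
    by rewrite /ones mul1r.
  by have := der_uniq e e'; rewrite big_split/=; lra.
have h2 i : dq i + \sum_j cmx k (a s) i j * dp j = - \sum_j dA i j * ps k (a s) j.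
  have e : der s (fun s => qs k (a s) i + \sum_j cmx k (a s) i j * ps k (a s) j)
    (dq i + \sum_j (dA i j * ps k (a s) j + cmx k (a s) i j * dp j)).
    by apply: derD => //; apply: der_sum => j; exact: derM.
  have e' : der s (fun s => qs k (a s) i + \sum_j cmx k (a s) i j * ps k (a s) j) 0.
    apply: der_ext (der_cst s 0) => s'; have [_ /(_ i)] := ps_sys k (a s').
    by rewrite /ones mul1r.
  by have := der_uniq e e'; rewrite big_split/=; lra.
have [z1 z2] : (forall i, dp i - P i = 0) /\ (forall i, dq i - Q i = 0).
  apply: (@hom0 R n k (a s)); split=> i; rewrite /ones mul1r.
    under eq_bigr do rewrite mulrBr.
    by rewrite sumrB; have := h1 i; have := hP i; lra.
  under eq_bigr do rewrite mulrBr.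
  by rewrite sumrB; have := h2 i; have := hQ i; lra.
move=> i; split.
  by have /eqP := z1 i; rewrite subr_eq0 => /eqP <-; exact: hdp.
by have /eqP := z2 i; rewrite subr_eq0 => /eqP <-; exact: hdq.
Qed.

Variable g : 'I_n -> R.

Definition al (t x : R) (i : 'I_n) : R := g i * expR (- k i * x + 4 * k i ^+ 3 * t).
Definition pp t x := ps k (al t x).
Definition qq t x := qs k (al t x).

Lemma der_al_x t x i : der x (fun x => al t x i) (- k i * al t x i).
Proof.
apply: der_eq (derZ (g i) (der_exp (derD (derZ (- k i) (der_id x)) (der_cst x (4 * k i ^+ 3 * t))))) _.
by rewrite /al; ring.
Qed.

Lemma der_al_t t x i : der t (fun t => al t x i) (4 * k i ^+ 3 * al t x i).
Proof.
apply: der_eq (derZ (g i) (der_exp (derD (der_cst t (- k i * x)) (derZ (4 * k i ^+ 3) (der_id t))))) _.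
by rewrite /al; ring.
Qed.

Lemma der_pq_x t x i : der x (fun x => pp t x i) (dxp k (pp t x) (qq t x) i) /\
  der x (fun x => qq t x i) (dxq k (pp t x) (qq t x) i).
Proof.
apply: (@ps_der (al t) (fun x i => - k i * al t x i)) => [s j|j|j].
- exact: der_al_x.
- rewrite (dx_sys1 k0 (ps_sys k _)); congr (_ + _); apply: eq_bigr => l _.
  by congr (_ * _); rewrite /cauchy; field; rewrite gt_eqF// addr_gt0.
- rewrite (dx_sys2 k0 (ps_sys k _)); congr (- _); apply: eq_bigr => l _.
  by congr (_ * _); rewrite /cauchy; field; rewrite gt_eqF// addr_gt0.
Qed.

Lemma der_pq_t t x i : der t (fun t => pp t x i) (dtp k (pp t x) (qq t x) i) /\
  der t (fun t => qq t x i) (dtq k (pp t x) (qq t x) i).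
Proof.
apply: (@ps_der (al^~ x) (fun t i => 4 * k i ^+ 3 * al t x i)) => [s j|j|j].
- exact: der_al_t.
- rewrite (dt_sys1 k0 (ps_sys k _)); congr (_ + _); apply: eq_bigr => l _.
  by congr (_ * _); rewrite /cauchy; field; rewrite gt_eqF// addr_gt0.
- rewrite (dt_sys2 k0 (ps_sys k _)); congr (- _); apply: eq_bigr => l _.
  by congr (_ * _); rewrite /cauchy; field; rewrite gt_eqF// addr_gt0.
Qed.

Lemma continuous_pq i : continuous (fun z : R * R => pp z.1 z.2 i) /\
  continuous (fun z : R * R => qq z.1 z.2 i).
Proof.
have cal j : continuous (fun z : R * R => al z.1 z.2 j).
  move=> z; apply: cvgM; first exact: cvg_cst.
  apply: continuous_comp; last exact: continuous_expR.
  apply: cvgD; apply: cvgM; try exact: cvg_cst; [exact: cvg_snd|exact: cvg_fst].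
apply: (@pairsol_closed _ (fun f : R * R -> R => continuous f) (fun _ => @ones R n)
  (fun z => al z.1 z.2) (fun z => cmx k (al z.1 z.2))).
- by move=> c z; exact: cvg_cst.
- by move=> f h cf ch z; apply: cvgD; [exact: cf|exact: ch].
- by move=> f h cf ch z; apply: cvgM; [exact: cf|exact: ch].
- by move=> f cf f0 z; apply: cvgV => //; exact: cf.
- by move=> j z; exact: cvg_cst.
- by move=> j l z; apply: cvgM; [apply: cvgM; exact: cal|exact: cvg_cst].
- by move=> j; exact: cal.
- by move=> z; exact: pairmx_ones_unit.
Qed.

Let R_ m t x := Rsum k m (pp t x) (qq t x).
Let M_ m t x := Msum k m (pp t x) (qq t x).
Let Z_ m t x := Zsum k m (pp t x) (qq t x).

Lemma der_Rsum m t x : der x (R_ m t) (- 2 * M_ m.+1 t x).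
Proof.
apply: der_eq (der_sum _ _ (fun i => derZ (k i ^+ m)
  (derD (der_sqr (der_pq_x t x i).1) (der_sqr (der_pq_x t x i).2)))) _.
rewrite /M_ /Msum big_distrr; apply: eq_bigr => i _ /=.
by rewrite /dxp /dxq exprS; ring.
Qed.

Lemma der_Msum m t x : der x (M_ m t) (- 2 * R_ m.+1 t x - 8 * R_ 0 t x * Z_ m t x).
Proof.
apply: der_eq (der_sum _ _ (fun i => derZ (k i ^+ m)
  (derB (der_sqr (der_pq_x t x i).1) (der_sqr (der_pq_x t x i).2)))) _.
rewrite /dxp /dxq -/(R_ 0 t x); move: (R_ 0 t x) => R0.
rewrite /R_ /Z_ /Rsum /Zsum !big_distrr -sumrB; apply: eq_bigr => i _ /=.
by rewrite exprS; ring.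
Qed.

Lemma der_Rsum_t t x : der t ((R_ 0)^~ x)
  (8 * M_ 3 t x + 16 * R_ 0 t x ^+ 2 * M_ 1 t x + 32 * M_ 1 t x * Z_ 1 t x).
Proof.
apply: der_eq (der_sum _ _ (fun i => derZ (k i ^+ 0)
  (derD (der_sqr (der_pq_t t x i).1) (der_sqr (der_pq_t t x i).2)))) _.
rewrite /dtp /dtq -/(R_ 0 t x) -/(R_ 2 t x) -/(M_ 1 t x).
have -> : 16 * R_ 0 t x ^+ 2 * M_ 1 t x = 16 * R_ 0 t x ^+ 2 *
  \sum_i k i ^+ 1 * (pp t x i ^+ 2 - qq t x i ^+ 2) by [].
move: (R_ 0 t x) (R_ 2 t x) (M_ 1 t x) => R0 R2 M1.
rewrite /M_ /Z_ /Msum /Zsum !big_distrr -!big_split; apply: eq_bigr => i _ /=.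
by ring.
Qed.

Definition soliton t x : R := - 2 * Rsum k 0 (pp t x) (qq t x).

Lemma soliton_mKdV : mKdV soliton.
Proof.
(* This relation removes the sums Z, so that all derivatives needed are polynomials in the sums R
   and M. *)
have Z1 t x : Z_ 1 t x = - R_ 0 t x ^+ 2 / 2 by exact: Zsum1 (ps_sys k _).
have d1 t x : der x (soliton t) (4 * M_ 1 t x).
  by apply: der_eq (derZ _ (der_Rsum 0 t x)) _; ring.
have d1M t x : der x (M_ 1 t) (- 2 * R_ 2 t x + 4 * R_ 0 t x ^+ 3).
  by apply: der_eq (der_Msum 1 t x) _; rewrite Z1; field.
have e1 : pd_x soliton = fun t x => 4 * M_ 1 t x.
  by apply/funext => t; apply/funext => x; exact: der_val (d1 t x).
have e2 : pd_x (pd_x soliton) = fun t x => 4 * (- 2 * R_ 2 t x + 4 * R_ 0 t x ^+ 3).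
  rewrite e1; apply/funext => t; apply/funext => x; apply: der_val; apply: derZ; exact: d1M.
have d3 t x : der x (fun x => 4 * (- 2 * R_ 2 t x + 4 * R_ 0 t x ^+ 3))
   (4 * (4 * M_ 3 t x - 24 * R_ 0 t x ^+ 2 * M_ 1 t x)).
  apply: derZ.
  have dR3 : der x (fun x => R_ 0 t x ^+ 3) (3 * R_ 0 t x ^+ 2 * (- 2 * M_ 1 t x)).
    apply: (@der_ext _ _ (fun x => R_ 0 t x ^+ 2 * R_ 0 t x)) => [y|]; first by ring.
    apply: der_eq (derM (der_sqr (der_Rsum 0 t x)) (der_Rsum 0 t x)) _; ring.
  by apply: der_eq (derD (derZ _ (der_Rsum 2 t x)) (derZ _ dR3)) _; ring.
move=> t x; rewrite e2 /pd_x (der_val (d3 t x)) (der_val (d1 t x)) /pd_t.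
rewrite (der_val (derZ (- 2) (der_Rsum_t t x))) Z1 /soliton -/(R_ 0 t x); by field.
Qed.

End Curves.

(** * Differential polynomials in the eigenfunctions *)

Section Expressions.
Context {R : realType} (n : nat) (k : 'I_n -> R).
Hypothesis k0 : forall i, 0 < k i.

(* Polynomials in the eigenfunctions: a class of functions closed under both
   partial derivatives. *)
Inductive ex := Cst of R | Pe of 'I_n | Qe of 'I_n | Add of ex & ex | Mul of ex & ex.

Fixpoint eval e (p q : 'I_n -> R) : R :=
  match e with
  | Cst c => c | Pe i => p i | Qe i => q i
  | Add e f => eval e p q + eval f p q | Mul e f => eval e p q * eval f p q
  end.

Fixpoint dex (P Q : 'I_n -> ex) e : ex :=
  match e with
  | Cst _ => Cst 0 | Pe i => P i | Qe i => Q i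
  | Add e f => Add (dex P Q e) (dex P Q f)
  | Mul e f => Add (Mul (dex P Q e) f) (Mul e (dex P Q f))
  end.

(* A lower bound for the degree of the monomials; [Cst 0] counts as quadratic. *)
Fixpoint mindeg e : nat :=
  match e with
  | Cst c => if c == 0 then 2 else 0 | Pe _ => 1 | Qe _ => 1
  | Add e f => minn (mindeg e) (mindeg f) | Mul e f => mindeg e + mindeg f
  end.

Definition Sumx (f : 'I_n -> ex) : ex := foldr (fun i => Add (f i)) (Cst 0) (enum 'I_n).

Lemma eval_Sumx f p q : eval (Sumx f) p q = \sum_i eval (f i) p q.
Proof.
rewrite /Sumx -big_enum; elim: (enum 'I_n) => [|i s /= ->]; first by rewrite big_nil.
by rewrite big_cons.
Qed.

Lemma mindeg_Sumx f m : (m <= 2)%N -> (forall i, m <= mindeg (f i))%N ->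
  (m <= mindeg (Sumx f))%N.
Proof.
move=> m2 h; rewrite /Sumx; elim: (enum 'I_n) => [|i s IH] /=; first by rewrite eqxx.
by rewrite leq_min h.
Qed.

Lemma mindeg_dex P Q e : (forall i, 0 < mindeg (P i))%N -> (forall i, 0 < mindeg (Q i))%N ->
  (minn 2 (mindeg e) <= mindeg (dex P Q e))%N.
Proof.
move=> hP hQ; elim: e => [c|i|i|e IHe f IHf|e IHe f IHf] /=.
- by rewrite eqxx geq_minl.
- exact: leq_trans (geq_minr _ _) (hP i).
- exact: leq_trans (geq_minr _ _) (hQ i).
- by rewrite leq_min; move: IHe IHf; rewrite !minnE; lia.
- by rewrite leq_min; move: IHe IHf; rewrite !minnE; lia.
Qed.

Lemma eval_bound (B : R) e : exists2 C, 0 <= C & forall p q,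
  \sum_i (p i ^+ 2 + q i ^+ 2) <= B ->
  `|eval e p q| <= C * Num.sqrt (\sum_i (p i ^+ 2 + q i ^+ 2)) ^+ mindeg e.
Proof.
pose S := 1 + Num.sqrt B.
have S1 : 1 <= S by rewrite lerDl sqrtr_ge0.
have r0 (p q : 'I_n -> R) : 0 <= \sum_i (p i ^+ 2 + q i ^+ 2).
  by apply: sumr_ge0 => i _; rewrite addr_ge0 ?sqr_ge0.
have rS (p q : 'I_n -> R) : \sum_i (p i ^+ 2 + q i ^+ 2) <= B ->
    Num.sqrt (\sum_i (p i ^+ 2 + q i ^+ 2)) <= S.
  move=> /(ler_wsqrtr) h; apply: le_trans h _; rewrite /S; lra.
have comp1 (p q : 'I_n -> R) i : `|p i| <= Num.sqrt (\sum_i (p i ^+ 2 + q i ^+ 2)) /\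
     `|q i| <= Num.sqrt (\sum_i (p i ^+ 2 + q i ^+ 2)).
  have h : p i ^+ 2 + q i ^+ 2 <= \sum_i (p i ^+ 2 + q i ^+ 2).
    by apply: (@le_sum1 R n (fun i => p i ^+ 2 + q i ^+ 2)) => j; rewrite addr_ge0 ?sqr_ge0.
  by rewrite -!sqrtr_sqr; split; apply: ler_wsqrtr; apply: le_trans h;
    rewrite ?lerDl ?lerDr sqr_ge0.
elim: e => [c|i|i|e [C C0 hC] f [D D0 hD]|e [C C0 hC] f [D D0 hD]].
- exists `|c| => // p q h /=; case: eqP => [->|_]; last by rewrite expr0 mulr1.
  by rewrite normr0 mul0r.
- by exists 1 => // p q h /=; rewrite mul1r expr1; case: (comp1 p q i).
- by exists 1 => // p q h /=; rewrite mul1r expr1; case: (comp1 p q i).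
- exists (C * S ^+ mindeg e + D * S ^+ mindeg f).
    by rewrite addr_ge0// mulr_ge0// exprn_ge0// (le_trans ler01).
  move=> p q h /=; rewrite (le_trans (ler_normD _ _))// mulrDl.
  set rho := Num.sqrt _; have rho0 : 0 <= rho by exact: sqrtr_ge0.
  have w d d' : (d' <= d)%N -> rho ^+ d <= S ^+ d * rho ^+ d'.
    move=> dd; rewrite -(subnK dd) exprD [X in _ <= X * _]exprD -mulrA.
    apply: ler_pM; rewrite ?exprn_ge0//.
      by rewrite lerXn2r ?nnegrE// ?(le_trans ler01)// rS.
    rewrite ler_peMl ?exprn_ge0// exprn_ege1//.
  apply: lerD.
    rewrite -mulrA; apply: le_trans (hC p q h) _; rewrite ler_wpM2l// w//.
    exact: geq_minl.
  rewrite -mulrA; apply: le_trans (hD p q h) _; rewrite ler_wpM2l// w//.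
  exact: geq_minr.
- exists (C * D); first exact: mulr_ge0.
  move=> p q h /=; rewrite normrM exprD mulrACA ler_pM//; [exact: hC|exact: hD].
Qed.

(** Expressions of degree at least two are dominated by R_0 itself. Since [C] depends only on [B]
    and [e], this gives decay of all derivatives and L^1 bounds uniform in the phases. *)
Lemma eval_bound2 (B : R) e : (2 <= mindeg e)%N -> exists2 C, 0 <= C & forall p q,
  \sum_i (p i ^+ 2 + q i ^+ 2) <= B ->
  `|eval e p q| <= C * \sum_i (p i ^+ 2 + q i ^+ 2).
Proof.
move=> e2; have [C C0 hC] := eval_bound B e; pose S := Num.sqrt B.
have S0 : 0 <= S by exact: sqrtr_ge0.
exists (C * S ^+ (mindeg e - 2)); first by rewrite mulr_ge0 ?exprn_ge0.
move=> p q h; apply: le_trans (hC p q h) _; rewrite -mulrA ler_wpM2l//.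
have r0 : 0 <= \sum_i (p i ^+ 2 + q i ^+ 2).
  by apply: sumr_ge0 => i _; rewrite addr_ge0 ?sqr_ge0.
rewrite -{1}(subnK e2) exprD sqr_sqrtr// ler_wpM2r//.
by rewrite lerXn2r ?nnegrE ?sqrtr_ge0// ler_wsqrtr.
Qed.

Definition Re m : ex := Sumx (fun i =>
  Mul (Cst (k i ^+ m)) (Add (Mul (Pe i) (Pe i)) (Mul (Qe i) (Qe i)))).
Definition Me m : ex := Sumx (fun i =>
  Mul (Cst (k i ^+ m)) (Add (Mul (Pe i) (Pe i)) (Mul (Cst (- 1)) (Mul (Qe i) (Qe i))))).

Definition dxPe i := Add (Mul (Cst (- k i)) (Pe i)) (Mul (Mul (Cst (- 2)) (Re 0)) (Qe i)).
Definition dxQe i := Add (Mul (Cst (k i)) (Qe i)) (Mul (Mul (Cst 2) (Re 0)) (Pe i)).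
Definition dtPe i := Add (Mul (Cst (4 * k i ^+ 3)) (Pe i))
  (Add (Mul (Mul (Cst (8 * k i ^+ 2)) (Re 0)) (Qe i))
  (Add (Mul (Mul (Cst (8 * k i)) (Mul (Re 0) (Re 0))) (Pe i))
  (Add (Mul (Mul (Cst (8 * k i)) (Me 1)) (Qe i)) (Mul (Mul (Cst 8) (Re 2)) (Qe i))))).
Definition dtQe i := Add (Mul (Cst (- 4 * k i ^+ 3)) (Qe i))
  (Add (Mul (Mul (Cst (- 8 * k i ^+ 2)) (Re 0)) (Pe i))
  (Add (Mul (Mul (Cst (8 * k i)) (Me 1)) (Pe i))
  (Add (Mul (Mul (Cst (- 8 * k i)) (Mul (Re 0) (Re 0))) (Qe i))
    (Mul (Mul (Cst (- 8)) (Re 2)) (Pe i))))).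

Lemma eval_Re m p q : eval (Re m) p q = Rsum k m p q.
Proof. by rewrite eval_Sumx; apply: eq_bigr => i _ /=; ring. Qed.
Lemma eval_Me m p q : eval (Me m) p q = Msum k m p q.
Proof. by rewrite eval_Sumx; apply: eq_bigr => i _ /=; ring. Qed.

Definition dx := dex dxPe dxQe.
Definition dt := dex dtPe dtQe.

Lemma mindeg_Re m : (2 <= mindeg (Re m))%N.
Proof. by apply: mindeg_Sumx => // i /=; case: eqP. Qed.

Lemma mindeg_dx e : (2 <= mindeg e)%N -> (2 <= mindeg (dx e))%N.
Proof.
move=> e2; have := @mindeg_dex dxPe dxQe e; rewrite (minn_idPl e2); apply=> i;
  by rewrite /dxPe /dxQe [mindeg _]/= leq_min !addn_gt0/= !orbT.
Qed.

Lemma mindeg_dt e : (2 <= mindeg e)%N -> (2 <= mindeg (dt e))%N.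
Proof.
move=> e2; have := @mindeg_dex dtPe dtQe e; rewrite (minn_idPl e2); apply=> i;
  by rewrite /dtPe /dtQe [mindeg _]/= !leq_min !addn_gt0/= !orbT.
Qed.

Lemma mindeg_iter_dx e m : (2 <= mindeg e)%N -> (2 <= mindeg (iter m dx e))%N.
Proof. by move=> e2; elim: m => // m; exact: mindeg_dx. Qed.

Lemma mindeg_iter_dt e m : (2 <= mindeg e)%N -> (2 <= mindeg (iter m dt e))%N.
Proof. by move=> e2; elim: m => // m; exact: mindeg_dt. Qed.

Variable g : 'I_n -> R.

Definition fe e t x := eval e (pp k g t x) (qq k g t x).

Lemma fe_dx e t x : der x (fe e t) (fe (dx e) t x).
Proof.
rewrite /fe; elim: e => [c|i|i|e IHe f IHf|e IHe f IHf] /=.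
- exact: der_cst.
- apply: der_eq (der_pq_x k0 g t x i).1 _; rewrite eval_Re /dxp; ring.
- apply: der_eq (der_pq_x k0 g t x i).2 _; rewrite eval_Re /dxq; ring.
- exact: derD.
- exact: derM.
Qed.

Lemma fe_dt e t x : der t ((fe e)^~ x) (fe (dt e) t x).
Proof.
rewrite /fe; elim: e => [c|i|i|e IHe f IHf|e IHe f IHf] /=.
- exact: der_cst.
- apply: der_eq (der_pq_t k0 g t x i).1 _; rewrite !eval_Re eval_Me /dtp; ring.
- apply: der_eq (der_pq_t k0 g t x i).2 _; rewrite !eval_Re eval_Me /dtq; ring.
- exact: derD.
- exact: derM.
Qed.

Lemma fe_cont e : continuous (fun z : R * R => fe e z.1 z.2).
Proof.
rewrite /fe; elim: e => [c|i|i|e IHe f IHf|e IHe f IHf] z /=.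
- exact: cvg_cst.
- exact: ((continuous_pq k g i).1 z).
- exact: ((continuous_pq k g i).2 z).
- by apply: cvgD; [exact: IHe|exact: IHf].
- by apply: cvgM; [exact: IHe|exact: IHf].
Qed.

(** The two expressions differ as syntax; the equality of their values is the compatibility of the
    Lax pair, obtained here from the existence of the eigenfunctions rather than by algebra. *)
Lemma fe_comm e t x : fe (dx (dt e)) t x = fe (dt (dx e)) t x.
Proof.
by apply: (@clairaut _ (fe e) (fe (dt e)) (fe (dx e)) (fe (dx (dt e))) (fe (dt (dx e))));
  [exact: fe_dt|exact: fe_dx|move=> ? ?; exact: fe_dx|move=> ? ?; exact: fe_dt|
   exact: fe_cont|exact: fe_cont].
Qed.

Lemma fe_iter_comm e m t x : fe (iter m dx (dt e)) t x = fe (dt (iter m dx e)) t x.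
Proof.
elim: m t x => // m IH t x /=; rewrite -fe_comm.
apply: (@der_uniq _ x (fe (iter m dx (dt e)) t)); first exact: fe_dx.
by rewrite (_ : fe (iter m dx (dt e)) t = fe (dt (iter m dx e)) t);
  [exact: fe_dx|apply/funext].
Qed.

Lemma fe_derive1n e m t : derive1n m (fe e t) = fe (iter m dx e) t.
Proof.
elim: m => [//|m IH]; rewrite derive1nS IH.
by apply/funext => x; apply: der_val; exact: fe_dx.
Qed.

Lemma fe_smooth e : smooth (fe e).
Proof.
move=> m; elim: m e => [|m IH] e; split; rewrite //; try exact: fe_cont.
split.
- by move=> t x; exact: der_derivable (fe_dt e t x).
- by move=> t x; exact: der_derivable (fe_dx e t x).
- rewrite (_ : pd_t (fe e) = fe (dt e))//.
  by apply/funext => t; apply/funext => x; exact: der_val (fe_dt e t x).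
- rewrite (_ : pd_x (fe e) = fe (dx e))//.
  by apply/funext => t; apply/funext => x; exact: der_val (fe_dx e t x).
Qed.

End Expressions.

(** * Decay of solitons *)

Section Decay.
Context {R : realType}.

Lemma expR_poly_bound (j : nat) (c : R) : 0 < c ->
  exists M : R, forall x : R, `|x| ^+ j * expR (- c * `|x|) <= M.
Proof.
move=> c0; case: j => [|j].
  exists 1 => x; rewrite expr0 mul1r -expR0 ler_expR mulNr oppr_le0 mulr_ge0// ltW//.
have d0 : 0 < c / j.+1%:R by rewrite divr_gt0.
(* With y = c |x| / (j + 1): exp((j + 1) y) >= (1 + y)^(j + 1) >= y^(j + 1). *)
exists ((c / j.+1%:R) ^- j.+1) => x.
rewrite mulNr expRN -ler_pdivlMr ?invr_gt0 ?expR_gt0// invrK.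
rewrite mulrC ler_pdivlMr ?exprn_gt0//.
rewrite -exprMn (_ : c * `|x| = j.+1%:R * (`|x| * (c / j.+1%:R))); last first.
  by rewrite [RHS]mulrC -mulrA divfK ?pnatr_eq0// mulrC.
have y0 : 0 <= `|x| * (c / j.+1%:R) by rewrite mulr_ge0// ltW.
rewrite expRM_natl; apply: lerXn2r; rewrite ?nnegrE ?expR_ge0//.
by apply: le_trans (expR_ge1Dx _); rewrite lerDr.
Qed.

Section Bounds.
Context (n : nat) (k : 'I_n -> R).
Hypothesis k0 : forall i, 0 < k i.

Definition rr a : R := \sum_i (ps k a i ^+ 2 + qs k a i ^+ 2).

Lemma rr_ge0 a : 0 <= rr a.
Proof. by apply: sumr_ge0 => i _; rewrite addr_ge0 ?sqr_ge0. Qed.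

Lemma rrE a : rr a = Rsum k 0 (ps k a) (qs k a).
Proof. by apply: eq_bigr => i _; rewrite expr0 mul1r. Qed.

Lemma rr_mom a : rr a = \sum_i a i * ps k a i.
Proof. by rewrite rrE (Rsum0 (ps_sys k a)); apply: eq_bigr => i _; rewrite expr0 mulr1. Qed.

(** Decay to the right, where the a_i are small: |psi|^2 = <a, p> <= (|a|^2 + |psi|^2) / 2. *)
Lemma rr_le_sqr a : rr a <= \sum_i a i ^+ 2.
Proof.
have h : rr a <= \sum_i (a i ^+ 2 / 2 + (ps k a i ^+ 2 + qs k a i ^+ 2) / 2).
  rewrite rr_mom; apply: ler_sum => i _.
  have := sqr_ge0 (a i - ps k a i); have := sqr_ge0 (qs k a i); rewrite sqrrB; lra.
move: h; rewrite big_split/= -!big_distrl/= -/(rr a); lra.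
Qed.

(** By [Zsum1], R_0^2 = - 2 sum_i k_i p_i q_i <= K R_0. *)
Lemma rr_le_max K a : 0 <= K -> (forall i, k i <= K) -> rr a <= K.
Proof.
move=> K0 kK.
have h : rr a ^+ 2 <= K * rr a.
  have := Zsum1 k0 (ps_sys k a); rewrite -rrE => e.
  have -> : rr a ^+ 2 = \sum_i - 2 * k i * (ps k a i * qs k a i).
    transitivity (- 2 * Zsum k 1 (ps k a) (qs k a)); first by rewrite e; field.
    by rewrite /Zsum big_distrr; apply: eq_bigr => i _ /=; ring.
  rewrite /rr big_distrr; apply: ler_sum => i _ /=.
  have := sqr_ge0 (ps k a i + qs k a i); rewrite sqrrD => h1.
  apply: le_trans (_ : k i * (ps k a i ^+ 2 + qs k a i ^+ 2) <= _).
    rewrite -mulrA (mulrC (-2)) -mulrA ler_pM2l//; lra.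
  by rewrite ler_wpM2r// addr_ge0 ?sqr_ge0.
have [r0|r0] := ltP 0 (rr a); first by rewrite -(ler_pM2r r0) -expr2.
exact: le_trans K0.
Qed.

(** Decay to the left, where the a_i are large. In the imaginary part of the quadratic form,
    positivity of the Cauchy matrix bounds the vectors (a_i p_i) and (a_i q_i) independently of
    [a]. *)
Lemma rr_le_inv : injective k -> exists2 C, 0 <= C &
  forall a, (forall i, 0 < a i) -> rr a <= C * \sum_i a i ^- 2.
Proof.
move=> kI; have [c c0 hc] := cauchy_pos k0 kI.
exists (n%:R / c ^+ 2); first by rewrite divr_ge0// exprn_ge0// ltW.
move=> a a0; have := solves_im (ps_sys k a).
pose d i := a i * ps k a i; pose e i := a i * qs k a i.
have -> : \sum_i \sum_j cmx k a i j * (ps k a i * ps k a j + qs k a i * qs k a j) =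
    \sum_i \sum_j cauchy k i j * (d i * d j) + \sum_i \sum_j cauchy k i j * (e i * e j).
  rewrite -big_split; apply: eq_bigr => i _; rewrite -big_split; apply: eq_bigr => j _ /=.
  by rewrite /cmx /d /e; ring.
have := hc d; have := hc e; rewrite -/(\sum_i e i).
set de := \sum_i \sum_j _; set ee := \sum_i \sum_j _ => h1 h2 h3.
pose X := \sum_i d i ^+ 2 + \sum_i e i ^+ 2.
have d0 : 0 <= \sum_i d i ^+ 2 by apply: sumr_ge0 => i _; exact: sqr_ge0.
have e0 : 0 <= \sum_i e i ^+ 2 by apply: sumr_ge0 => i _; exact: sqr_ge0.
have X0 : 0 <= X by exact: addr_ge0.
have XS : c * X <= - \sum_i e i by rewrite /X mulrDr; lra.
have cX0 : 0 <= c * X by rewrite mulr_ge0// ltW.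
have X2 : (c * X) ^+ 2 <= n%:R * X.
  apply: le_trans (_ : (- \sum_i e i) ^+ 2 <= _).
    by rewrite lerXn2r ?nnegrE//; lra.
  rewrite sqrrN; apply: le_trans (sqr_sum_le _) _.
  by rewrite ler_wpM2l// /X; lra.
have XC : X <= n%:R / c ^+ 2.
  have [x0|x0] := ltP 0 X; last by apply: le_trans x0 _; rewrite divr_ge0// exprn_ge0// ltW.
  rewrite ler_pdivlMr ?exprn_gt0//; move: X2; rewrite exprMn expr2 (expr2 X) mulrA ler_pM2r//.
  by rewrite -expr2 mulrC.
apply: le_trans (_ : X * \sum_i a i ^- 2 <= _); last first.
  by rewrite ler_wpM2r// sumr_ge0// => i _; rewrite invr_ge0 exprn_ge0// ltW.
rewrite big_distrr; apply: ler_sum => i _ /=.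
rewrite ler_pdivlMr ?exprn_gt0// mulrDl -!exprMn /X.
apply: lerD; rewrite mulrC.
  exact: (@le_sum1 R n (fun i => d i ^+ 2)) (fun=> sqr_ge0 _).
exact: (@le_sum1 R n (fun i => e i ^+ 2)) (fun=> sqr_ge0 _).
Qed.

Variable g : 'I_n -> R.
Hypothesis g0 : forall i, 0 < g i.
Hypothesis kI : injective k.

Lemma rr_al_decay (T : R) : exists D c, [/\ 0 < c, 0 <= D & forall t x, `|t| <= T ->
  rr (al k g t x) <= D * expR (- c * `|x|)].
Proof.
have [C C0 hC] := rr_le_inv kI.
have [m m0 hm] := pos_lbound k0.
have al0 t x i : 0 < al k g t x i by rewrite mulr_gt0 ?expR_gt0.
have alsq t x i : al k g t x i ^+ 2 = g i ^+ 2 * expR (2 * (- k i * x + 4 * k i ^+ 3 * t)).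
  by rewrite /al exprMn -expRM_natl.
(* [D1] serves for x >= 0 and [D2] for x < 0; the exponentials absorb the times up to [T]. *)
pose D1 := \sum_i g i ^+ 2 * expR (8 * k i ^+ 3 * `|T|).
pose D2 := C * \sum_i g i ^- 2 * expR (8 * k i ^+ 3 * `|T|).
have D10 : 0 <= D1 by apply: sumr_ge0 => i _; rewrite mulr_ge0 ?sqr_ge0 ?expR_ge0.
have D20 : 0 <= D2.
  by rewrite mulr_ge0// sumr_ge0// => i _; rewrite mulr_ge0 ?invr_ge0 ?sqr_ge0 ?expR_ge0.
exists (D1 + D2), (2 * m); split; [lra|lra|move=> t x tT].
have k3 i : `|8 * k i ^+ 3 * t| <= 8 * k i ^+ 3 * `|T|.
  have k30 : 0 <= 8 * k i ^+ 3 by rewrite mulr_ge0// exprn_ge0// ltW.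
  by rewrite normrM (ger0_norm k30) ler_wpM2l// (le_trans tT)// ler_norm.
have [x0|x0] := leP 0 x.
  apply: le_trans (_ : D1 * expR (- (2 * m) * `|x|) <= _); last first.
    by rewrite ler_wpM2r ?expR_ge0//; lra.
  apply: le_trans (rr_le_sqr _) _; rewrite big_distrl; apply: ler_sum => i _ /=.
  rewrite alsq -[leRHS]mulrA ler_wpM2l ?sqr_ge0// -expRD ler_expR (ger0_norm x0).
  have := ler_wpM2r x0 (hm i); have := k3 i; rewrite ler_norml => /andP[_]; lra.
apply: le_trans (_ : D2 * expR (- (2 * m) * `|x|) <= _); last first.
  by rewrite ler_wpM2r ?expR_ge0//; lra.
apply: le_trans (hC _ (al0 t x)) _; rewrite /D2 -[leRHS]mulrA ler_wpM2l// big_distrl.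
apply: ler_sum => i _ /=; rewrite alsq invfM -expRN -[leRHS]mulrA ler_wpM2l ?invr_ge0 ?sqr_ge0//.
rewrite -expRD ler_expR (ltr0_norm x0).
have := ler_wpM2l (ltW (m0)) (ltW x0) => _.
have x0' : 0 <= - x by lra.
have := ler_wpM2r x0' (hm i); have := k3 i; rewrite ler_norml => /andP[+ _]; lra.
Qed.

Lemma fe_decay e T j : (2 <= mindeg e)%N -> exists M : R, forall t x, `|t| <= T ->
  `|x ^+ j * fe k g e t x| <= M.
Proof.
move=> e2.
have [D [c [c0 D0 hD]]] := rr_al_decay T.
have K0 : 0 <= \sum_i k i by apply: sumr_ge0 => i _; exact: ltW.
have kK i : k i <= \sum_i k i by apply: le_sum1 => l; exact: ltW.
have [C C0 hC] := eval_bound2 (\sum_i k i) e2.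
have [M hM] := expR_poly_bound j c0.
exists (C * D * M) => t x tT; rewrite normrM normrX.
have h1 : `|fe k g e t x| <= C * (D * expR (- c * `|x|)).
  apply: le_trans (hC _ _ _) _; first exact: rr_le_max.
  by rewrite ler_wpM2l// hD.
apply: le_trans (ler_wpM2l _ h1) _; first by rewrite exprn_ge0.
have := ler_wpM2l (mulr_ge0 C0 D0) (hM x); lra.
Qed.

Lemma fe_seminorm e t j m : (2 <= mindeg e)%N ->
  (schwartz_seminorm j m (fe k g e t) < +oo)%E.
Proof.
move=> e2; have [M hM] := fe_decay `|t| j (mindeg_iter_dx k m e2).
apply: (@le_lt_trans _ _ M%:E); last by rewrite ltry.
apply: ge_ereal_sup => _ [x _ <-].
by rewrite lee_fin fe_derive1n// hM.
Qed.

Lemma fe_schwartz e t : (2 <= mindeg e)%N -> schwartz (fe k g e t).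
Proof.
move=> e2; split => [m x|j m]; last exact: fe_seminorm.
by rewrite fe_derive1n//; exact: der_derivable (fe_dx k0 g _ _ _).
Qed.

Lemma derive1n_lin m (h : R) (f1 f2 f3 : @ex R n) (s t : R) :
  derive1n m (fun x => h^-1 * (fe k g f1 s x - fe k g f2 t x) - fe k g f3 t x) =
  fun x => h^-1 * (fe k g (iter m (dx k) f1) s x - fe k g (iter m (dx k) f2) t x)
     - fe k g (iter m (dx k) f3) t x.
Proof.
elim: m => [//|m IH]; rewrite derive1nS IH; apply/funext => x; apply: der_val.
by apply: derB; [apply: derZ; apply: derB|]; exact: fe_dx.
Qed.

(** Two mean value steps bound the remainder of the difference quotient by |h| times the second time
    derivative, whose weighted size is bounded uniformly over times within distance 1 of [t]. *)
Lemma fe_is_derive e t : (2 <= mindeg e)%N ->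
  schwartz_is_derive (fe k g e) t (fe k g (dt k e) t).
Proof.
move=> e2 j m.
pose f := iter m (dx k) e.
have f2 : (2 <= mindeg (dt k (dt k f)))%N.
  by do 2 apply: mindeg_dt; exact: mindeg_iter_dx.
have [M hM] := fe_decay (`|t| + 1) j f2.
have M0 : 0 <= M.
  by apply: le_trans (hM t 0 _); rewrite ?normr_ge0// lerDl.
have key (h : R) : h != 0 -> `|h| <= 1 ->
  (schwartz_seminorm j m (fun x => h^-1 * (fe k g e (t + h)%R x - fe k g e t x)
     - fe k g (dt k e) t x)%R <= (`|h| * M)%:E)%E.
  move=> h0 h1; apply: ge_ereal_sup => _ [x _ <-].
  rewrite lee_fin derive1n_lin fe_iter_comm// -/f.
  have [s] := @der_MVT _ (fe k g f ^~ x) (fe k g (dt k f) ^~ x) t (t + h)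
    (fun s => fe_dt k0 g f s x).
  rewrite addrAC subrr add0r => sh ->.
  have [r] := @der_MVT _ (fe k g (dt k f) ^~ x) (fe k g (dt k (dt k f)) ^~ x) t s
    (fun s => fe_dt k0 g _ s x).
  move=> rs E; rewrite (mulrC _ h) mulKf// E mulrA normrM mulrC.
  rewrite ler_pM//; apply: hM.
  have := ler_normD (r - t) t; rewrite subrK => rt; apply: le_trans rt _.
  by rewrite addrC lerD2l (le_trans rs)// (le_trans sh).
have sem0 (f' : R -> R) : (0 <= schwartz_seminorm j m f')%E.
  have h1 : (`|(0 : R) ^+ j * derive1n m f' 0|%:E <= schwartz_seminorm j m f')%E.
    by apply: ereal_sup_ubound; exists 0.
  by apply: le_trans h1; rewrite lee_fin.
apply: (@squeeze_cvge _ _ _ _ (cst 0%E) _ (fun h => (`|h| * M)%:E)).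
- near=> h; rewrite sem0/=; apply: key; near: h; first exact: nbhs_dnbhs_neq.
  exact: dnbhs0_le.
- exact: cvg_cst.
- apply: cvg_EFin; first exact: nearW.
  have c0 : h @[h --> (0 : R)^'] --> (0 : R) by apply: cvg_within.
  have c1 : `|h| @[h --> (0 : R)^'] --> (0 : R) by rewrite -[X in _ --> X](@normr0 R R); exact: cvg_norm.
  have c2 : M @[_ --> (0 : R)^'] --> M by exact: cvg_cst.
  by rewrite -[X in _ --> X](mul0r M); exact: cvgM.
Unshelve. all: by end_near. Qed.

Lemma fe_solution e : (2 <= mindeg e)%N -> mKdV (fe k g e) -> schwartz_solution (fe k g e).
Proof.
move=> e2 h; split => //; first exact: fe_smooth.
exists (fun m => fe k g (iter m (dt k) e)); split => // m t.
  exact/fe_schwartz/mindeg_iter_dt.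
exact/fe_is_derive/mindeg_iter_dt.
Qed.

Definition solx := Mul (@Cst R n (- 2)) (Re k 0).

Lemma soliton_fe : soliton k g = fe k g solx.
Proof. by apply/funext => t; apply/funext => x; rewrite /fe /= eval_Re. Qed.

Lemma mindeg_solx : (2 <= mindeg solx)%N.
Proof. by rewrite /= (leq_trans (mindeg_Re k 0))// leq_addl. Qed.

Lemma soliton_schwartz : schwartz_solution (soliton k g).
Proof.
rewrite soliton_fe; apply: fe_solution; first exact: mindeg_solx.
by rewrite -soliton_fe; exact: soliton_mKdV.
Qed.

End Bounds.
End Decay.

(** * Separation of solitons *)

Section LocalLimit.
Context {R : realType} (n : nat) (k : 'I_n -> R).
Hypotheses (k0 : forall i, 0 < k i) (kI : injective k).

Let C := cauchy k.

Lemma cauchy_sym i j : C i j = C j i.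
Proof. by rewrite /C /cauchy addrC. Qed.

Lemma cauchy_eq0 v : \sum_i \sum_j C i j * (v i * v j) <= 0 -> forall i, v i = 0.
Proof.
have [c c0 hc] := cauchy_pos k0 kI => h i.
have := le_trans (hc v) h; rewrite pmulr_rle0// => h1.
have h2 : v i ^+ 2 <= \sum_i v i ^+ 2.
  by apply: (@le_sum1 R n (fun i => v i ^+ 2)) => j; exact: sqr_ge0.
by apply/eqP; rewrite -sqrf_eq0 eq_le sqr_ge0 (le_trans h2 h1).
Qed.

(** Where [E i] is nonzero the real part of the quadratic form kills the unknowns of index [i];
    where [b i] is nonzero the imaginary part does, by positivity of the Cauchy matrix. Zeros of [E]
    appear in the limit of infinite a_i. *)
Lemma scaled_unit (E b : 'I_n -> R) : (forall i, 0 <= E i) ->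
  (forall i, E i != 0 \/ b i != 0) -> pairmx E (fun i j => b i * b j * C i j) \in unitmx.
Proof.
move=> E0 Eb; apply: pairmx_unit => p q s.
have sG i j : b i * b j * C i j = b j * b i * C j i.
  by rewrite cauchy_sym (mulrC (b i)).
have h1 : forall i, E i * (p i ^+ 2 + q i ^+ 2) = 0.
  move=> i; have := solves_re sG s.
  rewrite [RHS]big1 => [|j _]; last by rewrite mul0r.
  move=> e; have h0 j : true -> 0 <= E j * (p j ^+ 2 + q j ^+ 2).
    by rewrite mulr_ge0 ?addr_ge0 ?sqr_ge0.
  exact: (psumr_eq0P (fun j _ => h0 j isT) e).
have [hp hq] : (forall i, b i * p i = 0) /\ (forall i, b i * q i = 0).
  have := solves_im s; rewrite [X in _ = - X]big1 ?oppr0 => [|j _]; last by rewrite mul0r.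
  have -> : \sum_i \sum_j b i * b j * C i j * (p i * p j + q i * q j) =
    \sum_i \sum_j C i j * ((b i * p i) * (b j * p j)) +
    \sum_i \sum_j C i j * ((b i * q i) * (b j * q j)).
    rewrite -big_split; apply: eq_bigr => i _; rewrite -big_split; apply: eq_bigr => j _ /=; ring.
  have [c c0 hc] := cauchy_pos k0 kI.
  have hh v : 0 <= \sum_i \sum_j C i j * (v i * v j).
    apply: le_trans (hc v); rewrite mulr_ge0 ?(ltW c0)// sumr_ge0// => i _; exact: sqr_ge0.
  have := hh (fun i => b i * p i); have := hh (fun i => b i * q i) => h2 h3 h4.
  by split; apply: cauchy_eq0; lra.
have z i : p i = 0 /\ q i = 0.
  have [Ei|bi] := Eb i.
    have /eqP := h1 i; rewrite mulf_eq0 (negbTE Ei)/= => /eqP h.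
    by split; apply/eqP; rewrite -sqrf_eq0; apply/eqP;
      have := sqr_ge0 (p i); have := sqr_ge0 (q i); lra.
  by split; apply/eqP; [have /eqP := hp i|have /eqP := hq i]; rewrite mulf_eq0 (negbTE bi).
by split=> i; case: (z i).
Qed.

(* [gamma] is the Schur complement of the block of indices after [j]. *)
Lemma schur_vector (j : 'I_n) : exists (gamma mu : R) (h : 'I_n -> R),
  [/\ 0 < gamma, mu ^+ 2 = 2 * k j * gamma, \sum_i h i = mu,
      h j = 1 /\ (forall i : 'I_n, (i < j)%N -> h i = 0) &
      (forall i : 'I_n, (j < i)%N -> \sum_l C i l * h l = 0) /\
      \sum_l C j l * h l = gamma].
Proof.
(* [N] sends the wanted vector [h] to the [j]-th basis vector: Cauchy rows after [j], identity rows
   elsewhere. *)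
pose N : 'M[R]_n := \matrix_(i, l) (if (j < i)%N then C i l else (i == l)%:R).
have Ndelta (v : 'cV[R]_n) (i : 'I_n) : (i <= j)%N -> (N *m v) i 0 = v i 0.
  move=> ij; rewrite mxE (bigD1 i)//= big1 => [|l li].
    by rewrite mxE ltnNge ij/= eqxx mul1r addr0.
  by rewrite mxE ltnNge ij/= eq_sym (negbTE li) mul0r.
have NC (v : 'cV[R]_n) (i : 'I_n) : (j < i)%N -> (N *m v) i 0 = \sum_l C i l * v l 0.
  by move=> ij; rewrite mxE; apply: eq_bigr => l _; rewrite mxE ij.
have quad (v : 'I_n -> R) : (forall i : 'I_n, (i < j)%N -> v i = 0) ->
    (forall i : 'I_n, (j < i)%N -> \sum_l C i l * v l = 0) ->
    \sum_i \sum_l C i l * (v i * v l) = v j * \sum_l C j l * v l.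
  move=> v0 Cv0; rewrite (bigD1 j)//= [X in _ + X]big1 ?addr0 => [|i ij].
    by rewrite big_distrr; apply: eq_bigr => l _ /=; ring.
  have -> : \sum_l C i l * (v i * v l) = v i * \sum_l C i l * v l.
    by rewrite big_distrr; apply: eq_bigr => l _ /=; ring.
  move: ij; rewrite -val_eqE/= neq_ltn => /orP[/v0 ->|/Cv0 ->]; by rewrite ?mul0r ?mulr0.
have uN : N \in unitmx.
  rewrite -unitmx_tr -row_free_unit -kermx_eq0; apply/eqP/row_matrixP => i.
  have : row i (kermx N^T) *m N^T = 0 by rewrite -row_mul mulmx_ker row0.
  rewrite row0; move: (row i _) => v.
  move/(congr1 trmx); rewrite trmx_mul trmxK trmx0 => /matrixP hv.
  have v0 (l : 'I_n) : (l <= j)%N -> v 0 l = 0.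
    by move=> lj; have := hv l 0; rewrite Ndelta// !mxE.
  have vC (l : 'I_n) : (j < l)%N -> \sum_m C l m * v 0 m = 0.
    move=> lj; have := hv l 0; rewrite NC// mxE => e.
    by rewrite -[RHS]e; apply: eq_bigr => m _; rewrite mxE.
  apply/matrixP => a b; rewrite (ord1 a) [RHS]mxE.
  apply: (@cauchy_eq0 (fun l => v 0 l)).
  by rewrite quad ?v0 ?mul0r// => l lj; apply: v0; exact: ltnW.
pose hv := invmx N *m delta_mx j (0 : 'I_1).
have Nh : N *m hv = delta_mx j 0 by rewrite mulKVmx.
pose h i := hv i 0.
have hj : h j = 1 by rewrite /h -(Ndelta hv)// Nh mxE !eqxx.
have h0 (i : 'I_n) : (i < j)%N -> h i = 0.
  by move=> ij; rewrite /h -(Ndelta hv)// 1?ltnW// Nh mxE -val_eqE /= ltn_eqF.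
have hC (i : 'I_n) : (j < i)%N -> \sum_l C i l * h l = 0.
  by move=> ij; rewrite -(NC hv)// Nh mxE -val_eqE /= gtn_eqF.
have gE : \sum_i \sum_l C i l * (h i * h l) = \sum_l C j l * h l.
  by rewrite quad// hj mul1r.
exists (\sum_l C j l * h l), (\sum_i h i), h; split => //.
- rewrite ltNge; apply/negP; rewrite -gE => /cauchy_eq0/(_ j); rewrite hj.
  by move/eqP; rewrite oner_eq0.
(* Since (k_i + k_l) C_il = 1, mu^2 is the form of K C + C K at [h]; each half is k_j gamma, because
   [h] vanishes before [j] and C h after [j]. *)
- have kC : \sum_i \sum_l (k i + k l) * C i l * (h i * h l) = (\sum_i h i) ^+ 2.
    rewrite expr2 big_distrl; apply: eq_bigr => i _; rewrite big_distrr.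
    apply: eq_bigr => l _ /=; rewrite /C /cauchy divff ?mul1r// gt_eqF// addr_gt0//.
  rewrite -kC.
  have half : \sum_i \sum_l k i * C i l * (h i * h l) = k j * \sum_l C j l * h l.
    rewrite (bigD1 j)//= [X in _ + X]big1 ?addr0 => [|i ij].
      by rewrite big_distrr; apply: eq_bigr => l _ /=; rewrite hj; ring.
    have -> : \sum_l k i * C i l * (h i * h l) = k i * h i * \sum_l C i l * h l.
      by rewrite big_distrr; apply: eq_bigr => l _ /=; ring.
    move: ij; rewrite -val_eqE/= neq_ltn => /orP[/h0 ->|/hC ->]; by rewrite ?mulr0 ?mul0r.
  have half' : \sum_i \sum_l k l * C i l * (h i * h l) = k j * \sum_l C j l * h l.
    rewrite exchange_big -half; apply: eq_bigr => i _; apply: eq_bigr => l _.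
    by rewrite cauchy_sym (mulrC (h l)).
  rewrite -mulrA mulr2n mulrDl !mul1r -{1}half -half' -big_split.
  apply: eq_bigr => i _; rewrite -big_split; apply: eq_bigr => l _ /=; ring.
Qed.

Section Limit.
Variable j : 'I_n.
Variables (gamma mu : R) (h : 'I_n -> R).
Hypotheses (mu2 : mu ^+ 2 = 2 * k j * gamma) (hmu : \sum_i h i = mu)
  (hj : h j = 1) (h0 : forall i : 'I_n, (i < j)%N -> h i = 0)
  (hC : forall i : 'I_n, (j < i)%N -> \sum_l C i l * h l = 0)
  (hg : \sum_l C j l * h l = gamma).

(** Coefficients of the system after the unknowns of index beyond [j] are multiplied by a_i and
    their rows divided by a_i. Beyond [j], [w i] stands for 1 / a_i, before [j] for a_i, and [z] is
    a_j; the limit is w = 0. *)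
Let E (w : 'I_n -> R) (i : 'I_n) : R := if (j < i)%N then w i ^+ 2 else 1.
Let b (w : 'I_n -> R) (z : R) (i : 'I_n) : R := if (j < i)%N then 1 else if i == j then z else w i.

(** The unknowns before [j] vanish. The rows after [j] prescribe C (b q) = - 1 and C (b p) = 0
    there; pairing with the Schur vector [h] eliminates them and leaves a one-soliton system with
    coupling gamma z^2 and source z mu. *)
Lemma limit_system (w : 'I_n -> R) (z : R) p q : (forall i, i != j -> w i = 0) ->
  solves (E w) (fun i l => b w z i * b w z l * C i l) (b w z) p q ->
  (forall i : 'I_n, (i < j)%N -> p i = 0 /\ q i = 0) /\
  p j ^+ 2 + q j ^+ 2 = 2 * k j * (gamma * z ^+ 2) / (1 + (gamma * z ^+ 2) ^+ 2).
Proof.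
move=> w0 [s1 s2].
have Ej : E w j = 1 by rewrite /E ltnn.
have bj : b w z j = z by rewrite /b ltnn eqxx.
have Eg (i : 'I_n) : (j < i)%N -> E w i = 0.
  by move=> ji; rewrite /E ji w0 ?expr0n// -val_eqE/= gtn_eqF.
have bg (i : 'I_n) : (j < i)%N -> b w z i = 1 by move=> ji; rewrite /b ji.
have El (i : 'I_n) : (i < j)%N -> E w i = 1 by move=> ij; rewrite /E ltnNge (ltnW ij).
have bl (i : 'I_n) : (i < j)%N -> b w z i = 0.
  by move=> ij; rewrite /b ltnNge (ltnW ij)/= -val_eqE/= ltn_eqF// w0// -val_eqE/= ltn_eqF.
split.
  move=> i ij; have := s1 i; have := s2 i; rewrite El// bl//.
  rewrite !big1 => [|l _|l _]; rewrite ?mul0r//; lra.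
pose D (v : 'I_n -> R) i := \sum_l C i l * (b w z l * v l).
have DE v i : \sum_l b w z i * b w z l * C i l * v l = b w z i * D v i.
  by rewrite /D big_distrr; apply: eq_bigr => l _ /=; ring.
have hD v : \sum_i h i * D v i = gamma * (z * v j).
  rewrite /D; under eq_bigr do rewrite big_distrr/=.
  rewrite exchange_big/= (bigD1 j)//= [X in _ + X]big1 ?addr0 => [|l lj].
    under eq_bigr do rewrite bj mulrA.
    rewrite -big_distrl/= -hg; congr (_ * _); apply: eq_bigr => i _.
    by rewrite cauchy_sym mulrC.
  have -> : \sum_i h i * (C i l * (b w z l * v l)) = (\sum_i C l i * h i) * (b w z l * v l).
    by rewrite big_distrl; apply: eq_bigr => i _ /=; rewrite cauchy_sym; ring.
  by move: lj; rewrite -val_eqE/= neq_ltn => /orP[/bl ->|/hC ->]; rewrite ?mul0r ?mulr0.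
have hsplit (v : 'I_n -> R) (c : R) : (forall i : 'I_n, (j < i)%N -> v i = c) ->
    \sum_i h i * v i = v j + (mu - 1) * c.
  move=> vc; rewrite (bigD1 j)//= hj mul1r -hmu [in RHS](bigD1 j)//= hj addrAC subrr add0r.
  congr (_ + _); rewrite big_distrl; apply: eq_bigr => i ij /=.
  by move: ij; rewrite -val_eqE/= neq_ltn => /orP[/h0 ->|/vc ->]; rewrite ?mul0r.
have Dq (i : 'I_n) : (j < i)%N -> D q i = - 1.
  by move=> ji; have := s1 i; rewrite DE Eg// bg//; lra.
have Dp (i : 'I_n) : (j < i)%N -> D p i = 0.
  by move=> ji; have := s2 i; rewrite DE Eg// bg//; lra.
have eq_ := hD q; rewrite (hsplit _ _ Dq) in eq_.
have ep := hD p; rewrite (hsplit _ _ Dp) in ep.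
have r1 := s1 j; rewrite DE Ej bj in r1.
have r2 := s2 j; rewrite DE Ej bj in r2.
pose G := gamma * z ^+ 2.
have e1 : p j - G * q j = z * mu.
  have Dqj : D q j = gamma * (z * q j) + (mu - 1) by lra.
  by move: r1; rewrite Dqj /G; lra.
have e2 : q j = - G * p j.
  have Dpj : D p j = gamma * (z * p j) by lra.
  by move: r2; rewrite Dpj /G; lra.
have G1 : 0 < 1 + G ^+ 2 by have := sqr_ge0 G; lra.
have e3 : p j * (1 + G ^+ 2) = z * mu by rewrite -e1 e2; ring.
apply: (mulIf (lt0r_neq0 G1)).
rewrite -/G divfK ?gt_eqF// e2.
apply: (mulIf (lt0r_neq0 G1)).
have -> : (p j ^+ 2 + (- G * p j) ^+ 2) * (1 + G ^+ 2) * (1 + G ^+ 2) =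
  (p j * (1 + G ^+ 2)) ^+ 2 * (1 + G ^+ 2) by ring.
by rewrite e3 exprMn mu2 /G; ring.
Qed.

Lemma local_limit_at (a : nat -> 'I_n -> R) (z : R) : 0 < z ->
  (forall m i, 0 < a m i) -> (forall m, a m j = z) ->
  (forall i : 'I_n, (i < j)%N -> a m i @[m --> \oo] --> 0) ->
  (forall i : 'I_n, (j < i)%N -> (a m i)^-1 @[m --> \oo] --> 0) ->
  forall i, ps k (a m) i ^+ 2 + qs k (a m) i ^+ 2 @[m --> \oo] -->
    if i == j then 2 * k j * (gamma * z ^+ 2) / (1 + (gamma * z ^+ 2) ^+ 2) else 0.
Proof.
move=> z0 a0 aj al ar.
pose w (s : option nat) (i : 'I_n) : R := if s is Some m then
  (if (i < j)%N then a m i else if (j < i)%N then (a m i)^-1 else 0) else 0.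
(* [None] adjoins the limit to the parameters. Convergence to the value there is closed under the
   field operations, so Cramer's rule passes the limit through the system. *)
pose P (f : option nat -> R) := f (Some m) @[m --> \oo] --> f None.
have Pc c : P (fun=> c) by exact: cvg_cst.
have PD f f' : P f -> P f' -> P (fun s => f s + f' s) by move=> *; exact: cvgD.
have PM f f' : P f -> P f' -> P (fun s => f s * f' s) by move=> *; exact: cvgM.
have PV f : P f -> (forall s, f s != 0) -> P (fun s => (f s)^-1).
  by move=> *; apply: cvgV.
have Pw i : P (fun s => w s i).
  rewrite /P /w /=; case: (ltngtP (i : nat) j) => ij; [exact: al|exact: ar|exact: cvg_cst].
have PE i : P (fun s => E (w s) i).
  rewrite /E; case: (j < i)%N; last exact: Pc.
  exact: (PM _ _ (Pw i) (Pw i)).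
have Pb i : P (fun s => b (w s) z i).
  by rewrite /b; case: (j < i)%N; [exact: Pc|case: (i == j); [exact: Pc|exact: Pw]].
pose G s i l := b (w s) z i * b (w s) z l * C i l.
have PG i l : P (fun s => G s i l) by exact: (PM _ _ (PM _ _ (Pb i) (Pb l)) (Pc _)).
have uM s : pairmx (E (w s)) (G s) \in unitmx.
  apply: scaled_unit => i.
    by rewrite /E; case: ifP => _; rewrite ?sqr_ge0.
  rewrite /E /b; case: ifP => _; [right|left]; exact: oner_neq0.
pose p s := repart (E (w s)) (G s) (b (w s) z).
pose q s := impart (E (w s)) (G s) (b (w s) z).
have Ppq i := pairsol_closed Pc PD PM PV PE PG Pb uM i.
have ss s : solves (E (w s)) (G s) (b (w s) z) (p s) (q s) by exact: pairsolP.
(* [alpha] undoes the rescaling of the unknowns. *)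
pose alpha (m : nat) (i : 'I_n) : R := if (j < i)%N then a m i else 1.
have al0 m i : alpha m i != 0.
  by rewrite /alpha; case: ifP => _; rewrite ?oner_eq0// gt_eqF.
have aE m i : a m i = alpha m i * b (w (Some m)) z i.
  rewrite /alpha /b /w /=; case: (ltngtP (i : nat) j) => ij; rewrite ?mul1r ?mulr1//.
    by rewrite -val_eqE/= ltn_eqF.
  have -> : i = j by exact: val_inj.
  by rewrite eqxx aj.
have EE m i : E (w (Some m)) i = (alpha m i ^+ 2)^-1.
  rewrite /E /alpha /w /=; case: (ltngtP (i : nat) j) => ij; rewrite ?expr1n ?invr1//.
  by rewrite exprVn.
have psE m i : ps k (a m) i = p (Some m) i / alpha m i /\
               qs k (a m) i = q (Some m) i / alpha m i.
  suff [h1 h2] : (fun i => p (Some m) i / alpha m i) =1 ps k (a m) /\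
     (fun i => q (Some m) i / alpha m i) =1 qs k (a m) by rewrite -h1 -h2.
  apply: sys_uniq; have [s1 s2] := ss (Some m).
  have GA (v : 'I_n -> R) i' : \sum_l cmx k (a m) i' l * (v l / alpha m l) =
      alpha m i' * \sum_l G (Some m) i' l * v l.
    rewrite big_distrr; apply: eq_bigr => l _ /=.
    rewrite /cmx (aE m i') (aE m l) /G -/C; field; exact: al0.
  have EA (v : 'I_n -> R) i' : ones i' * (v i' / alpha m i') = alpha m i' * (E (w (Some m)) i' * v i').
    by rewrite /ones EE; field; exact: al0.
  split=> i'; rewrite EA GA -?mulrBr -?mulrDr.
    by rewrite s1 -aE.
  by rewrite s2 mulr0.
move=> i.
have -> : (fun m => ps k (a m) i ^+ 2 + qs k (a m) i ^+ 2) =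
    fun m => E (w (Some m)) i * (p (Some m) i * p (Some m) i + q (Some m) i * q (Some m) i).
  by apply/funext => m; have [-> ->] := psE m i; rewrite EE; field; exact: al0.
have [pp0 pj] := @limit_system (w None) z (p None) (q None) (fun _ _ => erefl) (ss None).
have -> : (if i == j then 2 * k j * (gamma * z ^+ 2) / (1 + (gamma * z ^+ 2) ^+ 2) else 0) =
    E (w None) i * (p None i * p None i + q None i * q None i).
  case: eqP => [->|/eqP]; first by rewrite -pj /E ltnn; ring.
  rewrite -val_eqE/= neq_ltn => /orP[/pp0[-> ->]|ji]; first by ring.
  by rewrite /E ji /= expr0n/= mul0r.
by case: (Ppq i) => Pp Pq; exact: (PM _ _ (PE i) (PD _ _ (PM _ _ Pp Pp) (PM _ _ Pq Pq))).
Qed.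
End Limit.

(** [gamma] is fixed before the sequence [a], so that phases can be normalised by it; it records the
    shift of soliton [j] caused by those of larger index. *)
Lemma local_limit : exists gamma : 'I_n -> R, (forall j, 0 < gamma j) /\
  forall j (a : nat -> 'I_n -> R) (z : R), 0 < z ->
  (forall m i, 0 < a m i) -> (forall m, a m j = z) ->
  (forall i : 'I_n, (i < j)%N -> a m i @[m --> \oo] --> 0) ->
  (forall i : 'I_n, (j < i)%N -> (a m i)^-1 @[m --> \oo] --> 0) ->
  forall i, ps k (a m) i ^+ 2 + qs k (a m) i ^+ 2 @[m --> \oo] -->
    if i == j then 2 * k j * (gamma j * z ^+ 2) / (1 + (gamma j * z ^+ 2) ^+ 2) else 0.
Proof.
have ex j := schur_vector j.
have [gamma hg] := @choice _ _ _ ex.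
exists gamma; split=> [j|j a z]; have [mu [h []]] := hg j => //.
move=> g0 mu2 hmu [hj h0] [hC hgj].
exact: (local_limit_at mu2 hmu hj h0 hC hgj).
Qed.

End LocalLimit.

Section Limits.
Context {R : realType}.

Lemma cvg_sumr (n : nat) (u : 'I_n -> nat -> R) (l : 'I_n -> R) :
  (forall i, u i m @[m --> \oo] --> l i) ->
  \sum_i u i m @[m --> \oo] --> \sum_i l i.
Proof. by move=> h; apply: cvg_big => //; exact: add_continuous. Qed.

Lemma cvg0_bounded (u v : nat -> R) (B : R) : u m @[m --> \oo] --> 0 ->
  (forall m, `|v m| <= B) -> u m * v m @[m --> \oo] --> 0.
Proof.
move=> hu hv; apply: norm_cvg0.
have hu' : `|u m| * B @[m --> \oo] --> 0.
  have hn : `|u m| @[m --> \oo] --> (0 : R).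
    by rewrite -[X in _ --> X](@normr0 R R); exact: cvg_norm.
  by rewrite -[X in _ --> X](mul0r B); apply: cvgM => //; exact: cvg_cst.
apply: (squeeze_cvgr _ (cvg_cst 0) hu'); near=> l.
by rewrite normr_ge0/= normrM ler_wpM2l.
Unshelve. all: by end_near. Qed.

Lemma cvg0_sum (n : nat) (u : 'I_n -> nat -> R) :
  (forall i, u i m @[m --> \oo] --> 0) -> \sum_i u i m @[m --> \oo] --> 0.
Proof. by move=> /cvg_sumr; rewrite big1. Qed.

Lemma cvg_minr (T : Type) (F : set_system T) (FF : Filter F) (u v : T -> R) (l c : R) :
  u m @[m --> F] --> l -> v m @[m --> F] --> c ->
  Num.min (u m) (v m) @[m --> F] --> Num.min l c.
Proof.
move=> hu hv; have e (x y : R) : Num.min x y = (x + y - `|x - y|) / 2.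
  have [xy|xy] := leP x y.
    by rewrite ler0_norm ?subr_le0//; field.
  by rewrite gtr0_norm ?subr_gt0//; field.
rewrite e (_ : (fun m => _) = fun m => (u m + v m - `|u m - v m|) / 2).
  apply: cvgM; last exact: cvg_cst.
  by apply: cvgB; [exact: cvgD|apply: cvg_norm; exact: cvgB].
by apply/funext => m; exact: e.
Qed.

Lemma cvg_expRN (u : nat -> R) : u m @[m --> \oo] --> +oo ->
  expR (- u m) @[m --> \oo] --> 0.
Proof. by move=> h; exact: (cvg_comp _ _ h (@cvgr_expR R)). Qed.

Lemma cvgy_scale (c : R) (d : R) (u : nat -> R) : 0 < c -> u m @[m --> \oo] --> +oo ->
  c * u m + d @[m --> \oo] --> +oo.
Proof.
move=> c0 /cvgryPge h; apply/cvgryPge => A; near=> m.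
rewrite -lerBlDr -ler_pdivrMl//; near: m; exact: h.
Unshelve. all: by end_near. Qed.

(** After translation by [y m] the minimum is dominated by [g], so pointwise convergence suffices.
    Only the common part is seen: mass of [f m] located elsewhere is left out. *)
Lemma shift_min_cvg (f : nat -> R -> R) (g : R -> R) (y : nat -> R) :
  (forall m, continuous (f m)) -> (forall m x, 0 <= f m x) -> (forall x, 0 <= g x) ->
  (forall m, tame (f m)) -> continuous g -> tame g ->
  (forall x, f m (x + y m) @[m --> \oo] --> g x) ->
  itg (fun x => Num.min (f m x) (g (x - y m))) @[m --> \oo] --> itg g.
Proof.
move=> cf f0 g0 tf cg tg fg; have [mg [C gC]] := tg.
have cm m : continuous (fun x => Num.min (f m x) (g (x - y m))).
  move=> x; apply: cvg_minr; first exact: cf.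
  apply: continuous_comp; last exact: cg.
  by apply: cvgB; [exact: cvg_id|exact: cvg_cst].
have cm' m : continuous (fun x => Num.min (f m (x + y m)) (g x)).
  move=> x; apply: cvg_minr; last exact: cg.
  apply: continuous_comp; last exact: cf.
  by apply: cvgD; [exact: cvg_id|exact: cvg_cst].
rewrite (_ : (fun m => _) = fun m => itg (fun x => Num.min (f m (x + y m)) (g x))).
  apply: (@itg_cvg _ _ _ C).
  - by move=> m; exact: continuous_measurable_fun.
  - move=> m x; apply: le_trans (gC x).
    by rewrite !ger0_norm ?le_min ?f0 ?g0// ge_min lexx orbT.
  - move=> x; rewrite -[X in _ --> X](@min_r _ _ (g x) (g x))//.
    by apply: cvg_minr => //; exact: cvg_cst.
apply/funext => m; rewrite -(itg_shift (y m) (cm m)).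
  by congr itg; apply/funext => x; rewrite addrK.
by apply: tame_min => //; exact: (tame_shift (- y m) tg).
Qed.

End Limits.

(** * Trace identities for the profile at time 0 *)

Section Profile.
Context {R : realType}.

Section Identities.
Context (n : nat) (k : 'I_n -> R).
Hypotheses (k0 : forall i, 0 < k i) (kI : injective k).
Variable g : 'I_n -> R.
Hypothesis g0 : forall i, 0 < g i.

Let p := pp k g 0.
Let q := qq k g 0.

Definition rho i x := pp k g 0 x i ^+ 2 + qq k g 0 x i ^+ 2.
Definition rs x := rr k (al k g 0 x).

Lemma rsE x : rs x = \sum_i rho i x. Proof. by []. Qed.

Lemma rho_ge0 i x : 0 <= rho i x.
Proof. by rewrite addr_ge0 ?sqr_ge0. Qed.

Lemma rs_ge0 x : 0 <= rs x.
Proof. exact: rr_ge0. Qed.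

Lemma rho_le_rs i x : rho i x <= rs x.
Proof. by rewrite rsE; apply: (@le_sum1 R n (rho^~ x)) => j; exact: rho_ge0. Qed.

Let K := \sum_i k i.

Lemma sum_k_ge0 : 0 <= K.
Proof. by apply: sumr_ge0 => i _; exact: ltW. Qed.

Lemma rs_le x : rs x <= K.
Proof. by apply: (rr_le_max k0 _ sum_k_ge0) => i; apply: le_sum1 => j; exact: ltW. Qed.

Lemma rs_decay : exists D c : R, [/\ 0 < c, 0 <= D & forall x, rs x <= D * expR (- c * `|x|)].
Proof.
have [D [c [c0 D0 h]]] := rr_al_decay k0 g0 kI 0.
by exists D, c; split => // x; apply: h; rewrite normr0.
Qed.

Lemma fe_tame e : (2 <= mindeg e)%N -> tame (fe k g e 0).
Proof.
move=> e2.
have [M0 h0] := fe_decay k0 g0 kI 0 0 e2.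
have [M2 h2] := fe_decay k0 g0 kI 0 2 e2.
apply: (@tame_cont _ _ (M0 + M2)).
  by move=> x; exact: der_cont (fe_dx k0 g e 0 x).
move=> x; rewrite /bell ler_pdivlMr; last by have := sqr_ge0 x; lra.
have n0 : `|(0 : R)| <= 0 by rewrite normr0.
have := h0 0 x n0; have := h2 0 x n0.
by rewrite !normrM expr0 normr1 mul1r -expr2 real_normK ?num_real//; lra.
Qed.

Definition rhox i : ex n := Add (@Mul R n (Pe i) (Pe i)) (Mul (Qe i) (Qe i)).

Lemma rho_fe i : rho i = fe k g (rhox i) 0.
Proof. by apply/funext => x; rewrite /fe /= /rho !expr2. Qed.

Lemma rho_cont i : continuous (rho i).
Proof. by move=> x; rewrite rho_fe; exact: der_cont (fe_dx k0 g _ 0 x). Qed.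

Lemma rho_tame i : tame (rho i).
Proof. by rewrite rho_fe; exact: fe_tame. Qed.

Lemma rs_fe : rs = fe k g (Re k 0) 0.
Proof. by apply/funext => x; rewrite /fe eval_Re /rs rrE. Qed.

Lemma rs_cont : continuous rs.
Proof. by move=> x; rewrite rs_fe; exact: der_cont (fe_dx k0 g _ 0 x). Qed.

Lemma rs_tame : tame rs.
Proof. by rewrite rs_fe; apply: fe_tame; exact: mindeg_Re. Qed.

Lemma cvg_expN_nat (c : R) : 0 < c -> expR (- c * `|n%:R|) @[n --> \oo] --> (0 : R).
Proof.
move=> c0; rewrite (_ : (fun n => _) = fun n => expR (- (c * n%:R + 0))).
  by apply: cvg_expRN; apply: cvgy_scale => //; exact: cvgr_idn.
by apply/funext => m; rewrite addr0 mulNr ger0_norm.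
Qed.

Lemma decay_cvg0 (f : R -> R) (D c : R) : 0 < c ->
  (forall x, `|f x| <= D * expR (- c * `|x|)) ->
  f n%:R @[n --> \oo] --> 0 /\ f (- n%:R) @[n --> \oo] --> 0.
Proof.
move=> c0 h.
have z : D * expR (- c * `|n%:R|) @[n --> \oo] --> (0 : R).
  by rewrite -[X in _ --> X](mulr0 D); apply: cvgM; [exact: cvg_cst|exact: cvg_expN_nat].
split; apply: norm_cvg0.
- apply: (squeeze_cvgr _ (cvg_cst 0) z); near=> m; rewrite normr_ge0/=.
  exact: h.
- apply: (squeeze_cvgr _ (cvg_cst 0) z); near=> m; rewrite normr_ge0/=.
  by apply: le_trans (h _) _; rewrite normrN.
Unshelve. all: by end_near. Qed.

(** R_0^2 is half the derivative of F = sum_i a_i q_i, which vanishes at +oo. At -oo the a_i blow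
    up, the rows of the system force C (a q) to tend to - 1 for the Cauchy matrix C, and F tends to
    - <1, C^-1 1> = - 2 sum_i k_i. *)
Lemma itg_rs_sqr : itg (fun x => rs x ^+ 2) = K.
Proof.
pose F x := \sum_i al k g 0 x i * qq k g 0 x i.
have dF x : der x F (2 * rs x ^+ 2).
  apply: der_eq (der_sum _ _ (fun i => derM (der_al_x k g 0 x i) (der_pq_x k0 g 0 x i).2)) _.
  transitivity (2 * rs x * \sum_i al k g 0 x i * pp k g 0 x i); last first.
    by rewrite -[X in _ * X](rr_mom k) -/(rs x); ring.
  rewrite big_distrr; apply: eq_bigr => i _ /=.
  rewrite /dxq -[Rsum _ _ _ _]rrE -/(rs x); ring.
have al0 x i : 0 < al k g 0 x i by rewrite mulr_gt0 ?expR_gt0.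
have [D [c [c0 D0 hr]]] := rs_decay.
have [m m0 hm] := pos_lbound k0.
have alE x i : al k g 0 x i = g i * expR (- k i * x) by rewrite /al mulr0 addr0.
have cv_al i : al k g 0 n%:R i @[n --> \oo] --> 0.
  rewrite (_ : (fun l => _) = fun l => expR (- k i * `|l%:R|) * g i).
    by apply: (cvg0_bounded (B := `|g i|)) => //; exact: cvg_expN_nat.
  by apply/funext => l; rewrite alE [LHS]mulrC ger0_norm.
have cv_alV i : (al k g 0 (- n%:R) i)^-1 @[n --> \oo] --> 0.
  rewrite (_ : (fun l => _) = fun l => expR (- k i * `|l%:R|) * (g i)^-1).
    by apply: (cvg0_bounded (B := `|(g i)^-1|)) => //; exact: cvg_expN_nat.
  by apply/funext => l; rewrite alE invfM mulrC -expRN ger0_norm//; congr (expR _ * _); ring.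
have qb x i : `|qq k g 0 x i| <= 1 + K /\ `|pp k g 0 x i| <= 1 + K.
  have := rho_le_rs i x; have := rs_le x; rewrite /rho => h1 h2.
  have hK := sum_k_ge0.
  have sq (y : R) : y ^+ 2 <= K -> `|y| <= 1 + K.
    move=> yK; have := sqr_ge0 (`|y| - 1); rewrite sqrrB expr1n mulr1 real_normK ?num_real// => h3.
    have := normr_ge0 y; lra.
  by split; apply: sq; have := sqr_ge0 (qq k g 0 x i); have := sqr_ge0 (pp k g 0 x i); lra.
have Fp : F n%:R @[n --> \oo] --> 0.
  apply: cvg0_sum => i; apply: (cvg0_bounded (B := 1 + K)); first exact: cv_al.
  by move=> l; case: (qb l%:R i).
pose C : 'M[R]_n := \matrix_(i, j) cauchy k i j.
have uC : C \in unitmx.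
  rewrite -unitmx_tr -row_free_unit -kermx_eq0; apply/eqP/row_matrixP => i.
  have : row i (kermx C^T) *m C^T = 0 by rewrite -row_mul mulmx_ker row0.
  rewrite row0; move: (row i _) => v /(congr1 trmx); rewrite trmx_mul trmxK trmx0 => /matrixP hv.
  apply/matrixP => a b; rewrite (ord1 a) [RHS]mxE; apply: (cauchy_eq0 k0 kI).
  rewrite big1// => l _; transitivity (v 0 l * (C *m v^T) l 0).
    by rewrite mxE big_distrr; apply: eq_bigr => l' _ /=; rewrite !mxE; ring.
  by rewrite hv mxE mulr0.
pose one : 'cV[R]_n := const_mx 1.
pose h i := (invmx C *m one) i 0.
have Ch i : \sum_j cauchy k i j * h j = 1.
  have /matrixP/(_ i 0) := mulKVmx uC one; rewrite mxE [RHS]mxE => <-.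
  by apply: eq_bigr => j _; rewrite mxE.
(* Trace of C^-1 (K C + C K) = C^-1 1 1^T, where K is the diagonal matrix of the k_i. *)
have hS : \sum_i h i = 2 * K.
  pose Km : 'M[R]_n := \matrix_(i, j) (if i == j then k i else 0).
  have KC i j : (Km *m C) i j = k i * cauchy k i j.
    rewrite mxE (bigD1 i)//= big1 ?addr0 ?mxE ?eqxx// ?mxE// => l li.
    by rewrite mxE eq_sym (negbTE li) mul0r.
  have CK i j : (C *m Km) i j = k j * cauchy k i j.
    rewrite mxE (bigD1 j)//= big1 ?addr0 ?mxE ?eqxx// ?mxE 1?mulrC// => l li.
    by rewrite [X in _ * X]mxE (negbTE li) mulr0.
  have e : Km *m C + C *m Km = one *m one^T.
    apply/matrixP => i j; rewrite mxE KC CK [RHS]mxE big_ord1 !mxE mulr1 -mulrDl.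
    by rewrite /cauchy divff// gt_eqF// addr_gt0.
  have trK : \tr Km = K by apply: eq_bigr => i _; rewrite mxE eqxx.
  have := congr1 (fun M => \tr (invmx C *m M)) e.
  rewrite mulmxDr linearD /= mulmxA mxtrace_mulC mulmxA mulmxV// mul1mx mulmxA mulVmx// mul1mx trK.
  rewrite mulmxA mxtrace_mulC /mxtrace big_ord1 mxE => e2.
  rewrite mulr2n mulrDl !mul1r e2; apply: eq_bigr => i _.
  by rewrite !mxE mul1r /h mxE.
have Fm : F (- n%:R) @[n --> \oo] --> - (2 * K).
  (* The system paired with h = C^-1 1: the remainder carries the factors 1 / a_i, which vanish at
     -oo. *)
  have FE x : F x = \sum_i (al k g 0 x i)^-1 * (pp k g 0 x i * h i) - 2 * K.
    have [s1 s2] := ps_sys k (al k g 0 x).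
    rewrite -hS -sumrB /F.
    have row1 i : \sum_j cauchy k i j * (al k g 0 x j * qq k g 0 x j) =
        (al k g 0 x i)^-1 * pp k g 0 x i - 1.
      have := s1 i; rewrite /ones mul1r -/(pp k g 0 x) -/(qq k g 0 x).
      have -> : \sum_j cmx k (al k g 0 x) i j * qq k g 0 x j = al k g 0 x i *
          \sum_j cauchy k i j * (al k g 0 x j * qq k g 0 x j).
        by rewrite big_distrr; apply: eq_bigr => j _ /=; rewrite /cmx; ring.
      move=> e; apply: (mulfI (lt0r_neq0 (al0 x i))).
      rewrite mulrBr mulr1 mulrA divff ?gt_eqF// mul1r; lra.
    transitivity (\sum_i h i * \sum_j cauchy k i j * (al k g 0 x j * qq k g 0 x j)).
      under [RHS]eq_bigr do rewrite big_distrr/=.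
      rewrite exchange_big; apply: eq_bigr => j _ /=.
      rewrite -[LHS]mul1r -(Ch j) big_distrl; apply: eq_bigr => i _ /=.
      by rewrite /cauchy (addrC (k j)); ring.
    by apply: eq_bigr => i _; rewrite row1; ring.
  have z : \sum_i (al k g 0 (- l%:R) i)^-1 * (pp k g 0 (- l%:R) i * h i) @[l --> \oo] --> 0.
    apply: cvg0_sum => i; apply: (cvg0_bounded (B := (1 + K) * `|h i|)); first exact: cv_alV.
    by move=> l; rewrite normrM ler_wpM2r//; case: (qb (- l%:R) i).
  rewrite (_ : (fun l => F (- l%:R)) = fun l =>
      \sum_i (al k g 0 (- l%:R) i)^-1 * (pp k g 0 (- l%:R) i * h i) - 2 * K).
    by rewrite -[X in _ --> X]sub0r; exact: (cvgB z (cvg_cst (2 * K))).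
  by apply/funext => l; rewrite FE.
have t2 : tame (fun x => rs x ^+ 2).
  apply: (tame_le _ (tameM rs_tame (rs_tame.1) (M := K) _)).
  - by apply: continuous_measurable_fun => x; apply: cvgM; exact: rs_cont.
  - by move=> x; rewrite ger0_norm ?rs_ge0 ?rs_le.
  - by move=> x; rewrite expr2.
have := @itg_FTC _ (fun x => 2 * rs x ^+ 2) F (- (2 * K)) 0 _ (tameZ 2 t2) dF Fp Fm.
rewrite (itgZ 2 t2) sub0r opprK => E; apply: (mulfI (_ : 2 != 0 :> R)) => //.
apply: E => x; apply: cvgM; first exact: cvg_cst.
by apply: cvgM; exact: rs_cont.
Qed.

Definition betas x := Rsum k 2 (pp k g 0 x) (qq k g 0 x).

Lemma betas_tame : tame betas.
Proof.
rewrite (_ : betas = fe k g (Re k 2) 0); first by apply: fe_tame; exact: mindeg_Re.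
by apply/funext => x; rewrite /fe eval_Re.
Qed.

Lemma rs_cube_tame : tame (fun x => rs x ^+ 3).
Proof.
apply: (tame_le _ (tameZ (K ^+ 2) rs_tame)).
  by apply: continuous_measurable_fun => x; do 2 (apply: cvgM; first exact: rs_cont); exact: rs_cont.
move=> x; rewrite normrX normrM mulrC exprS ler_wpM2l// normrX ger0_norm ?rs_ge0//.
by rewrite ger0_norm ?sum_k_ge0// lerXn2r ?nnegrE ?rs_ge0 ?sum_k_ge0 ?rs_le.
Qed.

(** By [Zsum1], the derivative of M_1 is - 2 R_2 + 4 R_0^3, and M_1 vanishes at both ends. *)
Lemma itg_betas : itg betas = 2 * itg (fun x => rs x ^+ 3).
Proof.
pose F x := Msum k 1 (pp k g 0 x) (qq k g 0 x).
have dF x : der x F (- 2 * betas x + 4 * rs x ^+ 3).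
  apply: der_eq (der_Msum k0 g 1 0 x) _.
  by rewrite (Zsum1 k0 (ps_sys k _)) -/(betas x) -!rrE -/(rs x); field.
have [D [c [c0 D0 hr]]] := rs_decay.
have FK x : `|F x| <= K * rs x.
  rewrite /F /Msum (le_trans (ler_norm_sum _ _ _))// rsE big_distrr; apply: ler_sum => i _ /=.
  rewrite normrM expr1 (gtr0_norm (k0 i)); apply: ler_pM; rewrite ?(ltW (k0 i))//.
  - by apply: le_sum1 => j; exact: ltW.
  - rewrite ler_norml /rho; have := sqr_ge0 (qq k g 0 x i); have := sqr_ge0 (pp k g 0 x i).
    move=> *; apply/andP; split; lra.
have [Fp Fm] : F n%:R @[n --> \oo] --> 0 /\ F (- n%:R) @[n --> \oo] --> 0.
  apply: (@decay_cvg0 F (K * D) c c0) => x; apply: le_trans (FK x) _.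
  by rewrite -mulrA ler_wpM2l ?sum_k_ge0.
have t1 := betas_tame; have t2 := rs_cube_tame.
have cb : continuous betas.
  rewrite (_ : betas = fe k g (Re k 2) 0).
    by move=> x; exact: der_cont (fe_dx k0 g _ 0 x).
  by apply/funext => x; rewrite /fe eval_Re.
have := @itg_FTC _ _ F 0 0 _ (tameD (tameZ (- 2) t1) (tameZ 4 t2)) dF Fp Fm.
rewrite subr0 (itgD (tameZ _ t1) (tameZ _ t2)) !itgZ// => E.
suff : - 2 * itg betas + 4 * itg (fun x => rs x ^+ 3) = 0 by lra.
apply: E => x; apply: cvgD; (apply: cvgM; first exact: cvg_cst); first exact: cb.
by do 2 (apply: cvgM; first exact: rs_cont); exact: rs_cont.
Qed.

End Identities.
End Profile.

(** * Convergence in L^1 to a sum of single solitons *)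

Section Separation.
Context {R : realType}.

(* [bump c x = c / cosh (2 c x)], half the modulus of a single soliton. *)
Definition bump (c x : R) : R :=
  2 * c * expR (- (2 * c) * x) / (1 + expR (- (2 * c) * x) ^+ 2).

Section OneSoliton.
Variable c : R.
Hypothesis c0 : 0 < c.

Let k (_ : 'I_1) := c.
Let g (_ : 'I_1) := Num.sqrt (2 * c).
Let k0 i : 0 < k i. Proof. exact: c0. Qed.
Let kI : injective k. Proof. by move=> i j _; rewrite (ord1 i) (ord1 j). Qed.
Let g0 i : 0 < g i. Proof. by rewrite sqrtr_gt0 mulr_gt0. Qed.

(** The case n = 1; the amplitude sqrt(2 c) centres it at 0. Bounds, decay and trace identities are
    thereby inherited by [bump]. *)
Lemma bump_rs : bump c = rs k g.
Proof.
apply/funext => x.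
pose E := expR (- (2 * c) * x); have E0 : 0 < E by exact: expR_gt0.
have D0 : 1 + E ^+ 2 != 0 by rewrite gt_eqF// ltr_pwDl ?sqr_ge0.
have al2 i : al k g 0 x i ^+ 2 = 2 * c * E.
  rewrite /al exprMn sqr_sqrtr ?mulr_ge0 ?(ltW c0)// -expRM_natl; congr (_ * expR _).
  by rewrite /k; ring.
have [h1 h2] : (fun i => al k g 0 x i / (1 + E ^+ 2)) =1 ps k (al k g 0 x) /\
    (fun i => - E * (al k g 0 x i / (1 + E ^+ 2))) =1 qs k (al k g 0 x).
  have cE i j : cmx k (al k g 0 x) i j = E.
    rewrite (ord1 i) (ord1 j) /cmx -expr2 al2 /cauchy /k.
    rewrite (_ : 2 * c * E = E * (c + c)); last ring.
    by rewrite mulfK// gt_eqF// addr_gt0.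
  by apply: sys_uniq; split=> i; (have -> : i = ord0 by rewrite (ord1 i));
    rewrite big_ord1 cE /ones; field.
rewrite rsE big_ord1 /rho /pp /qq -h1 -h2 /bump -/E.
transitivity (al k g 0 x ord0 ^+ 2 / (1 + E ^+ 2)); first by rewrite al2.
by field.
Qed.

Lemma bump_ge0 x : 0 <= bump c x.
Proof. by rewrite bump_rs rs_ge0. Qed.

Lemma bump_le x : bump c x <= c.
Proof. by rewrite bump_rs (le_trans (rs_le k0 g x))// big_ord1. Qed.

Lemma bump_cont : continuous (bump c).
Proof. by rewrite bump_rs; exact: rs_cont. Qed.

Lemma bump_tame : tame (bump c).
Proof. by rewrite bump_rs; exact: rs_tame. Qed.

Lemma itg_bump_sqr : itg (fun x => bump c x ^+ 2) = c.
Proof. by rewrite bump_rs (itg_rs_sqr k0 kI g0) big_ord1. Qed.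

Lemma itg_bump_cube : c ^+ 2 * itg (bump c) = 2 * itg (fun x => bump c x ^+ 3).
Proof.
rewrite -(itgZ (c ^+ 2) bump_tame) bump_rs -(itg_betas k0 kI g0); congr itg; apply/funext => x.
by rewrite /betas /Rsum big_ord1 rsE big_ord1.
Qed.

Lemma bump_sqr_tame : tame (fun x => bump c x ^+ 2).
Proof.
have -> : (fun x => bump c x ^+ 2) = fun x => bump c x * bump c x.
  by apply/funext => x; rewrite expr2.
apply: (tameM bump_tame (bump_tame.1) (M := c)) => x.
by rewrite ger0_norm ?bump_ge0 ?bump_le.
Qed.

Lemma bump_cube_tame : tame (fun x => bump c x ^+ 3).
Proof.
have -> : (fun x => bump c x ^+ 3) = fun x => bump c x ^+ 2 * bump c x.
  by apply/funext => x; rewrite exprSr.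
apply: (tameM bump_sqr_tame (bump_tame.1) (M := c)) => x.
by rewrite ger0_norm ?bump_ge0 ?bump_le.
Qed.

End OneSoliton.

Section Soliton.
Context (n : nat) (k : 'I_n -> R).
Hypotheses (k0 : forall i, 0 < k i) (kI : injective k).

(* Phases for which soliton [i] is centred at [y i], when the solitons are
   ordered by their indices from left to right. *)
Definition phase (gamma y : 'I_n -> R) i := (Num.sqrt (gamma i))^-1 * expR (k i * y i).

Variable gamma : 'I_n -> R.
Hypothesis gam0 : forall i, 0 < gamma i.
Hypothesis glim : forall j (a : nat -> 'I_n -> R) (z : R), 0 < z ->
  (forall m i, 0 < a m i) -> (forall m, a m j = z) ->
  (forall i : 'I_n, (i < j)%N -> a m i @[m --> \oo] --> 0) ->
  (forall i : 'I_n, (j < i)%N -> (a m i)^-1 @[m --> \oo] --> 0) ->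
  forall i, ps k (a m) i ^+ 2 + qs k (a m) i ^+ 2 @[m --> \oo] -->
    if i == j then 2 * k j * (gamma j * z ^+ 2) / (1 + (gamma j * z ^+ 2) ^+ 2) else 0.

Lemma phase_gt0 y i : 0 < phase gamma y i.
Proof. by rewrite mulr_gt0 ?expR_gt0// invr_gt0 sqrtr_gt0. Qed.

Variable y : nat -> 'I_n -> R.
Hypothesis ysep : forall i j : 'I_n, (i < j)%N -> y m j - y m i @[m --> \oo] --> +oo.

Let g m := phase gamma (y m).
Let g0 m i : 0 < g m i := phase_gt0 (y m) i.

Lemma rho_local i j x : rho k (g m) i (x + y m j) @[m --> \oo] -->
  if i == j then bump (k j) x else 0.
Proof.
pose a m := al k (g m) 0 (x + y m j).
have aE m l : a m l = (Num.sqrt (gamma l))^-1 * expR (k l * (y m l - y m j - x)).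
  by rewrite /a /al /g /phase -[LHS]mulrA -expRD; congr (_ * expR _); ring.
pose z := (Num.sqrt (gamma j))^-1 * expR (- k j * x).
have z0 : 0 < z by rewrite mulr_gt0 ?expR_gt0// invr_gt0 sqrtr_gt0.
have a0 m l : 0 < a m l by rewrite aE mulr_gt0 ?expR_gt0// invr_gt0 sqrtr_gt0.
have aj m : a m j = z by rewrite aE /z subrr sub0r mulrN mulNr.
have gz : gamma j * z ^+ 2 = expR (- (2 * k j) * x).
  rewrite /z exprMn exprVn sqr_sqrtr ?ltW// mulrA divff ?gt_eqF// mul1r -expRM_natl.
  by congr expR; ring.
have al_ (l : 'I_n) : (l < j)%N -> a m l @[m --> \oo] --> 0.
  move=> lj; rewrite (_ : (fun m => _) = fun m =>
      expR (- (k l * (y m j - y m l) + k l * x)) * (Num.sqrt (gamma l))^-1).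
    apply: (cvg0_bounded (B := `|(Num.sqrt (gamma l))^-1|)) => //.
    by apply: cvg_expRN; apply: cvgy_scale => //; exact: ysep.
  by apply/funext => m; rewrite aE mulrC; congr (expR _ * _); ring.
have ar (l : 'I_n) : (j < l)%N -> (a m l)^-1 @[m --> \oo] --> 0.
  move=> jl; rewrite (_ : (fun m => _) = fun m =>
      expR (- (k l * (y m l - y m j) + - (k l * x))) * Num.sqrt (gamma l)).
    apply: (cvg0_bounded (B := `|Num.sqrt (gamma l)|)) => //.
    by apply: cvg_expRN; apply: cvgy_scale => //; exact: ysep.
  apply/funext => m; rewrite aE invfM invrK mulrC -expRN; congr (expR _ * _); ring.
have := @glim j a z z0 a0 aj al_ ar i; rewrite gz.
by [].
Qed.

Lemma rs_local j x : rs k (g m) (x + y m j) @[m --> \oo] --> bump (k j) x.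
Proof.
have -> : bump (k j) x = \sum_i (if i == j then bump (k j) x else 0).
  by rewrite (bigD1 j)//= eqxx big1 ?addr0// => i ij; rewrite (negbTE ij).
by apply: cvg_sumr => i; exact: rho_local.
Qed.

(** Local convergence yields the limits of the common parts [A] and [B]. The second trace identity
    writes the weighted sum of all the L^1 distances through the integral of R^3, the first bounds
    that integral from above by the common parts, and the resulting bound is zero in the limit: no
    mass escapes. *)
Lemma rho_bump_cvg i :
  itg (fun x => `|rho k (g m) i x - bump (k i) (x - y m i)|) @[m --> \oo] --> 0.
Proof.
pose K := \sum_i k i.
have kK l : k l <= K by apply: le_sum1 => j; exact: ltW.
(* Nonnegative because 0 <= R <= K; the sum over [l] is R^2 (K - R). *)
pose f m l x := rho k (g m) l x * (rs k (g m) x * (K - rs k (g m) x)).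
pose G l x := bump (k l) x * (bump (k l) x * (K - bump (k l) x)).
pose A m l := itg (fun x => Num.min (f m l x) (G l (x - y m l))).
pose B m l := itg (fun x => Num.min (rho k (g m) l x) (bump (k l) (x - y m l))).
have rb m x : 0 <= rs k (g m) x <= K by rewrite rs_ge0 rs_le.
have mulb (r : R) : 0 <= r <= K -> 0 <= r * (K - r) <= K * K.
  by move=> /andP[? ?]; rewrite mulr_ge0 ?subr_ge0//= ler_pM ?subr_ge0//; lra.
have f0 m l x : 0 <= f m l x.
  by rewrite mulr_ge0 ?rho_ge0//; have /andP[] := mulb _ (rb m x).
have bb l x : 0 <= bump (k l) x <= K.
  by rewrite bump_ge0//= (le_trans (bump_le (k0 l) x)).
have G0 l x : 0 <= G l x.
  by rewrite mulr_ge0 ?bump_ge0//; have /andP[] := mulb _ (bb l x).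
have ccm (h : R -> R) : continuous h -> continuous (fun x => h x * (K - h x)).
  by move=> ch x; apply: cvgM; [exact: ch|apply: cvgB; [exact: cvg_cst|exact: ch]].
have cf m l : continuous (f m l).
  move=> x; apply: cvgM; first exact: rho_cont.
  exact: (ccm _ (@rs_cont _ _ _ k0 (g m)) x).
have cG l : continuous (G l).
  move=> x; apply: cvgM; first exact: bump_cont.
  exact: (ccm _ (bump_cont (k0 l)) x).
have tf m l : tame (f m l).
  apply: (tameM (rho_tame k0 kI (g0 m) l) (M := K * K)).
    by apply: continuous_measurable_fun; exact: (ccm _ (@rs_cont _ _ _ k0 (g m))).
  by move=> x; have /andP[? ?] := mulb _ (rb m x); rewrite ger0_norm.
have tG l : tame (G l).
  apply: (tameM (bump_tame (k0 l)) (M := K * K)).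
    by apply: continuous_measurable_fun; exact: (ccm _ (bump_cont (k0 l))).
  by move=> x; have /andP[? ?] := mulb _ (bb l x); rewrite ger0_norm.
have rl l x : rho k (g m) l (x + y m l) @[m --> \oo] --> bump (k l) x.
  by have := @rho_local l l x; rewrite eqxx.
have Acv l : A m l @[m --> \oo] --> itg (G l).
  apply: (@shift_min_cvg _ (fun m => f m l) (G l) (fun m => y m l)) => // x.
  apply: cvgM; first exact: rl.
  by apply: cvgM; [exact: rs_local|apply: cvgB; [exact: cvg_cst|exact: rs_local]].
have Bcv l : B m l @[m --> \oo] --> itg (bump (k l)).
  apply: (@shift_min_cvg _ (fun m => rho k (g m) l) _ (fun m => y m l)) => //.
  - by move=> m; exact: rho_cont.
  - by move=> m x; exact: rho_ge0.
  - by move=> x; exact: bump_ge0.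
  - by move=> m; exact: rho_tame.
  - exact: bump_cont.
  - exact: bump_tame.
pose D m l := itg (fun x => `|rho k (g m) l x - bump (k l) (x - y m l)|).
have tb m l : tame (fun x => bump (k l) (x - y m l)).
  exact: (tame_shift (- y m l) (bump_tame (k0 l))).
have itb m l : itg (fun x => bump (k l) (x - y m l)) = itg (bump (k l)).
  by rewrite (itg_shift (- y m l) (bump_cont (k0 l)) (bump_tame (k0 l))).
(* |a - b| = a + b - 2 min(a, b). *)
have DE m l : D m l = itg (rho k (g m) l) + itg (bump (k l)) - 2 * B m l.
  have tr := rho_tame k0 kI (g0 m) l.
  rewrite -(itb m l) -itgD// -itgZ; last exact: tame_min.
  rewrite -itgB; [|exact: tameD|by apply: tameZ; exact: tame_min].
  congr itg; apply/funext => x.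
  have [h|h] := leP (rho k (g m) l x) (bump (k l) (x - y m l)).
    by rewrite ler0_norm ?subr_le0//; ring.
  by rewrite gtr0_norm ?subr_gt0//; ring.
(* R^3 = K R^2 - sum_l f_l, where R^2 has integral K and f_l is at least its common part with the
   translate of G_l. *)
have cube m : itg (fun x => rs k (g m) x ^+ 3) <= K * K - \sum_l A m l.
  have t2 : tame (fun x => rs k (g m) x ^+ 2).
    apply: (tame_le _ (tameM (rs_tame k0 kI (g0 m)) ((rs_tame k0 kI (g0 m)).1) (M := K) _)).
    - by apply: continuous_measurable_fun => x; apply: cvgM; exact: rs_cont.
    - by move=> x; have /andP[? ?] := rb m x; rewrite ger0_norm.
    - by move=> x; rewrite expr2.
  have e : (fun x => rs k (g m) x ^+ 3) =
      fun x => K * rs k (g m) x ^+ 2 - \sum_l f m l x.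
    by apply/funext => x; rewrite /f -big_distrl/= -rsE; ring.
  rewrite e itgB; [|exact: tameZ|exact: tame_sum].
  rewrite itgZ// (itg_rs_sqr k0 kI (g0 m)) itg_sum//.
  rewrite lerD2l lerN2; apply: ler_sum => l _; apply: le_itg => //.
    by apply: tame_min => //; exact: (tame_shift (- y m l) (tG l)).
  by move=> x; rewrite ge_min lexx.
have key m : \sum_l k l ^+ 2 * D m l <= 2 * (K * K - \sum_l A m l)
    + \sum_l (k l ^+ 2 * itg (bump (k l)) - 2 * (k l ^+ 2 * B m l)).
  have -> : \sum_l k l ^+ 2 * D m l = itg (betas k (g m)) +
      \sum_l (k l ^+ 2 * itg (bump (k l)) - 2 * (k l ^+ 2 * B m l)).
    have -> : itg (betas k (g m)) = \sum_l k l ^+ 2 * itg (rho k (g m) l).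
      have tr l : tame (rho k (g m) l) by exact: rho_tame.
      under eq_bigr do rewrite -itgZ//.
      by rewrite -itg_sum// => l; exact: tameZ.
    by rewrite -big_split; apply: eq_bigr => l _ /=; rewrite DE; ring.
  by rewrite lerD2r (itg_betas k0 kI (g0 m)) ler_pM2l.
have GE l : itg (G l) = K * k l - itg (fun x => bump (k l) x ^+ 3).
  have t2 := bump_sqr_tame (k0 l); have t3 := bump_cube_tame (k0 l).
  have -> : K * k l = itg (fun x => K * bump (k l) x ^+ 2).
    by rewrite itgZ// itg_bump_sqr.
  rewrite -itgB//; last exact: tameZ.
  by congr itg; apply/funext => x; rewrite /G; ring.
(* The limit is the same expression for separate single solitons, and it vanishes by their own trace
   identities. *)
have lim0 : 2 * (K * K - \sum_l A m l)
    + \sum_l (k l ^+ 2 * itg (bump (k l)) - 2 * (k l ^+ 2 * B m l)) @[m --> \oo] --> 0.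
  have e0 : 2 * (K * K - \sum_l itg (G l))
    + \sum_l (k l ^+ 2 * itg (bump (k l)) - 2 * (k l ^+ 2 * itg (bump (k l)))) = 0.
    under eq_bigr do rewrite GE.
    rewrite sumrB -big_distrr/= -/K.
    under [X in _ + X]eq_bigr do rewrite (itg_bump_cube (k0 _)).
    by rewrite sumrB -!big_distrr/=; ring.
  rewrite -[X in _ --> X]e0.
  apply: cvgD.
    apply: cvgM; first exact: cvg_cst.
    by apply: cvgB; [exact: cvg_cst|exact: (@cvg_sumr _ _ (fun l m => A m l) _ Acv)].
  apply: (@cvg_sumr _ _ (fun l m => k l ^+ 2 * itg (bump (k l)) - 2 * (k l ^+ 2 * B m l))) => l; apply: cvgB; first exact: cvg_cst.
  by apply: cvgM; [exact: cvg_cst|apply: cvgM; [exact: cvg_cst|exact: Bcv]].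
have k2 : 0 < k i ^+ 2 by rewrite exprn_gt0.
have D0 m l : 0 <= D m l by apply: itg_ge0.
rewrite (_ : (fun m => _) = fun m => (k i ^+ 2 * D m i) * (k i ^+ 2)^-1); last first.
  by apply/funext => m; rewrite mulrC mulKf ?gt_eqF.
apply: (cvg0_bounded (B := `|(k i ^+ 2)^-1|)) => //.
apply: (squeeze_cvgr _ (cvg_cst 0) lim0); near=> m.
rewrite mulr_ge0 ?(ltW k2)//=; apply: le_trans (key m).
apply: (@le_sum1 R n (fun l => k l ^+ 2 * D m l)) => l.
by rewrite mulr_ge0 ?sqr_ge0.
Unshelve. all: by end_near. Qed.

End Soliton.
End Separation.

(** * Fourier transforms *)

Section Fourier.
Context {R : realType}.
Implicit Types (f h : R -> R) (xi : R).

Definition fc f xi := itg (fun x => cos (x * xi) * f x).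
Definition fs f xi := itg (fun x => sin (x * xi) * f x).
Definition modhat f xi := Num.sqrt (fc f xi ^+ 2 + fs f xi ^+ 2).

Definition norm_cst : R := (Num.sqrt (2 * pi))^-1.

Lemma norm_cst_gt0 : 0 < norm_cst.
Proof. by rewrite invr_gt0 sqrtr_gt0 mulr_gt0// pi_gt0. Qed.

Lemma cont_cosM xi : continuous (fun x : R => cos (x * xi)).
Proof.
move=> x; apply: (@continuous_comp _ _ _ (fun x : R => x * xi) cos); last exact: continuous_cos.
by apply: cvgM; [exact: cvg_id|exact: cvg_cst].
Qed.

Lemma cont_sinM xi : continuous (fun x : R => sin (x * xi)).
Proof.
move=> x; apply: (@continuous_comp _ _ _ (fun x : R => x * xi) sin); last exact: continuous_sin.
by apply: cvgM; [exact: cvg_id|exact: cvg_cst].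
Qed.

Lemma tame_cosM f xi : tame f -> tame (fun x => cos (x * xi) * f x).
Proof.
move=> tf; rewrite (_ : (fun x => _) = fun x => f x * cos (x * xi)).
  apply: (tameM tf (M := 1)); last by move=> x; exact: cos_max.
  by apply: continuous_measurable_fun; exact: cont_cosM.
by apply/funext => x; rewrite mulrC.
Qed.

Lemma tame_sinM f xi : tame f -> tame (fun x => sin (x * xi) * f x).
Proof.
move=> tf; rewrite (_ : (fun x => _) = fun x => f x * sin (x * xi)).
  apply: (tameM tf (M := 1)); last by move=> x; exact: sin_max.
  by apply: continuous_measurable_fun; exact: cont_sinM.
by apply/funext => x; rewrite mulrC.
Qed.

Lemma normc_fourier f xi : tame f ->
  ComplexField.Normc.normc (fourier f xi) = norm_cst * modhat f xi.
Proof.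
move=> tf; have ts := tame_sinM xi tf; rewrite /fourier /cintegral /expi /=.
have -> : \int[lebesgue_measure]_x
     (cos (- (x * xi)) * f x - sin (- (x * xi)) * 0) = fc f xi.
  by congr itg; apply/funext => x; rewrite cosN mulr0 subr0.
have -> : \int[lebesgue_measure]_x
     (cos (- (x * xi)) * 0 + sin (- (x * xi)) * f x) = - fs f xi.
  rewrite /fs -itgN//; congr itg; apply/funext => x.
  by rewrite sinN mulr0 add0r mulNr.
rewrite -/norm_cst !mul0r subr0 addr0 mulrN sqrrN !exprMn -mulrDr sqrtrM ?sqr_ge0//.
by rewrite sqrtr_sqr gtr0_norm ?norm_cst_gt0.
Qed.

Lemma modhat_ge0 f xi : 0 <= modhat f xi.
Proof. exact: sqrtr_ge0. Qed.

Lemma sqrt_sum_le (a b : R) : Num.sqrt (a ^+ 2 + b ^+ 2) <= `|a| + `|b|.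
Proof.
rewrite -[leRHS]ger0_norm ?addr_ge0// -sqrtr_sqr ler_wsqrtr//.
rewrite sqrrD !real_normK ?num_real//.
have : 0 <= `|a| * `|b| by rewrite mulr_ge0.
lra.
Qed.

Lemma fc_le f xi : tame f -> `|fc f xi| <= itg (fun x => `|f x|).
Proof.
move=> tf; apply: le_trans (itg_norm (tame_cosM xi tf)) _.
apply: le_itg; [exact/tame_norm/tame_cosM|exact: tame_norm|move=> x].
by rewrite normrM ler_piMl// cos_max.
Qed.

Lemma fs_le f xi : tame f -> `|fs f xi| <= itg (fun x => `|f x|).
Proof.
move=> tf; apply: le_trans (itg_norm (tame_sinM xi tf)) _.
apply: le_itg; [exact/tame_norm/tame_sinM|exact: tame_norm|move=> x].
by rewrite normrM ler_piMl// sin_max.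
Qed.

Lemma modhat_le f xi : tame f -> modhat f xi <= 2 * itg (fun x => `|f x|).
Proof.
move=> tf; apply: le_trans (sqrt_sum_le _ _) _.
by rewrite mulr2n mulrDl mul1r lerD ?fc_le ?fs_le.
Qed.

Lemma fcD f h xi : tame f -> tame h -> fc (fun x => f x + h x) xi = fc f xi + fc h xi.
Proof.
move=> tf th; rewrite -itgD; [|exact: tame_cosM|exact: tame_cosM].
by congr itg; apply/funext => x; rewrite mulrDr.
Qed.

Lemma fsD f h xi : tame f -> tame h -> fs (fun x => f x + h x) xi = fs f xi + fs h xi.
Proof.
move=> tf th; rewrite -itgD; [|exact: tame_sinM|exact: tame_sinM].
by congr itg; apply/funext => x; rewrite mulrDr.
Qed.

Lemma fcZ c f xi : tame f -> fc (fun x => c * f x) xi = c * fc f xi.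
Proof.
move=> tf; rewrite -itgZ; last exact: tame_cosM.
by congr itg; apply/funext => x; rewrite mulrCA.
Qed.

Lemma fsZ c f xi : tame f -> fs (fun x => c * f x) xi = c * fs f xi.
Proof.
move=> tf; rewrite -itgZ; last exact: tame_sinM.
by congr itg; apply/funext => x; rewrite mulrCA.
Qed.

Lemma modhatZ c f xi : tame f -> modhat (fun x => c * f x) xi = `|c| * modhat f xi.
Proof.
move=> tf; rewrite /modhat fcZ// fsZ// !exprMn -mulrDr sqrtrM ?sqr_ge0//.
by rewrite sqrtr_sqr.
Qed.

Lemma minkowski2 (a b c d : R) :
  Num.sqrt ((a + c) ^+ 2 + (b + d) ^+ 2) <=
  Num.sqrt (a ^+ 2 + b ^+ 2) + Num.sqrt (c ^+ 2 + d ^+ 2).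
Proof.
have h1 : 0 <= a ^+ 2 + b ^+ 2 by rewrite addr_ge0 ?sqr_ge0.
have h2 : 0 <= c ^+ 2 + d ^+ 2 by rewrite addr_ge0 ?sqr_ge0.
rewrite -[leRHS]ger0_norm ?addr_ge0 ?sqrtr_ge0// -sqrtr_sqr ler_wsqrtr//.
rewrite [leRHS]sqrrD !sqr_sqrtr// -sqrtrM//.
have : a * c + b * d <= Num.sqrt ((a ^+ 2 + b ^+ 2) * (c ^+ 2 + d ^+ 2)).
  apply: le_trans (ler_norm _) _; rewrite -sqrtr_sqr ler_wsqrtr//.
  by have := sqr_ge0 (a * d - b * c); lra.
lra.
Qed.

Lemma modhatD f h xi : tame f -> tame h ->
  modhat (fun x => f x + h x) xi <= modhat f xi + modhat h xi.
Proof. by move=> tf th; rewrite /modhat fcD// fsD//; exact: minkowski2. Qed.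

Lemma continuous_fc f : tame f -> continuous (fc f) /\ continuous (fs f).
Proof.
move=> tf; split=> [a|a].
- have I : a \in `]a - 1, a + 1[%classic by rewrite inE/= in_itv/=; apply/andP; split; lra.
  apply: (@continuity_under_integral _ _ _ lebesgue_measure
    (fun xi x => cos (x * xi) * f x) setT measurableT (a - 1) (a + 1) _ _
    (fun x => `|f x|) _ _ _ I).
  + by move=> xi _; exact/tame_integrable/tame_cosM.
  + apply: aeW => x _ xi _; apply: cvgM; last exact: cvg_cst.
    apply: (@continuous_comp _ _ _ (fun xi : R => x * xi) cos); last exact: continuous_cos.
    by apply: cvgM; [exact: cvg_cst|exact: cvg_id].
  + exact/tame_integrable/tame_norm.
  + by move=> xi _; apply: aeW => x _; rewrite normrM ler_piMl// cos_max.
- have I : a \in `]a - 1, a + 1[%classic by rewrite inE/= in_itv/=; apply/andP; split; lra.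
  apply: (@continuity_under_integral _ _ _ lebesgue_measure
    (fun xi x => sin (x * xi) * f x) setT measurableT (a - 1) (a + 1) _ _
    (fun x => `|f x|) _ _ _ I).
  + by move=> xi _; exact/tame_integrable/tame_sinM.
  + apply: aeW => x _ xi _; apply: cvgM; last exact: cvg_cst.
    apply: (@continuous_comp _ _ _ (fun xi : R => x * xi) sin); last exact: continuous_sin.
    by apply: cvgM; [exact: cvg_cst|exact: cvg_id].
  + exact/tame_integrable/tame_norm.
  + by move=> xi _; apply: aeW => x _; rewrite normrM ler_piMl// sin_max.
Qed.

Lemma continuous_modhat f : tame f -> continuous (modhat f).
Proof.
move=> tf xi; have [cc cs] := continuous_fc tf.
apply: (@continuous_comp _ _ _ (fun xi : R => fc f xi ^+ 2 + fs f xi ^+ 2) Num.sqrt).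
  by apply: cvgD; [apply: cvgM; exact: cc|apply: cvgM; exact: cs].
exact: sqrt_continuous.
Qed.

(** [F] lists a function with all its derivatives, so that bounds on high derivatives can be quoted
    without iterating [derive1]. *)
Definition nice (F : nat -> R -> R) :=
  forall i, tame (F i) /\ forall x, der x (F i) (F i.+1 x).

Lemma niceD F H : nice F -> nice H -> nice (fun i x => F i x + H i x).
Proof.
move=> nF nH i; split; first exact: tameD (nF i).1 (nH i).1.
by move=> x; apply: derD; [exact: (nF i).2|exact: (nH i).2].
Qed.

Lemma niceZ c F : nice F -> nice (fun i x => c * F i x).
Proof.
move=> nF i; split; first exact: tameZ (nF i).1.
by move=> x; apply: derZ; exact: (nF i).2.
Qed.

Lemma nice_sum (n : nat) (F : 'I_n -> nat -> R -> R) : (forall l, nice (F l)) ->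
  nice (fun i x => \sum_l F l i x).
Proof.
move=> nF i; split; first by apply: tame_sum => l; exact: (nF l i).1.
by move=> x; apply: der_sum => l; exact: (nF l i).2.
Qed.

Lemma nice_shift b F : nice F -> nice (fun i x => F i (x - b)).
Proof.
move=> nF i; split; first exact: (tame_shift (- b) (nF i).1).
move=> x; apply: der_eq (@der_comp _ x (F i) (fun y => y - b) _ _ ((nF i).2 (x - b)) (derB (der_id x) (der_cst x b))) _.
by rewrite subr0 mulr1.
Qed.

Lemma tame_cvg0 f : tame f -> f n%:R @[n --> \oo] --> 0 /\ f (- n%:R) @[n --> \oo] --> 0.
Proof.
move=> [_ [C hC]].
have z : `|C| * n.+1%:R^-1 @[n --> \oo] --> (0 : R).
  by rewrite -[X in _ --> X](mulr0 `|C|); apply: cvgM; [exact: cvg_cst|exact: cvg_harmonic].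
have b n : bell (n%:R : R) <= n.+1%:R^-1.
  have h1 : 0 < 1 + (n%:R : R) ^+ 2 by have := sqr_ge0 (n%:R : R); lra.
  rewrite /bell lef_pV2 ?posrE//.
  rewrite -natr1 addrC lerD2l -natrX ler_nat; case: n {h1} => // n.
  by rewrite expnS expn1 leq_pmulr.
have le n : C * bell (n%:R : R) <= `|C| * n.+1%:R^-1.
  apply: le_trans (_ : `|C| * bell (n%:R : R) <= _).
    by rewrite ler_wpM2r ?ler_norm// ltW ?bell_gt0.
  by rewrite ler_wpM2l.
split; apply: norm_cvg0.
- apply: (squeeze_cvgr _ (cvg_cst 0) z); near=> m; rewrite normr_ge0/=.
  exact: le_trans (hC _) (le m).
- apply: (squeeze_cvgr _ (cvg_cst 0) z); near=> m; rewrite normr_ge0/=.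
  by apply: le_trans (hC _) _; rewrite /bell sqrrN; exact: le.
Unshelve. all: by end_near. Qed.

Lemma itg_der0 (f F : R -> R) : continuous f -> tame f -> tame F ->
  (forall x, der x F (f x)) -> itg f = 0.
Proof.
move=> cf tf tF dF; have [Fp Fm] := tame_cvg0 tF.
by rewrite (itg_FTC cf tf dF Fp Fm) subrr.
Qed.

Lemma der_cosM xi x : der x (fun x => cos (x * xi)) (- xi * sin (x * xi)).
Proof.
have d : der x (fun x => x * xi) xi.
  by apply: der_eq (derM (der_id x) (der_cst x xi)) _; rewrite mul1r mulr0 addr0.
by apply: der_eq (@der_comp _ x cos (fun y => y * xi) _ _ (is_derive_cos (x * xi)) d) _; ring.
Qed.

Lemma der_sinM xi x : der x (fun x => sin (x * xi)) (xi * cos (x * xi)).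
Proof.
have d : der x (fun x => x * xi) xi.
  by apply: der_eq (derM (der_id x) (der_cst x xi)) _; rewrite mul1r mulr0 addr0.
by apply: der_eq (@der_comp _ x sin (fun y => y * xi) _ _ (is_derive_sin (x * xi)) d) _; ring.
Qed.

Lemma fourier_der F xi i : nice F ->
  fc (F i.+1) xi = xi * fs (F i) xi /\ fs (F i.+1) xi = - (xi * fc (F i) xi).
Proof.
move=> nF; have [t0 d0] := nF i; have [t1 d1] := nF i.+1.
have c0 : continuous (F i) by move=> x; exact: der_cont (d0 x).
have c1 : continuous (F i.+1) by move=> x; exact: der_cont (d1 x).
have tc0 := tame_cosM xi t0; have ts0 := tame_sinM xi t0.
have tc1 := tame_cosM xi t1; have ts1 := tame_sinM xi t1.
split.
- have : itg (fun x => - xi * (sin (x * xi) * F i x) + cos (x * xi) * F i.+1 x) = 0.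
    apply: (itg_der0 _ _ tc0).
    - move=> x; apply: cvgD; last by apply: cvgM; [exact: cont_cosM|exact: c1].
      apply: cvgM; first exact: cvg_cst.
      by apply: cvgM; [exact: cont_sinM|exact: c0].
    - by apply: tameD => //; exact: tameZ.
    - by move=> x; apply: der_eq (derM (der_cosM xi x) (d0 x)) _; rewrite mulrA.
  rewrite itgD//; last exact: tameZ.
  rewrite itgZ// -/(fs (F i) xi) -/(fc (F i.+1) xi); lra.
- have : itg (fun x => xi * (cos (x * xi) * F i x) + sin (x * xi) * F i.+1 x) = 0.
    apply: (itg_der0 _ _ ts0).
    - move=> x; apply: cvgD; last by apply: cvgM; [exact: cont_sinM|exact: c1].
      apply: cvgM; first exact: cvg_cst.
      by apply: cvgM; [exact: cont_cosM|exact: c0].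
    - by apply: tameD => //; exact: tameZ.
    - by move=> x; apply: der_eq (derM (der_sinM xi x) (d0 x)) _; rewrite mulrA.
  rewrite itgD//; last exact: tameZ.
  rewrite itgZ// -/(fc (F i) xi) -/(fs (F i.+1) xi); lra.
Qed.

Lemma modhat_der F xi i : nice F -> modhat (F i) xi = `|xi| ^+ i * modhat (F 0%N) xi.
Proof.
move=> nF; elim: i => [|i IH]; first by rewrite expr0 mul1r.
rewrite exprS -mulrA -IH /modhat; have [-> ->] := fourier_der xi i nF.
rewrite sqrrN !exprMn -mulrDr sqrtrM ?sqr_ge0// sqrtr_sqr.
by rewrite addrC.
Qed.

Lemma modhat_decay F xi i : nice F ->
  `|xi| ^+ i * modhat (F 0%N) xi <= 2 * itg (fun x => `|F i x|).
Proof. by move=> nF; rewrite -modhat_der//; apply: modhat_le; exact: (nF i).1. Qed.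

Lemma japanese_ge1 xi : 1 <= japanese xi.
Proof. by rewrite /japanese -[leLHS]sqrtr1 ler_wsqrtr// lerDl sqr_ge0. Qed.

Lemma japanese_sqr xi : japanese xi ^+ 2 = (bell xi)^-1.
Proof. by rewrite /japanese sqr_sqrtr ?invrK// addr_ge0 ?sqr_ge0. Qed.

Lemma exp_1D_le (m : nat) (y : R) : 0 <= y -> (1 + y) ^+ m <= 2 ^+ m * (1 + y ^+ m).
Proof.
move=> y0; have [y1|y1] := leP y 1.
  apply: le_trans (_ : 2 ^+ m * 1 <= _).
    by rewrite mulr1 lerXn2r ?nnegrE//; lra.
  by rewrite ler_wpM2l ?exprn_ge0// lerDl exprn_ge0.
apply: le_trans (_ : (2 * y) ^+ m <= _).
  by rewrite lerXn2r ?nnegrE//; lra.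
by rewrite exprMn ler_wpM2l ?exprn_ge0// lerDr.
Qed.

Definition wt (p s a xi : R) : R := (japanese xi `^ s * a) `^ p.

Lemma wt_ge0 p s a xi : 0 <= wt p s a xi.
Proof. exact: powR_ge0. Qed.

Lemma wt_le p s a b xi : 0 <= p -> 0 <= a -> a <= b -> wt p s a xi <= wt p s b xi.
Proof.
move=> p0 a0 ab; apply: ge0_ler_powR => //; rewrite ?nnegrE ?mulr_ge0 ?powR_ge0//.
  exact: le_trans ab.
by rewrite ler_wpM2l ?powR_ge0.
Qed.

Lemma wtM p s a b xi : 0 <= a -> 0 <= b -> wt p s (a * b) xi = a `^ p * wt p s b xi.
Proof.
move=> a0 b0; rewrite /wt mulrCA; apply: powRM => //.
exact: mulr_ge0 (powR_ge0 _ _) b0.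
Qed.

Lemma powR_add_le (p a b : R) : 0 <= p -> 0 <= a -> 0 <= b ->
  (a + b) `^ p <= 2 `^ p * (a `^ p + b `^ p).
Proof.
move=> p0 a0 b0.
wlog ab : a b a0 b0 / a <= b.
  move=> H; have [ab|ba] := leP a b; first exact: H.
  by rewrite addrC [X in _ * X]addrC; apply: H => //; exact: ltW.
apply: le_trans (_ : (2 * b) `^ p <= _).
  by apply: ge0_ler_powR => //; rewrite ?nnegrE; lra.
by rewrite powRM// ler_wpM2l ?powR_ge0// lerDr powR_ge0.
Qed.

Lemma wtD p s a b xi : 0 <= p -> 0 <= a -> 0 <= b ->
  wt p s (a + b) xi <= 2 `^ p * (wt p s a xi + wt p s b xi).
Proof.
move=> p0 a0 b0; rewrite /wt mulrDr; apply: powR_add_le => //;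
  by rewrite mulr_ge0// powR_ge0.
Qed.

(** The two bounds on [a] give (1 + eta^2)^m a^2 <= 2^m A (A + B), small with [A]. As m >= |s| + 2,
    this decay pays for the weight and leaves one factor [bell]. The variable [eta] is xi itself or
    xi / lam for a soliton of scale lam. *)
Lemma wt_bound (p s : R) (m : nat) : 1 <= p -> `|s| + 2 <= m%:R ->
  forall a A B xi eta, 0 <= a -> a <= A -> `|eta| ^+ (2 * m) * a <= B -> `|xi| <= `|eta| ->
  wt p s a xi <= Num.sqrt (2 ^+ m * (A * (A + B))) `^ p * bell eta.
Proof.
move=> p1 hm a A B xi eta a0 aA etaB xe.
pose J := japanese eta; pose c := Num.sqrt (2 ^+ m * (A * (A + B))).
have J1 : 1 <= J by exact: japanese_ge1.
have A0 : 0 <= A by exact: le_trans aA.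
have B0 : 0 <= B by apply: le_trans etaB; rewrite mulr_ge0// exprn_ge0.
have Jc : J ^+ m * a <= c.
  have Jm0 : 0 <= J ^+ m * a by rewrite mulr_ge0// exprn_ge0// (le_trans ler01).
  rewrite -[leLHS](ger0_norm Jm0) -sqrtr_sqr ler_wsqrtr// exprMn -exprM mulnC exprM japanese_sqr /bell invrK.
  apply: le_trans (_ : 2 ^+ m * (1 + (eta ^+ 2) ^+ m) * a ^+ 2 <= _).
    by rewrite ler_wpM2r ?sqr_ge0// exp_1D_le// sqr_ge0.
  rewrite -mulrA ler_wpM2l ?exprn_ge0//.
  have -> : (eta ^+ 2) ^+ m = `|eta| ^+ (2 * m) by rewrite exprM real_normK ?num_real.
  have -> : (1 + `|eta| ^+ (2 * m)) * a ^+ 2 = a * (a + `|eta| ^+ (2 * m) * a) by ring.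
  by apply: ler_pM => //; rewrite ?lerD// addr_ge0// mulr_ge0// exprn_ge0.
have jJ : japanese xi <= J.
  rewrite /J /japanese ler_wsqrtr// lerD2l -(real_normK (num_real xi)) -(real_normK (num_real eta)).
  by rewrite lerXn2r ?nnegrE.
have js : japanese xi `^ s <= J `^ `|s|.
  apply: le_trans (_ : japanese xi `^ `|s| <= _).
    by apply: ler_powR; [exact: japanese_ge1|exact: ler_norm].
  by apply: ge0_ler_powR => //; rewrite ?nnegrE ?(le_trans ler01)// japanese_ge1.
have J0 : 0 < J by exact: lt_le_trans J1.
have JJ : J `^ `|s| * J ^+ 2 <= J ^+ m.
  rewrite -!powR_mulrn ?(ltW J0)// -powRD; last by rewrite (gt_eqF J0) implybT.
  exact: ler_powR.
have step : japanese xi `^ s * a <= c * bell eta.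
  rewrite -[bell eta]invrK -japanese_sqr -/J ler_pdivlMr ?exprn_gt0//.
  apply: le_trans Jc; rewrite mulrAC ler_wpM2r//.
  by apply: le_trans JJ; rewrite ler_wpM2r// exprn_ge0// ltW.
have c0 : 0 <= c by exact: sqrtr_ge0.
have b0 := ltW (bell_gt0 eta).
apply: le_trans (_ : (c * bell eta) `^ p <= _).
  by apply: ge0_ler_powR => //; rewrite ?nnegrE ?mulr_ge0 ?powR_ge0//; lra.
rewrite powRM// ler_wpM2l ?powR_ge0//.
rewrite -[leRHS]powRr1//.
by apply: (ger_powR _ p1); rewrite bell_gt0 bell_le1.
Qed.

Definition wtf (p s : R) f xi := wt p s (modhat f xi) xi.
(** The p-th power of the norm up to the factor [norm_cst] to the power p; it is subadditive up to
    the factor 2^p. *)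
Definition NN (p s : R) f := itg (wtf p s f).

Lemma measurable_japanese s : measurable_fun setT (fun xi : R => japanese xi `^ s).
Proof.
apply: (measurableT_comp (measurable_powR s)).
apply: continuous_measurable_fun => xi.
apply: (@continuous_comp _ _ _ (fun xi : R => 1 + xi ^+ 2) Num.sqrt).
  by apply: cvgD; [exact: cvg_cst|apply: cvgM; exact: cvg_id].
exact: sqrt_continuous.
Qed.

Lemma measurable_wt p s (a : R -> R) : continuous a -> measurable_fun setT (fun xi => wt p s (a xi) xi).
Proof.
move=> ca; apply: (measurableT_comp (measurable_powR p)).
by apply: measurable_funM; [exact: measurable_japanese|exact: continuous_measurable_fun].
Qed.

Lemma wtf_tame p s F : 1 <= p -> nice F -> tame (wtf p s (F 0%N)).
Proof.
move=> p1 nF; pose m := (Num.truncn (`|s| + 2)).+1.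
have hm : `|s| + 2 <= m%:R by apply: ltW; exact: truncnS_gt.
split; first by apply: measurable_wt; apply: continuous_modhat; exact: (nF 0%N).1.
eexists => xi; rewrite ger0_norm ?wt_ge0//.
apply: (wt_bound p1 hm (modhat_ge0 _ _) _ _ (lexx _)).
  exact: modhat_le (nF 0%N).1.
exact: modhat_decay.
Qed.

Lemma NN_ge0 p s f : 0 <= NN p s f.
Proof. by apply: itg_ge0 => xi; exact: wt_ge0. Qed.

Lemma FLnormE p s F : 1 <= p -> nice F ->
  FLnorm p s (F 0%N) = ((norm_cst `^ p * NN p s (F 0%N)) `^ p^-1)%:E.
Proof.
move=> p1 nF; have tw := wtf_tame s p1 nF.
rewrite /FLnorm unlock -poweR_EFin; congr (_ `^ _)%E.
rewrite /NN -itgZ// EFin_itg; last exact: tameZ.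
apply: eq_integral => xi _; rewrite normc_fourier; last exact: (nF 0%N).1.
have h0 : 0 <= japanese xi `^ s * (norm_cst * modhat (F 0%N) xi).
  by rewrite !mulr_ge0 ?powR_ge0 ?modhat_ge0// ltW// norm_cst_gt0.
rewrite /abse (ger0_norm h0) poweR_EFin -/(wt p s _ xi) wtM ?modhat_ge0//.
by rewrite ltW// norm_cst_gt0.
Qed.

Lemma NN_D_le p s F H : 1 <= p -> nice F -> nice H ->
  NN p s (fun x => F 0%N x + H 0%N x) <= 2 `^ p * (NN p s (F 0%N) + NN p s (H 0%N)).
Proof.
move=> p1 nF nH; have p0 : 0 <= p by exact: le_trans p1.
have tF := wtf_tame s p1 nF; have tH := wtf_tame s p1 nH.
rewrite /NN -itgD// -itgZ; last exact: tameD.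
apply: le_itg; [exact: (wtf_tame s p1 (niceD nF nH))|by apply: tameZ; exact: tameD|move=> xi].
apply: le_trans (_ : wt p s (modhat (F 0%N) xi + modhat (H 0%N) xi) xi <= _).
  by apply: wt_le => //; [exact: modhat_ge0|apply: modhatD; [exact: (nF 0%N).1|exact: (nH 0%N).1]].
by apply: wtD => //; exact: modhat_ge0.
Qed.

(* Interpolation: a small integral together with control of one high derivative. *)
Lemma NN_small (p s : R) (m : nat) : 1 <= p -> `|s| + 2 <= m%:R ->
  forall F A B, nice F -> itg (fun x => `|F 0%N x|) <= A ->
    itg (fun x => `|F (2 * m)%N x|) <= B ->
  NN p s (F 0%N) <= Num.sqrt (2 ^+ m * (2 * A * (2 * A + 2 * B))) `^ p * pi.
Proof.
move=> p1 hm F A B nF hA hB.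
have tb : tame (@bell R).
  by have := @tame_bellZ R 1 ltr01; rewrite (_ : (fun x => _) = bell)//; apply/funext => x; rewrite mul1r.
have ib : itg (@bell R) = pi.
  have := @itg_bellZ R 1 ltr01; rewrite divr1 (_ : (fun x => bell (1 * x)) = bell)//.
  by apply/funext => x; rewrite mul1r.
rewrite -ib -itgZ//; apply: le_itg; [exact: wtf_tame|exact: tameZ|move=> xi].
apply: (wt_bound p1 hm (modhat_ge0 _ _) _ _ (lexx _)).
  by apply: le_trans (modhat_le _ (nF 0%N).1) _; rewrite ler_pM2l.
by apply: le_trans (modhat_decay _ _ nF) _; rewrite ler_pM2l.
Qed.

Lemma fc_shift f b xi : continuous f -> tame f ->
  fc (fun x => f (x - b)) xi = cos (b * xi) * fc f xi - sin (b * xi) * fs f xi.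
Proof.
move=> cf tf; have tc := tame_cosM xi tf; have ts := tame_sinM xi tf.
rewrite -!itgZ// -itgB; [|exact: tameZ|exact: tameZ].
have c : continuous (fun x : R => cos (x * xi) * f (x - b)).
  move=> x; apply: cvgM; first exact: cont_cosM.
  apply: (@continuous_comp _ _ _ (fun x : R => x - b) f); last exact: cf.
  by apply: cvgB; [exact: cvg_id|exact: cvg_cst].
transitivity (itg (fun x => cos (x * xi) * f (x - b))); first by [].
rewrite -(itg_shift b c); last by apply: tame_cosM; exact: (tame_shift (- b) tf).
congr itg; apply/funext => x; rewrite addrK mulrDl cosD; ring.
Qed.

Lemma fs_shift f b xi : continuous f -> tame f ->
  fs (fun x => f (x - b)) xi = sin (b * xi) * fc f xi + cos (b * xi) * fs f xi.
Proof.
move=> cf tf; have tc := tame_cosM xi tf; have ts := tame_sinM xi tf.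
rewrite -!itgZ// -itgD; [|exact: tameZ|exact: tameZ].
have c : continuous (fun x : R => sin (x * xi) * f (x - b)).
  move=> x; apply: cvgM; first exact: cont_sinM.
  apply: (@continuous_comp _ _ _ (fun x : R => x - b) f); last exact: cf.
  by apply: cvgB; [exact: cvg_id|exact: cvg_cst].
transitivity (itg (fun x => sin (x * xi) * f (x - b))); first by [].
rewrite -(itg_shift b c); last by apply: tame_sinM; exact: (tame_shift (- b) tf).
congr itg; apply/funext => x; rewrite addrK mulrDl sinD; ring.
Qed.

(* [dsum y xi] is the modulus of [\sum_i exp (- i y_i xi)]. *)
Definition dsum (n : nat) (y : 'I_n -> R) (xi : R) : R :=
  Num.sqrt ((\sum_i cos (y i * xi)) ^+ 2 + (\sum_i sin (y i * xi)) ^+ 2).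

Lemma modhat_shifts (n : nat) (y : 'I_n -> R) f xi : continuous f -> tame f ->
  modhat (fun x => \sum_i f (x - y i)) xi = dsum y xi * modhat f xi.
Proof.
move=> cf tf; have ti i : tame (fun x => f (x - y i)) by exact: (tame_shift (- y i) tf).
have -> : modhat (fun x => \sum_i f (x - y i)) xi =
  Num.sqrt ((\sum_i fc (fun x => f (x - y i)) xi) ^+ 2 +
            (\sum_i fs (fun x => f (x - y i)) xi) ^+ 2).
  rewrite /modhat; congr (Num.sqrt (_ ^+ 2 + _ ^+ 2)).
    rewrite -itg_sum => [|i]; last exact: tame_cosM.
    by congr itg; apply/funext => x; rewrite big_distrr.
  rewrite -itg_sum => [|i]; last exact: tame_sinM.
  by congr itg; apply/funext => x; rewrite big_distrr.
rewrite /dsum /modhat -sqrtrM ?addr_ge0 ?sqr_ge0//; congr Num.sqrt.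
under eq_bigr do rewrite fc_shift//.
under [X in _ + X ^+ 2]eq_bigr do rewrite fs_shift//.
rewrite sumrB big_split/= -!big_distrl/=; ring.
Qed.

End Fourier.

(** * Exponential sums *)

Section ExpSums.
Context {R : realType}.

(** An arbitrary finite index type, since the square of an exponential sum is one indexed by
    pairs. *)
Definition modsq (I : finType) (y : I -> R) (xi : R) : R :=
  (\sum_i cos (y i * xi)) ^+ 2 + (\sum_i sin (y i * xi)) ^+ 2.

Lemma dsumE n (y : 'I_n -> R) xi : dsum y xi = Num.sqrt (modsq y xi).
Proof. by []. Qed.

Lemma modsq_ge0 (I : finType) (y : I -> R) xi : 0 <= modsq y xi.
Proof. by rewrite addr_ge0 ?sqr_ge0. Qed.

Lemma modsq_pairs (I : finType) (y : I -> R) xi :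
  modsq y xi = \sum_(ab : I * I) cos ((y ab.1 - y ab.2) * xi).
Proof.
rewrite -(pair_bigA _ (fun a b => cos ((y a - y b) * xi))) /= /modsq !expr2.
rewrite !big_distrl -big_split; apply: eq_bigr => a _ /=.
rewrite !big_distrr -big_split; apply: eq_bigr => b _ /=.
by rewrite mulrBl cosB.
Qed.

Lemma modsq_shift (I : finType) (y : I -> R) b xi :
  modsq (fun i => y i + b) xi = modsq y xi.
Proof.
rewrite !modsq_pairs; apply: eq_bigr => ab _; congr (cos (_ * _)); ring.
Qed.

Lemma modsq_sqr (I : finType) (y : I -> R) xi :
  modsq y xi ^+ 2 = modsq (fun ij : I * I => y ij.1 + y ij.2) xi.
Proof.
pose C := \sum_i cos (y i * xi); pose S := \sum_i sin (y i * xi).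
have e1 : \sum_(ij : I * I) cos ((y ij.1 + y ij.2) * xi) = C * C - S * S.
  rewrite -(pair_bigA _ (fun a b => cos ((y a + y b) * xi))) /=.
  rewrite /C /S !big_distrl -sumrB; apply: eq_bigr => a _ /=.
  rewrite !big_distrr -sumrB; apply: eq_bigr => b _ /=.
  by rewrite mulrDl cosD.
have e2 : \sum_(ij : I * I) sin ((y ij.1 + y ij.2) * xi) = S * C + C * S.
  rewrite -(pair_bigA _ (fun a b => sin ((y a + y b) * xi))) /=.
  rewrite /C /S !big_distrl -big_split; apply: eq_bigr => a _ /=.
  rewrite !big_distrr -big_split; apply: eq_bigr => b _ /=.
  by rewrite mulrDl sinD.
rewrite /modsq e1 e2 -/C -/S; ring.
Qed.

Lemma modsq_cont (I : finType) (y : I -> R) : continuous (modsq y).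
Proof.
move=> xi.
have cc : (fun xi : R => \sum_i cos (y i * xi)) x @[x --> xi] --> \sum_i cos (y i * xi).
  apply: cvg_big => [|i _]; first exact: add_continuous.
  apply: (@continuous_comp _ _ _ (fun x : R => y i * x) cos); last exact: continuous_cos.
  by apply: cvgM; [exact: cvg_cst|exact: cvg_id].
have cs : (fun xi : R => \sum_i sin (y i * xi)) x @[x --> xi] --> \sum_i sin (y i * xi).
  apply: cvg_big => [|i _]; first exact: add_continuous.
  apply: (@continuous_comp _ _ _ (fun x : R => y i * x) sin); last exact: continuous_sin.
  by apply: cvgM; [exact: cvg_cst|exact: cvg_id].
by apply: cvgD; apply: cvgM.
Qed.

Lemma modsq_le (I : finType) (y : I -> R) xi : modsq y xi <= #|I|%:R ^+ 2.
Proof.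
rewrite modsq_pairs; apply: le_trans (_ : \sum_(ab : I * I) 1 <= _).
  by apply: ler_sum => ab _; exact: cos_le1.
by rewrite sumr_const card_prod -natrX expnS expn1.
Qed.

(* Weights satisfying the conclusion of the Riemann-Lebesgue lemma. *)
Definition oscillating (w : R -> R) := tame w /\
  exists C : R, forall y : R, y != 0 -> `|itg (fun xi : R => w xi * cos (y * xi))| <= C / `|y|.

Lemma tame_osc_cos (w : R -> R) (y : R) : tame w -> tame (fun xi : R => w xi * cos (y * xi)).
Proof.
move=> tw; rewrite (_ : (fun x => _) = fun x : R => cos (x * y) * w x); first exact: tame_cosM.
by apply/funext => x; rewrite mulrC (mulrC y).
Qed.

Lemma tame_modsq (w : R -> R) (I : finType) (y : I -> R) : tame w -> tame (fun xi => w xi * modsq y xi).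
Proof.
move=> tw; apply: (tameM tw (M := #|I|%:R ^+ 2)).
  by apply: continuous_measurable_fun; exact: modsq_cont.
by move=> x; rewrite ger0_norm ?modsq_ge0 ?modsq_le.
Qed.

(** For the sums m_i + m_j indexed by pairs this is the additive energy. *)
Definition coinc (I : finType) (m : I -> nat) : nat := #|[pred ab : I * I | m ab.1 == m ab.2]|.

(** In the expansion over pairs, coincidences contribute the integral of [w] and all other terms
    oscillate at frequencies of order [L]. *)
Lemma modsq_limit (w : R -> R) (I : finType) (m : I -> nat) (L : nat -> R) : oscillating w ->
  L l @[l --> \oo] --> +oo ->
  itg (fun xi => w xi * modsq (fun i => L l * (m i)%:R) xi) @[l --> \oo] -->
    (coinc m)%:R * itg w.
Proof.
move=> [tw [C hC]] hL.
pose u l (ab : I * I) := itg (fun xi => w xi * cos (L l * ((m ab.1)%:R - (m ab.2)%:R) * xi)).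
rewrite (_ : (fun l => _) = fun l => \sum_ab u l ab); last first.
  apply/funext => l; rewrite -itg_sum => [|ab]; last exact: tame_osc_cos.
  congr itg; apply/funext => xi; rewrite modsq_pairs big_distrr; apply: eq_bigr => ab _ /=.
  by rewrite mulrBr.
have -> : (coinc m)%:R * itg w = \sum_(ab : I * I) (if m ab.1 == m ab.2 then itg w else 0).
  by rewrite -big_mkcond /= sumr_const mulr_natl.
apply: cvg_big => [|ab _]; first exact: add_continuous.
case: eqP => [e|/eqP ne].
  rewrite (_ : u ^~ ab = fun=> itg w); first exact: cvg_cst.
  apply/funext => l; congr itg; apply/funext => xi.
  by rewrite e subrr mulr0 mul0r cos0 mulr1.
pose d : R := (m ab.1)%:R - (m ab.2)%:R.
have d0 : d != 0 by rewrite subr_eq0 eqr_nat.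
have Linv : (L l)^-1 @[l --> \oo] --> (0 : R).
  apply/cvgr0Pnorm_le => e e0; near=> l.
  have Lp : e^-1 <= L l by near: l; move/cvgryPge: hL; apply.
  have L0 : 0 < L l by apply: lt_le_trans Lp; rewrite invr_gt0.
  by rewrite gtr0_norm ?invr_gt0// -[leRHS]invrK lef_pV2 ?posrE ?invr_gt0.
have z : `|(L l)^-1| * (C / `|d|) @[l --> \oo] --> (0 : R).
  apply: (cvg0_bounded (B := `|C / `|d| |)) => //.
  by rewrite -[X in _ --> X](@normr0 R R); exact: cvg_norm.
apply: norm_cvg0; apply: (squeeze_cvgr _ (cvg_cst 0) z); near=> l.
have Lp : 1 <= L l by near: l; move/cvgryPge: hL; apply.
have L0 : L l != 0 by rewrite gt_eqF// (lt_le_trans ltr01).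
rewrite normr_ge0/=; apply: le_trans (hC _ _) _; first by rewrite mulf_neq0.
by rewrite normrM invfM normfV mulrCA.
Unshelve. all: by end_near. Qed.

Lemma der_bellZ (c x : R) : der x (fun x => bell (c * x)) (- (2 * c * (c * x) * bell (c * x) ^+ 2)).
Proof.
have b0 : 1 + (c * x) ^+ 2 != 0 by rewrite gt_eqF// ltr_pwDl ?sqr_ge0.
have d : der x (fun x => 1 + (c * x) ^+ 2) (2 * (c * x) * c).
  by apply: der_eq (derD (der_cst x 1) (der_sqr (derZ c (der_id x)))) _; ring.
apply: der_eq (@is_deriveV R (fun x => 1 + (c * x) ^+ 2) x _ 1 b0 d) _; rewrite /bell /GRing.scale/= exprVn; ring.
Qed.

Lemma oscillating_bell (c : R) : 0 < c -> oscillating (fun x => bell (c * x)).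
Proof.
move=> c0; have tb := tame_bellZ c0; split => //.
pose b' x : R := - (2 * c * (c * x) * bell (c * x) ^+ 2).
have cb : continuous (fun x => bell (c * x)) by move=> x; exact: der_cont (der_bellZ c x).
have cb' : continuous b'.
  move=> x; apply: cvgN; apply: cvgM; last by apply: cvgM; exact: cb.
  by apply: cvgM; [exact: cvg_cst|apply: cvgM; [exact: cvg_cst|exact: cvg_id]].
have tb' : tame b'.
  apply: (tame_le _ (tameZ c tb)); first exact: continuous_measurable_fun.
  move=> x; rewrite /b' normrN.
  have bx := bell_gt0 (c * x).
  have h : `|2 * (c * x)| * bell (c * x) <= 1.
    rewrite -ler_pdivlMr// /bell invrK mul1r ler_norml.
    have h1 := sqr_ge0 (1 - c * x); have h2 := sqr_ge0 (1 + c * x).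
    by apply/andP; split; lra.
  have -> : 2 * c * (c * x) * bell (c * x) ^+ 2 = c * bell (c * x) * (2 * (c * x) * bell (c * x)) by ring.
  by rewrite normrM ler_piMr// normrM (gtr0_norm bx).
exists (itg (fun x => `|b' x|)) => y y0.
have ts := tame_sinM y tb; have tc := tame_cosM y tb; have ts' := tame_sinM y tb'.
have : itg (fun x => y * (cos (x * y) * bell (c * x)) + sin (x * y) * b' x) = 0.
  apply: (itg_der0 _ _ ts).
  - move=> x; apply: cvgD; last by apply: cvgM; [exact: cont_sinM|exact: cb'].
    apply: cvgM; first exact: cvg_cst.
    by apply: cvgM; [exact: cont_cosM|exact: cb].
  - by apply: tameD => //; exact: tameZ.
  - move=> x; apply: der_eq (derM (der_sinM y x) (der_bellZ c x)) _. by rewrite /b'; ring.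
rewrite itgD//; last exact: tameZ.
rewrite itgZ// => e.
rewrite ler_pdivlMr ?normr_gt0// -normrM.
have -> : itg (fun xi => bell (c * xi) * cos (y * xi)) * y = - itg (fun x => sin (x * y) * b' x).
  have -> : (fun xi => bell (c * xi) * cos (y * xi)) = fun x => cos (x * y) * bell (c * x).
    by apply/funext => x; rewrite mulrC (mulrC y).
  by move: e; lra.
by rewrite normrN; exact: fs_le.
Qed.

(** The weight of the lower bound, as a dilated [bell] is that of the upper bound. *)
Definition boxw (e x : R) : R := \1_(`[0, e]%classic : set R) x.

Lemma boxw_ge0 e x : 0 <= boxw e x.
Proof. by rewrite /boxw indicE. Qed.

Lemma boxw_tame e : tame (boxw e).
Proof.
split; first exact: measurable_indic.
exists (1 + e ^+ 2) => x; rewrite /bell ler_pdivlMr; last by have := sqr_ge0 x; lra.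
rewrite /boxw indicE; have e2 := sqr_ge0 e.
case: (boolP (_ \in _)) => [/set_mem|_]; last by rewrite normr0 mul0r; lra.
rewrite /= in_itv/= => /andP[x0 xe]; rewrite normr1 mul1r lerD2l.
by rewrite lerXn2r ?nnegrE// (le_trans x0).
Qed.

Lemma itg_boxwM e (f F : R -> R) : 0 < e -> continuous f -> (forall x, der x F (f x)) ->
  itg (fun x => boxw e x * f x) = F e - F 0.
Proof.
move=> e0 cf dF; rewrite -(FTC_segment e0 cf dF) [RHS]Rintegral_mkcond.
apply: eq_Rintegral => x _; rewrite patchE /boxw indicE.
by case: (_ \in _); rewrite /= ?mulr1n ?mulr0n ?mul1r ?mul0r.
Qed.

Lemma itg_boxw e : 0 < e -> itg (boxw e) = e.
Proof.
move=> e0; transitivity (itg (fun x => boxw e x * 1)).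
  by congr itg; apply/funext => x; rewrite mulr1.
rewrite (@itg_boxwM e (fun=> 1) (fun x => x) e0 _ (fun x => der_id x)) ?subr0//.
exact: cst_continuous.
Qed.

Lemma oscillating_boxw e : 0 < e -> oscillating (boxw e).
Proof.
move=> e0; split; first exact: boxw_tame.
exists 1 => y y0.
have d x : der x (fun x => y^-1 * sin (y * x)) (cos (y * x)).
  apply: der_eq (derZ y^-1 (@der_comp _ x sin (fun x => y * x) _ _ (is_derive_sin _) (derZ y (der_id x)))) _.
  by field.
rewrite (itg_boxwM e0 _ d); last first.
  move=> x; apply: (@continuous_comp _ _ _ (fun x : R => y * x) cos); last exact: continuous_cos.
  by apply: cvgM; [exact: cvg_cst|exact: cvg_id].
rewrite mulr0 sin0 mulr0 subr0 normrM normfV mulrC ler_wpM2r ?invr_ge0//.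
exact: sin_max.
Qed.

End ExpSums.

(** * Counting coincidences and additive energies *)

Section Counting.

Lemma coinc_inj (I : finType) (m : I -> nat) : injective m -> coinc m = #|I|.
Proof.
move=> mI; have fI : injective (fun a : I => (a, a)) by move=> a b [].
rewrite /coinc -(card_codom fI); apply: eq_card => -[a b]; rewrite inE /=.
apply/eqP/codomP => [/mI ->|[c [-> ->]]//]; by exists b.
Qed.

(** The powers of 4 form a Sidon set: a sum with larger term 4^a is at most 2 4^a < 4^(a+1), which
    determines a. *)
Lemma pow4_sum_inj (i j k l : nat) : (4 ^ i + 4 ^ j = 4 ^ k + 4 ^ l)%N ->
  (i = k /\ j = l) \/ (i = l /\ j = k).
Proof.
have pos m : (0 < 4 ^ m)%N by rewrite expn_gt0.
have le m m' : (m < m')%N -> (4 * 4 ^ m <= 4 ^ m')%N.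
  by move=> h; rewrite -expnS leq_exp2l.
have mono m m' : (m <= m')%N -> (4 ^ m <= 4 ^ m')%N by move=> h; rewrite leq_exp2l.
have inj m m' : (4 ^ m = 4 ^ m')%N -> m = m' by move/eqP; rewrite eqn_exp2l// => /eqP.
have key a b c d : (b <= a)%N -> (d <= c)%N -> (4 ^ a + 4 ^ b = 4 ^ c + 4 ^ d)%N -> a = c /\ b = d.
  move=> ba dc e; have ac : a = c.
    have [|/le h|//] := ltngtP a c; last first.
      by have := mono _ _ dc; have := pos b; lia.
    by move=> /le h; have := mono _ _ ba; have := pos d; lia.
  by split => //; apply: inj; subst; lia.
move=> e; have [ij|/ltnW ij] := leqP j i; have [kl|/ltnW kl] := leqP l k.
- by left; apply: key.
- by right; apply: (key _ _ _ _ ij kl); lia.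
- by right; have [] := key _ _ _ _ ij kl; lia.
- by left; have [] := key _ _ _ _ ij kl; lia.
Qed.

Lemma coinc_pow4 (n : nat) :
  (coinc (fun ij : 'I_n * 'I_n => 4 ^ ij.1 + 4 ^ ij.2) <= 2 * n ^ 2)%N.
Proof.
pose f (x : 'I_n * 'I_n) := (x, x); pose g (x : 'I_n * 'I_n) := (x, (x.2, x.1)).
have sub : [pred ab : ('I_n * 'I_n) * ('I_n * 'I_n) | (4 ^ ab.1.1 + 4 ^ ab.1.2 == 4 ^ ab.2.1 + 4 ^ ab.2.2)%N] \subset
    [predU codom f & codom g].
  apply/fintype.subsetP => -[[i j] [k l]]; rewrite inE /= => /eqP/pow4_sum_inj h.
  rewrite inE; apply/orP; case: h => -[h1 h2]; [left|right]; apply/codomP; exists (i, j);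
    by rewrite /f /g /= (val_inj h1) (val_inj h2).
rewrite /coinc; apply: leq_trans (subset_leq_card sub) _.
apply: leq_trans (_ : #|codom f| + #|codom g| <= _)%N.
  by rewrite -cardUI leq_addr.
have c : #|{: 'I_n * 'I_n}| = (n ^ 2)%N by rewrite card_prod card_ord mulnn.
by rewrite mul2n -addnn; apply: leq_add; rewrite -c leq_image_card.
Qed.

(** Three terms chosen freely in the middle third determine a fourth one within the range. *)
Lemma coinc_progression (a : nat) :
  (a ^ 3 <= coinc (fun ij : 'I_(3 * a) * 'I_(3 * a) => ij.1 + ij.2))%N.
Proof.
case: a => [|a]; first by [].
set b := a.+1.
have b1 (i : 'I_b) : (b + i < 3 * b)%N by have := ltn_ord i; lia.
have b2 (i j k : 'I_b) : (b + i + j - k < 3 * b)%N.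
  by have := ltn_ord i; have := ltn_ord j; lia.
pose f (x : 'I_b * 'I_b * 'I_b) := ((Ordinal (b1 x.1.1), Ordinal (b1 x.1.2)),
  (Ordinal (b1 x.2), Ordinal (b2 x.1.1 x.1.2 x.2))).
have fI : injective f.
  move=> [[i j] k] [[i' j'] k'] [] /addnI/val_inj-> /addnI/val_inj-> /addnI/val_inj-> _.
  by [].
have -> : (b ^ 3)%N = #|codom f|.
  by rewrite card_codom// !card_prod card_ord !expnS expn0 muln1 mulnA.
rewrite /coinc; apply: subset_leq_card; apply/fintype.subsetP => _ /codomP[[[i j] k] ->].
by rewrite inE /=; apply/eqP; have := ltn_ord i; have := ltn_ord j; have := ltn_ord k; lia.
Qed.

(** The differences increase strictly; this will make the detuned parameters distinct. *)
Lemma pow4_sub_inj (n : nat) (R : realType) :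
  injective (fun j : 'I_n => (4 ^ j)%:R - j%:R : R).
Proof.
have mono (i j : nat) : (i < j)%N -> (4 ^ i + j < 4 ^ j + i)%N.
  move=> ij; have [d ->] : exists d, j = (d.+1 + i)%N by exists (j - i.+1)%N; lia.
  have h1 : (1 <= 4 ^ i)%N by rewrite expn_gt0.
  have : (4 * d.+1 <= 4 ^ d.+1)%N.
    by elim: d {ij} => // m IH; rewrite expnS; lia.
  rewrite expnD => h2; have h3 := leq_mul h2 (leqnn (4 ^ i)).
  have h4 : (d.+1 <= d.+1 * 4 ^ i)%N by rewrite leq_pmulr.
  have h5 : (4 ^ i <= d.+1 * 4 ^ i)%N by rewrite leq_pmull.
  by move: h3; rewrite -mulnA; lia.
move=> i j e; apply: val_inj.
have aux (x y z w : R) : x - z = y - w -> x + w = y + z by move=> h; lra.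
have /eqP := aux _ _ _ _ e; rewrite -!natrD eqr_nat => /eqP e'.
by have [/mono|/mono|//] := ltngtP (i : nat) j; rewrite e' ltnn.
Qed.

End Counting.

(** * Dirichlet kernels *)

Section Dirichlet.
Context {R : realType}.

Definition dirichlet (n : nat) (th : R) := modsq (fun j : 'I_n => j%:R : R) th.

(** Squared moduli in (1 - exp(i th)) sum_(j < n) exp(i j th) = 1 - exp(i n th). *)
Lemma dirichlet_telescope n th :
  (2 - 2 * cos th) * dirichlet n th = 2 - 2 * cos (n%:R * th).
Proof.
pose C := \sum_(j < n) cos (j%:R * th); pose S := \sum_(j < n) sin (j%:R * th).
have [e1 e2] : (1 - cos th) * C + sin th * S = 1 - cos (n%:R * th) /\
   (1 - cos th) * S - sin th * C = - sin (n%:R * th).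
  rewrite /C /S {C S}; elim: n => [|n [IH1 IH2]].
    by rewrite !big_ord0 mul0r cos0 sin0; split; ring.
  rewrite !big_ord_recr/= -(natr1 n) (mulrDl n%:R) mul1r cosD sinD.
  split.
    rewrite mulrDr mulrDr addrACA IH1; ring.
  by rewrite !mulrDr opprD addrACA IH2; ring.
have cs := cos2Dsin2 th; have csn := cos2Dsin2 (n%:R * th).
have h : (2 - 2 * cos th) * dirichlet n th =
   ((1 - cos th) * C + sin th * S) ^+ 2 + ((1 - cos th) * S - sin th * C) ^+ 2.
  have -> : 2 - 2 * cos th = (1 - cos th) ^+ 2 + sin th ^+ 2 by rewrite -[X in X - _]/(1 + 1) -{2}cs; ring.
  rewrite /dirichlet /modsq -/C -/S; ring.
rewrite h e1 e2.
have -> : (1 - cos (n%:R * th)) ^+ 2 + (- sin (n%:R * th)) ^+ 2 =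
  1 - 2 * cos (n%:R * th) + (cos (n%:R * th) ^+ 2 + sin (n%:R * th) ^+ 2) by ring.
by rewrite csn; ring.
Qed.

Lemma dirichlet_le n th : dirichlet n th <= n%:R ^+ 2.
Proof. by have := modsq_le (fun j : 'I_n => j%:R : R) th; rewrite card_ord. Qed.

Lemma dirichlet_far n N th : (0 < N)%N -> (N%:R ^+ 2)^-1 <= 2 - 2 * cos th ->
  dirichlet n th <= 4 * N%:R ^+ 2.
Proof.
move=> N0 h; have N2 : 0 < (N%:R : R) ^+ 2 by rewrite exprn_gt0// ltr0n.
have e := dirichlet_telescope n th.
have d0 : 0 <= dirichlet n th by exact: modsq_ge0.
have : (N%:R ^+ 2)^-1 * dirichlet n th <= 4.
  apply: le_trans (_ : (2 - 2 * cos th) * dirichlet n th <= _); first by rewrite ler_wpM2r.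
  by rewrite e; have := cos_geN1 (n%:R * th); lra.
by rewrite mulrC ler_pdivrMr.
Qed.

(** On the arc |1 - exp(i th)| <= 1/N every cos(j th) with j < N is at least 1/2. Thus 4 / N^2 times
    the kernel of length [N] dominates the indicator of the arc, and its averages are computable. *)
Lemma dirichlet_near N th : 2 - 2 * cos th <= (N%:R ^+ 2)^-1 ->
  N%:R ^+ 2 / 4 <= dirichlet N th.
Proof.
case: N => [|N] h; first by rewrite expr0n/= mul0r modsq_ge0.
have N2 : 0 < (N.+1%:R : R) ^+ 2 by rewrite exprn_gt0// ltr0n.
have hc (j : 'I_N.+1) : 1 / 2 <= cos (j%:R * th).
  have := dirichlet_telescope j th.
  have : (2 - 2 * cos th) * dirichlet j th <= 1.
    apply: le_trans (_ : (N.+1%:R ^+ 2)^-1 * N.+1%:R ^+ 2 <= _); last by rewrite mulVf// gt_eqF.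
    have c0 : 0 <= 2 - 2 * cos th by have := cos_le1 th; lra.
    have m0 : 0 <= dirichlet j th by exact: modsq_ge0.
    apply: ler_pM => //.
    apply: le_trans (dirichlet_le _ _) _.
    by rewrite lerXn2r ?nnegrE// ler_nat ltnW// ltn_ord.
  lra.
have hC : N.+1%:R / 2 <= \sum_(j < N.+1) cos (j%:R * th).
  apply: le_trans (_ : \sum_(j < N.+1) (1 / 2 : R) <= _); last exact: ler_sum.
  by rewrite sumr_const card_ord -[leRHS]mulr_natl mul1r.
rewrite /dirichlet /modsq.
have h0 : 0 <= (N.+1%:R : R) / 2 by rewrite divr_ge0.
have : (N.+1%:R / 2) ^+ 2 <= (\sum_(j < N.+1) cos (j%:R * th)) ^+ 2.
  by rewrite lerXn2r ?nnegrE// (le_trans h0).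
have := sqr_ge0 (\sum_(j < N.+1) sin (j%:R * th)); lra.
Qed.

(** * Pointwise inequalities between powers *)

Section Pointwise.
Implicit Types p d s : R.

Lemma le_powR (x y a : R) : 0 <= a -> 0 <= x -> x <= y -> x `^ a <= y `^ a.
Proof.
move=> a0 x0 xy; apply: ge0_ler_powR => //; rewrite nnegrE//.
exact: le_trans xy.
Qed.

Lemma powR_split (x a b : R) : 0 < x -> x `^ a = x `^ b * x `^ (a - b).
Proof.
move=> x0; rewrite -powRD; last by rewrite (gt_eqF x0) implybT.
by rewrite addrC subrK.
Qed.

Lemma powR_sqr (x : R) : 0 <= x -> x `^ 2 = x ^+ 2.
Proof. by move=> x0; rewrite -powR_mulrn. Qed.

Lemma powR_antimono (x y a : R) : 0 < x -> x <= y -> a <= 0 -> y `^ a <= x `^ a.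
Proof.
move=> x0 xy a0; rewrite -[a]opprK !(powRN _ (- a)) lef_pV2 ?posrE ?powR_gt0//.
  by apply: le_powR; lra.
exact: lt_le_trans xy.
Qed.

(** Split at the threshold [s]: above it d^(p-2) <= s^(p-2), below it d^p <= s^p. The three lemmas
    that follow use the same device to compare p-th powers with squares and fourth powers. *)
Lemma powR_lt2_split p d s : 0 <= p -> 0 <= d -> p < 2 -> 0 < s ->
  d `^ p <= s `^ (p - 2) * d ^+ 2 + s `^ p.
Proof.
move=> p0 d0 p2 s0; have [ds|sd] := leP d s.
  rewrite ler_wpDl ?mulr_ge0 ?powR_ge0 ?sqr_ge0//.
  by apply: le_powR; lra.
have dp : 0 < d by exact: lt_trans sd.
rewrite ler_wpDr ?powR_ge0// (powR_split p 2 dp) powR_sqr// mulrC ler_wpM2r ?sqr_ge0//.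
by apply: powR_antimono; [|exact: ltW|lra].
Qed.

Lemma sqr_le_split p d s : 0 <= p -> 0 <= d -> p < 2 -> 0 < s ->
  d ^+ 2 <= s `^ (2 - p) * d `^ p + (s ^+ 2)^-1 * d ^+ 4.
Proof.
move=> p0 d0 p2 s0; have d40 : 0 <= d ^+ 4 by exact: exprn_ge0.
have [ds|sd] := leP d s.
  rewrite ler_wpDr ?mulr_ge0 ?invr_ge0 ?sqr_ge0//.
  move: d0; rewrite le_eqVlt => /predU1P[<-|dp].
    by rewrite expr0n/= mulr_ge0 ?powR_ge0.
  rewrite -(powR_sqr (ltW dp)) (powR_split 2 p dp) mulrC ler_wpM2r ?powR_ge0//.
  by apply: le_powR; lra.
rewrite ler_wpDl ?mulr_ge0 ?powR_ge0// ler_pdivlMl ?exprn_gt0//.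
rewrite (_ : d ^+ 4 = d ^+ 2 * d ^+ 2); last by rewrite -exprD.
by rewrite ler_wpM2r ?sqr_ge0// lerXn2r ?nnegrE// ltW.
Qed.

(** Above [s], d^(p-4) is bounded by its value at [s] if p <= 4 and at s^2 if p > 4; the sum covers
    both cases. *)
Lemma powR_gt2_split p d s : 0 <= p -> 0 <= d -> 2 < p -> 1 <= s -> d <= s ^+ 2 ->
  d `^ p <= s `^ p + (s `^ (p - 4) + (s ^+ 2) `^ (p - 4)) * d ^+ 4.
Proof.
move=> p0 d0 p2 s1 ds2; have d40 : 0 <= d ^+ 4 by exact: exprn_ge0.
have s0 : 0 < s by exact: lt_le_trans s1.
have [ds|sd] := leP d s.
  rewrite ler_wpDr ?mulr_ge0 ?addr_ge0 ?powR_ge0//.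
  by apply: le_powR; lra.
have dp : 0 < d by exact: lt_trans sd.
rewrite ler_wpDl ?powR_ge0// (powR_split p 4%:R dp) powR_mulrn// mulrC ler_wpM2r//.
have [p4|p4] := leP p 4.
  rewrite ler_wpDr ?powR_ge0//; apply: powR_antimono; [by []|exact: ltW|lra].
rewrite ler_wpDl ?powR_ge0//; apply: le_powR; rewrite ?sqr_ge0//; lra.
Qed.

Lemma pow4_le_split p d s (B : R) : 0 <= p -> 0 <= d -> 2 < p -> 0 < s -> 0 < B -> d <= B ->
  d ^+ 4 <= s ^+ 2 * d ^+ 2 + (s `^ (4 - p) + B `^ (4 - p)) * d `^ p.
Proof.
move=> p0 d0 p2 s0 B0 dB; have [ds|sd] := leP d s.
  rewrite ler_wpDr ?mulr_ge0 ?addr_ge0 ?powR_ge0//.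
  rewrite (_ : d ^+ 4 = d ^+ 2 * d ^+ 2); last by rewrite -exprD.
  by rewrite ler_wpM2r ?sqr_ge0// lerXn2r ?nnegrE// ltW.
have dp : 0 < d by exact: lt_trans sd.
have e4 : d ^+ 4 = d `^ 4%:R by rewrite powR_mulrn.
rewrite ler_wpDl//; first by rewrite mulr_ge0 ?sqr_ge0.
rewrite e4 (powR_split 4%:R p dp) mulrC ler_wpM2r ?powR_ge0//.
have [p4|p4] := leP p 4.
  rewrite ler_wpDl ?powR_ge0//; apply: le_powR; lra.
rewrite ler_wpDr ?powR_ge0//; apply: powR_antimono; [by []|exact: ltW|lra].
Qed.

End Pointwise.
End Dirichlet.

(** * Means of powers of exponential sums for the two configurations *)

Section Config.
Context {R : realType}.
Implicit Types (p : R) (w : R -> R) (L : nat -> R).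

Lemma dsum_ge0 n (y : 'I_n -> R) xi : 0 <= dsum y xi.
Proof. exact: sqrtr_ge0. Qed.

Lemma dsum_sqr n (y : 'I_n -> R) xi : dsum y xi ^+ 2 = modsq y xi.
Proof. by rewrite dsumE sqr_sqrtr// modsq_ge0. Qed.

Lemma dsum_le n (y : 'I_n -> R) xi : dsum y xi <= n%:R.
Proof.
rewrite -(@ler_pXn2r _ 2) ?nnegrE ?dsum_ge0 ?ler0n// dsum_sqr.
by have := modsq_le y xi; rewrite card_ord.
Qed.

Lemma tame_dsum p w n (y : 'I_n -> R) : 0 <= p -> tame w ->
  tame (fun xi => w xi * dsum y xi `^ p).
Proof.
move=> p0 tw; apply: (tameM tw (M := n%:R `^ p)).
  apply: (measurableT_comp (measurable_powR p)); apply: continuous_measurable_fun => xi.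
  apply: (@continuous_comp _ _ _ (modsq y) Num.sqrt); first exact: modsq_cont.
  exact: sqrt_continuous.
by move=> x; rewrite ger0_norm ?powR_ge0//; apply: le_powR; rewrite ?dsum_ge0 ?dsum_le.
Qed.

Definition mscale (I : finType) (m : I -> nat) (b : R) (i : I) : R := b * (m i)%:R.

(** Quantified over the weight because its scale, a multiple of lam, is fixed only after [n]. *)
Definition pow_mean_le p n (m : 'I_n -> nat) (V : R) := forall w L, oscillating w ->
  (forall x, 0 <= w x) -> 0 < itg w -> L l @[l --> \oo] --> +oo ->
  \forall l \near \oo, itg (fun xi => w xi * dsum (mscale m (L l)) xi `^ p) <= V * itg w.

Definition pow_mean_ge p n (m : 'I_n -> nat) (V : R) := forall w L, oscillating w ->
  (forall x, 0 <= w x) -> 0 < itg w -> L l @[l --> \oo] --> +oo ->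
  \forall l \near \oo, V * itg w <= itg (fun xi => w xi * dsum (mscale m (L l)) xi `^ p).

Lemma modsq_near w L (I : finType) (m : I -> nat) (e : R) : 0 < e -> oscillating w ->
  0 < itg w -> L l @[l --> \oo] --> +oo ->
  \forall l \near \oo, ((coinc m)%:R - e) * itg w <= itg (fun xi => w xi * modsq (mscale m (L l)) xi)
    <= ((coinc m)%:R + e) * itg w.
Proof.
move=> e0 ow w0 hL; have h := modsq_limit (m := m) ow hL.
have ew : 0 < e * itg w by rewrite mulr_gt0.
move/cvgrPdist_le : h => /(_ _ ew); apply: filterS => l.
by rewrite ler_distl; set c := itg _; lra.
Qed.

(** The averages of [modsq] tend to coincidence counts; each [+ 1] is room for reaching the
    limit. *)
Lemma pow_mean_le_of p n (m : 'I_n -> nat) (I1 I2 : finType) (m1 : I1 -> nat) (m2 : I2 -> nat)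
    (c0 c1 c2 : R) : 0 <= p -> 0 <= c1 -> 0 <= c2 ->
  (forall b xi, dsum (mscale m b) xi `^ p <=
     c0 + c1 * modsq (mscale m1 b) xi + c2 * modsq (mscale m2 b) xi) ->
  pow_mean_le p m (c0 + c1 * ((coinc m1)%:R + 1) + c2 * ((coinc m2)%:R + 1)).
Proof.
move=> p0 c10 c20 h w L ow w0 iw hL; have tw := ow.1.
have n1 := modsq_near m1 ltr01 ow iw hL; have n2 := modsq_near m2 ltr01 ow iw hL.
near=> l.
have /andP[_ b1] : ((coinc m1)%:R - 1) * itg w <= itg (fun xi => w xi * modsq (mscale m1 (L l)) xi)
    <= ((coinc m1)%:R + 1) * itg w by near: l.
have /andP[_ b2] : ((coinc m2)%:R - 1) * itg w <= itg (fun xi => w xi * modsq (mscale m2 (L l)) xi)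
    <= ((coinc m2)%:R + 1) * itg w by near: l.
have t1 := tame_modsq (mscale m1 (L l)) tw; have t2 := tame_modsq (mscale m2 (L l)) tw.
apply: le_trans (_ : itg (fun xi => c0 * w xi + (c1 * (w xi * modsq (mscale m1 (L l)) xi) +
   c2 * (w xi * modsq (mscale m2 (L l)) xi))) <= _).
  apply: le_itg; [exact: tame_dsum|by apply: tameD; [exact: tameZ|apply: tameD; exact: tameZ]|move=> xi].
  have := ler_wpM2l (w0 xi) (h (L l) xi); lra.
rewrite itgD; [|exact: tameZ|by apply: tameD; exact: tameZ].
rewrite itgD; [|exact: tameZ|exact: tameZ].
rewrite !itgZ//.
have := ler_wpM2l c10 b1; have := ler_wpM2l c20 b2; lra.
Unshelve. all: by end_near. Qed.

Lemma pow_mean_ge_of p n (m : 'I_n -> nat) (I1 I2 : finType) (m1 : I1 -> nat) (m2 : I2 -> nat)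
    (A B : R) : 0 <= p -> 0 < A -> 0 <= B -> 0 < (coinc m1)%:R - B * (coinc m2)%:R ->
  (forall b xi, modsq (mscale m1 b) xi <=
     B * modsq (mscale m2 b) xi + A * dsum (mscale m b) xi `^ p) ->
  pow_mean_ge p m (((coinc m1)%:R - B * (coinc m2)%:R) / (2 * A)).
Proof.
move=> p0 A0 B0 D0 h w L ow w0 iw hL; have tw := ow.1.
(* The total error e (1 + B) is half the gap, whence the factor 2 in the conclusion. *)
pose e := ((coinc m1)%:R - B * (coinc m2)%:R) / (2 * (1 + B)).
have e0 : 0 < e by rewrite divr_gt0// mulr_gt0// ltr_wpDr.
have n1 := modsq_near m1 e0 ow iw hL; have n2 := modsq_near m2 e0 ow iw hL.
near=> l.
have /andP[b1 _] : ((coinc m1)%:R - e) * itg w <= itg (fun xi => w xi * modsq (mscale m1 (L l)) xi)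
    <= ((coinc m1)%:R + e) * itg w by near: l.
have /andP[_ b2] : ((coinc m2)%:R - e) * itg w <= itg (fun xi => w xi * modsq (mscale m2 (L l)) xi)
    <= ((coinc m2)%:R + e) * itg w by near: l.
have t1 := tame_modsq (mscale m1 (L l)) tw; have t2 := tame_modsq (mscale m2 (L l)) tw.
have td := tame_dsum (mscale m (L l)) p0 tw.
have : itg (fun xi => w xi * modsq (mscale m1 (L l)) xi) <=
   B * itg (fun xi => w xi * modsq (mscale m2 (L l)) xi) +
   A * itg (fun xi => w xi * dsum (mscale m (L l)) xi `^ p).
  rewrite -!itgZ// -itgD; [|exact: tameZ|exact: tameZ].
  apply: le_itg; [by []|by apply: tameD; exact: tameZ|move=> xi].
  have := ler_wpM2l (w0 xi) (h (L l) xi); lra.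
have ee : e * (1 + B) = ((coinc m1)%:R - B * (coinc m2)%:R) / 2.
  by rewrite /e; field; rewrite gt_eqF// ltr_wpDr.
rewrite invfM mulrA mulrAC ler_pdivrMr// => k.
have := ler_wpM2l B0 b2.
have e1 : e * (1 + B) * itg w = ((coinc m1)%:R - B * (coinc m2)%:R) / 2 * itg w by rewrite ee.
move: k b1 e1; set X := itg (fun xi => w xi * modsq _ xi); set Y := itg (fun xi => w xi * modsq _ xi).
set Z := itg _; lra.
Unshelve. all: by end_near. Qed.

Lemma powR_small (be C eta : R) : 0 < be -> 0 < eta -> 0 < C ->
  exists t0 : nat, forall t : nat, (t0 <= t)%N -> C * t%:R `^ (- be) <= eta.
Proof.
move=> be0 eta0 C0; pose z := (C / eta) `^ be^-1.
have z0 : 0 < z by rewrite powR_gt0// divr_gt0.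
exists (Num.truncn z).+1 => t ht.
have zt : z <= t%:R.
  apply: le_trans (ltW (truncnS_gt z)) _; by rewrite ler_nat.
have : t%:R `^ (- be) <= z `^ (- be) by apply: powR_antimono; lra.
have -> : z `^ (- be) = eta / C.
  rewrite /z -powRrM mulrN mulVf ?gt_eqF// powRN powRr1 ?invf_div// divr_ge0//; exact: ltW.
by rewrite ler_pdivlMr// mulrC.
Qed.

Definition mid n (j : 'I_n) : nat := j.
Definition mpow n (j : 'I_n) : nat := (4 ^ j)%N.

Lemma mid_inj n : injective (@mid n). Proof. exact: val_inj. Qed.
Lemma mpow_inj n : injective (@mpow n).
Proof. by move=> i j /eqP; rewrite eqn_exp2l// => /eqP/val_inj. Qed.

Lemma coinc_mid n : coinc (@mid n) = n.
Proof. by rewrite coinc_inj ?card_ord//; exact: mid_inj. Qed.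
Lemma coinc_mpow n : coinc (@mpow n) = n.
Proof. by rewrite coinc_inj ?card_ord//; exact: mpow_inj. Qed.

Lemma modsq_mid n b (xi : R) : modsq (mscale (@mid n) b) xi = dirichlet n (b * xi).
Proof.
rewrite /dirichlet /modsq; congr (_ ^+ 2 + _ ^+ 2); apply: eq_bigr => i _;
  by rewrite /mscale /mid mulrA (mulrC i%:R).
Qed.

Lemma modsq_mscale_sqr (I : finType) (m : I -> nat) b (xi : R) :
  modsq (mscale m b) xi ^+ 2 = modsq (mscale (fun ij : I * I => m ij.1 + m ij.2)%N b) xi.
Proof.
rewrite modsq_sqr; congr modsq; apply/funext => ij.
by rewrite /mscale natrD mulrDr.
Qed.

Lemma dsum_mscale_pow4 n (m : 'I_n -> nat) b (xi : R) : dsum (mscale m b) xi ^+ 4 =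
  modsq (mscale (fun ij : 'I_n * 'I_n => m ij.1 + m ij.2)%N b) xi.
Proof. by rewrite -modsq_mscale_sqr -dsum_sqr -exprM. Qed.

(** Away from the peak, where |1 - exp(i b xi)| >= 1/N, the sum is at most 2 N. On the peak the
    power is split at [sg]: large values are charged to the second moment, small ones to the measure
    of the peak, estimated by the kernel of length [N]. *)
Lemma mid_mean_le p n N (sg : R) : 0 <= p -> p < 2 -> 0 < sg -> (0 < N)%N ->
  pow_mean_le p (@mid n) ((2 * N%:R) `^ p + sg `^ (p - 2) * (n%:R + 1) +
    4 * sg `^ p / N%:R ^+ 2 * (N%:R + 1)).
Proof.
move=> p0 p2 s0 N0; have N2 : 0 < (N%:R : R) ^+ 2 by rewrite exprn_gt0// ltr0n.
rewrite (_ : n%:R = (coinc (@mid n))%:R); last by rewrite coinc_mid.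
rewrite (_ : (N%:R + 1) = (coinc (@mid N))%:R + 1); last by rewrite coinc_mid.
apply: pow_mean_le_of => //.
- exact: powR_ge0.
- by rewrite divr_ge0 ?mulr_ge0 ?powR_ge0// ltW.
move=> b xi; have [h|h] := leP (N%:R ^+ 2)^-1 (2 - 2 * cos (b * xi)).
  rewrite -addrA ler_wpDr//.
    by rewrite addr_ge0// mulr_ge0 ?modsq_ge0 ?divr_ge0 ?mulr_ge0 ?powR_ge0// ltW.
  apply: le_powR; rewrite ?dsum_ge0//.
  rewrite -(@ler_pXn2r _ 2) ?nnegrE ?dsum_ge0 ?mulr_ge0// dsum_sqr modsq_mid.
  by have := dirichlet_far n N0 h; lra.
have := dirichlet_near (ltW h); rewrite -modsq_mid => k.
apply: le_trans (powR_lt2_split p0 (dsum_ge0 _ _) p2 s0) _.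
rewrite dsum_sqr -addrA ler_wpDl ?powR_ge0// lerD2l.
rewrite (_ : 4 * sg `^ p / _ * _ = sg `^ p * (4 * modsq (mscale (@mid N) b) xi / N%:R ^+ 2)); last by ring.
by rewrite ler_peMr ?powR_ge0// ler_pdivlMr//; lra.
Qed.

Lemma mpow_mean_le p n : 2 < p -> (0 < n)%N ->
  pow_mean_le p (@mpow n) (n%:R `^ (p / 2) + (n%:R `^ (p / 2 - 2) + n%:R `^ (p - 4)) * (2 * n%:R ^+ 2 + 1)).
Proof.
move=> p2 n0; have p0 : 0 <= p by lra.
have n1 : 1 <= n%:R :> R by rewrite ler1n.
(* The threshold is the typical size of the sum, and s^2 = n is its maximum. *)
pose s : R := Num.sqrt n%:R.
have s1 : 1 <= s by rewrite -[leLHS]sqrtr1 ler_wsqrtr.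
have s2 : s ^+ 2 = n%:R by rewrite sqr_sqrtr.
have sq a : s `^ a = n%:R `^ (a / 2).
  by rewrite -s2 -powR_sqr ?sqrtr_ge0// -powRrM; congr (_ `^ _); field.
pose c1 : R := n%:R `^ (p / 2 - 2) + n%:R `^ (p - 4).
have c10 : 0 <= c1 by rewrite addr_ge0 ?powR_ge0.
have := @pow_mean_le_of p n (@mpow n) _ _ (fun ij : 'I_n * 'I_n => mpow ij.1 + mpow ij.2)%N
  (@mid n) (n%:R `^ (p / 2)) c1 0 p0 c10 (lexx _).
move=> H w L ow w0 iw hL; apply: filterS (H _ w L ow w0 iw hL).
  move=> l /le_trans; apply; rewrite ler_wpM2r ?(ltW iw)// mul0r addr0 lerD2l ler_wpM2l// lerD2r.
  by have := coinc_pow4 n; rewrite -(ler_nat R) natrM natrX.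
move=> b xi; rewrite mul0r addr0 -dsum_mscale_pow4.
apply: le_trans (powR_gt2_split p0 (dsum_ge0 _ _) p2 s1 _) _.
  by rewrite s2 dsum_le.
rewrite s2 !sq /c1 (_ : (p - 4) / 2 = p / 2 - 2)//; by field.
Qed.

Lemma mpow_mean_ge p n : 1 <= p -> p < 2 -> (0 < n)%N ->
  pow_mean_ge p (@mpow n) (2 `^ (p - 4) * n%:R `^ (p / 2)).
Proof.
move=> p1 p2 n0; have p0 : 0 <= p by lra.
have n1 : 0 < n%:R :> R by rewrite ltr0n.
(* Then s^-2 times the energy bound 2 n^2 is n / 2, half of the second moment. *)
pose s : R := 2 * Num.sqrt n%:R.
have s0 : 0 < s by rewrite mulr_gt0// sqrtr_gt0.
have s2 : s ^+ 2 = 4 * n%:R by rewrite exprMn sqr_sqrtr ?ler0n//; ring.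
pose M2 := (fun ij : 'I_n * 'I_n => mpow ij.1 + mpow ij.2)%N.
have B0 : 0 <= (s ^+ 2)^-1 by rewrite invr_ge0 sqr_ge0.
have c2 : (coinc M2)%:R <= 2 * n%:R ^+ 2 :> R.
  by have := coinc_pow4 n; rewrite -(ler_nat R) natrM natrX.
have D0 : n%:R / 2 <= (coinc (@mpow n))%:R - (s ^+ 2)^-1 * (coinc M2)%:R.
  rewrite coinc_mpow; have := ler_wpM2l B0 c2.
  rewrite {2}s2 (_ : (4 * n%:R)^-1 * (2 * n%:R ^+ 2) = n%:R / 2 :> R); last first.
    by field; rewrite gt_eqF.
  lra.
have D1 : 0 < (coinc (@mpow n))%:R - (s ^+ 2)^-1 * (coinc M2)%:R by apply: lt_le_trans D0; lra.
have A0 : 0 < s `^ (2 - p) by exact: powR_gt0.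
have := @pow_mean_ge_of p n (@mpow n) _ _ (@mpow n) M2 _ _ p0 A0 B0 D1.
move=> H w L ow w0 iw hL; apply: filterS (H _ w L ow w0 iw hL).
  move=> l; apply: le_trans; rewrite ler_wpM2r ?(ltW iw)//.
  apply: le_trans (_ : n%:R / 2 / (2 * s `^ (2 - p)) <= _); last first.
    by rewrite ler_wpM2r// invr_ge0 mulr_ge0// ltW.
  rewrite ler_pdivlMr ?mulr_gt0// /s powRM ?sqrtr_ge0//.
  have -> : Num.sqrt (n%:R : R) = n%:R `^ 2^-1 by rewrite powR12_sqrt ?ler0n.
  rewrite -powRrM.
  have e1 : n%:R = n%:R `^ (p / 2) * n%:R `^ (2^-1 * (2 - p)) :> R.
    by rewrite -[LHS]powRr1 ?ler0n// (powR_split 1 (p / 2) n1); congr (_ * _ `^ _); field.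
  have e2 : 2 `^ (2 - p) = 4 / 2 `^ p :> R.
    rewrite powRB ?gt_eqF ?implybT// powR_sqr//; congr (_ / _); ring.
  have e3 : 2 `^ (p - 4) = 2 `^ p / 16 :> R.
    by rewrite (@powR_split _ 2 p 4)// (powR_mulrn 4 (ler0n _ 2)); field.
  have q0 : 0 < 2 `^ p :> R by rewrite powR_gt0.
  rewrite {3}e1 e2 e3; set u := n%:R `^ (p / 2); set v := n%:R `^ (2^-1 * (2 - p)).
  by rewrite le_eqVlt; apply/orP; left; apply/eqP; field; rewrite gt_eqF.
move=> b xi; rewrite -dsum_mscale_pow4 -dsum_sqr.
by have := sqr_le_split p0 (dsum_ge0 (mscale (@mpow n) b) xi) p2 s0; lra.
Qed.

Lemma mid_mean_ge p a : 2 < p -> (0 < a)%N ->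
  pow_mean_ge p (@mid (3 * a)) ((4 * (6 `^ (p / 2 - 2) + 3 `^ (4 - p)))^-1 * a%:R `^ (p - 1)).
Proof.
move=> p2 a0; have p0 : 0 <= p by lra.
have a1 : 0 < a%:R :> R by rewrite ltr0n.
(* Then s^2 times the second moment 3 a is a^3 / 2, half of the energy bound a^3. *)
pose s : R := a%:R / Num.sqrt 6.
have s60 : 0 < Num.sqrt 6 :> R by rewrite sqrtr_gt0.
have s0 : 0 < s by rewrite divr_gt0.
have s2 : s ^+ 2 = a%:R ^+ 2 / 6 by rewrite expr_div_n sqr_sqrtr.
pose M1 := (fun ij : 'I_(3 * a) * 'I_(3 * a) => mid ij.1 + mid ij.2)%N.
have B0 : 0 <= s ^+ 2 by rewrite sqr_ge0.
have c1 : a%:R ^+ 3 <= (coinc M1)%:R :> R.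
  by have := coinc_progression a; rewrite -(ler_nat R) natrX.
have D0 : a%:R ^+ 3 / 2 <= (coinc M1)%:R - s ^+ 2 * (coinc (@mid (3 * a)))%:R.
  rewrite coinc_mid s2 natrM.
  rewrite (_ : a%:R ^+ 2 / 6 * (3 * a%:R) = a%:R ^+ 3 / 2 :> R); last by field.
  lra.
have a3 : 0 < a%:R ^+ 3 :> R by rewrite exprn_gt0.
have D1 : 0 < (coinc M1)%:R - s ^+ 2 * (coinc (@mid (3 * a)))%:R by apply: lt_le_trans D0; lra.
have n0 : 0 < (3 * a)%:R :> R by rewrite ltr0n; lia.
pose A : R := s `^ (4 - p) + (3 * a)%:R `^ (4 - p).
have A0 : 0 < A by rewrite addr_gt0 ?powR_gt0.
have := @pow_mean_ge_of p (3 * a) (@mid _) _ _ M1 (@mid _) _ _ p0 A0 B0 D1.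
move=> H w L ow w0 iw hL; apply: filterS (H _ w L ow w0 iw hL).
  move=> l; apply: le_trans; rewrite ler_wpM2r ?(ltW iw)//.
  apply: le_trans (_ : a%:R ^+ 3 / 2 / (2 * A) <= _); last first.
    by rewrite ler_wpM2r// invr_ge0 mulr_ge0// ltW.
  have eA : A = a%:R `^ (4 - p) * (6 `^ (p / 2 - 2) + 3 `^ (4 - p)).
    rewrite /A /s natrM !powRM ?invr_ge0 ?sqrtr_ge0//.
    have -> : Num.sqrt (6 : R) = 6 `^ 2^-1 by rewrite powR12_sqrt.
    rewrite -powRN -powRrM (_ : - 2^-1 * (4 - p) = p / 2 - 2); last by field.
    ring.
  have e1 : a%:R ^+ 3 = a%:R `^ (4 - p) * a%:R `^ (p - 1) :> R.
    by rewrite -powR_mulrn// (powR_split 3%:R (4 - p) a1); congr (_ * _ `^ _); ring.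
  set q := 6 `^ (p / 2 - 2) + 3 `^ (4 - p); rewrite -/q in eA.
  have q0 : 0 < q by rewrite addr_gt0 ?powR_gt0.
  have v0 : 0 < a%:R `^ (4 - p) :> R by rewrite powR_gt0.
  rewrite e1 eA; set u := a%:R `^ (p - 1); set v := a%:R `^ (4 - p) in v0 *.
  by rewrite le_eqVlt; apply/orP; left; apply/eqP; field; rewrite !gt_eqF.
move=> b xi; rewrite -dsum_mscale_pow4 -dsum_sqr /A.
by apply: pow4_le_split => //; [exact: dsum_ge0|exact: dsum_le].
Qed.

(** [eta] becomes small while [c] stays fixed. Monotonicity of both configurations keeps the
    solitons in the order of their indices, injectivity makes the speeds distinct, and [n0] allows
    lam <= 1. *)
Definition inflating p (ga c : R) := forall eta : R, 0 < eta -> forall n0 : nat,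
  exists n, exists m0 m1 : 'I_n -> nat,
    [/\ (0 < n)%N /\ (n0 <= n)%N, {homo m0 : i j / (i < j)%N} /\ {homo m1 : i j / (i < j)%N},
        injective (fun j => (m1 j)%:R - (m0 j)%:R : R),
        pow_mean_le p m0 (eta * n%:R `^ ga) & pow_mean_ge p m1 (c * n%:R `^ ga)].

Lemma pow_mean_le_trans p n (m : 'I_n -> nat) V V' : V <= V' -> pow_mean_le p m V -> pow_mean_le p m V'.
Proof.
move=> VV h w L ow w0 iw hL; apply: filterS (h w L ow w0 iw hL) => l /le_trans; apply.
by rewrite ler_wpM2r// ltW.
Qed.

Lemma mid_homo n : {homo @mid n : i j / (i < j)%N}. Proof. by []. Qed.
Lemma mpow_homo n : {homo @mpow n : i j / (i < j)%N}.
Proof. by move=> i j ij; rewrite ltn_exp2l. Qed.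

Lemma inflating_lt2 p : 1 <= p -> p < 2 -> inflating p (p / 2) (2 `^ (p - 4)).
Proof.
move=> p1 p2 eta eta0 n0; have p0 : 0 <= p by lra.
have C0 : 0 < 2 `^ p + 10 :> R by rewrite ltr_wpDl ?powR_ge0.
have be0 : 0 < 2 - p by lra.
have [t0 ht0] := powR_small be0 eta0 C0.
pose t := (maxn t0 n0).+1.
have t1 : 1 <= t%:R :> R by rewrite ler1n.
have tp : 0 < t%:R :> R by apply: lt_le_trans t1.
have tn : (t <= t ^ 16)%N by rewrite -{1}(expn1 t) leq_pexp2l.
have e16 a : (t ^ 16)%:R `^ a = t%:R `^ (16 * a) :> R.
  by rewrite natrX -(powR_mulrn 16 (ltW tp)) -powRrM.
(* With n = t^16, the threshold t^9 lies slightly above sqrt n = t^8, and N = t^4. Up to constants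
   the three terms of the small mean are at most t^(9 p - 2) = t^(- (2 - p)) n^(p / 2). *)
exists (t ^ 16)%N, (@mid _), (@mpow _); split.
- by split; [apply: leq_trans tn|apply: leq_trans tn; rewrite /t; lia].
- by split; [exact: mid_homo|exact: mpow_homo].
- exact: pow4_sub_inj.
- have s0 : 0 < t%:R `^ 9 :> R by rewrite powR_gt0.
  have N0 : (0 < t ^ 4)%N by rewrite expn_gt0.
  apply: pow_mean_le_trans (mid_mean_le (t ^ 16)%N p0 p2 s0 N0).
  have e4 : (t ^ 4)%:R = t%:R `^ 4 :> R by rewrite natrX (powR_mulrn 4 (ltW tp)).
  have f16 : (t ^ 16)%:R = t%:R `^ 16 :> R by rewrite natrX (powR_mulrn 16 (ltW tp)).
  have le1 a b : a <= b -> t%:R `^ a <= t%:R `^ b :> R by move=> ab; apply: ler_powR.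
  have d a b : t%:R `^ (a + b) = t%:R `^ a * t%:R `^ b :> R.
    by rewrite powRD// (gt_eqF tp) implybT.
  rewrite e16 powRM ?powR_ge0// e4 f16 -!powRrM -(powR_mulrn 2 (powR_ge0 _ _)) -powRrM.
  have h := ht0 t; have {}h : (2 `^ p + 10) * t%:R `^ (- (2 - p)) <= eta by apply: h; rewrite /t; lia.
  apply: le_trans (_ : (2 `^ p + 10) * t%:R `^ (- (2 - p)) * t%:R `^ (16 * (p / 2)) <= _); last first.
    by rewrite ler_wpM2r ?powR_ge0.
  rewrite -[leRHS]mulrA -d (_ : - (2 - p) + 16 * (p / 2) = 9 * p - 2); last by field.
  set z := t%:R `^ (9 * p - 2).
  have h1 : t%:R `^ (4 * p) <= z by apply: le1; lra.
  have h2 : t%:R `^ (9 * (p - 2)) * t%:R `^ 16 = z by rewrite -d; congr (_ `^ _); ring.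
  have h3 : t%:R `^ (9 * p) * (t%:R `^ (4 * 2))^-1 * t%:R `^ 4 <= z.
    by rewrite -powRN -!d; apply: le1; lra.
  have g1 : 1 <= t%:R `^ 16 :> R by rewrite -f16 ler1n expn_gt0.
  have g2 : 1 <= t%:R `^ 4 :> R by rewrite -e4 ler1n expn_gt0.
  have k1 := ler_wpM2l (powR_ge0 2 p) h1.
  have k2 := ler_wpM2l (powR_ge0 t%:R (9 * (p - 2))) g1.
  have i0 : 0 <= t%:R `^ (9 * p) * (t%:R `^ (4 * 2))^-1 by rewrite mulr_ge0 ?invr_ge0 ?powR_ge0.
  have k3 := ler_wpM2l i0 g2.
  lra.
- by apply: mpow_mean_ge => //; rewrite expn_gt0.
Qed.

Lemma inflating_gt2 p : 2 < p -> exists2 c : R, 0 < c & inflating p (p - 1) c.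
Proof.
move=> p2; have p0 : 0 <= p by lra.
exists ((4 * (6 `^ (p / 2 - 2) + 3 `^ (4 - p)))^-1 / 3 `^ (p - 1)).
  by rewrite divr_gt0 ?powR_gt0// invr_gt0 mulr_gt0// addr_gt0 ?powR_gt0.
(* [be] is the gain: the exponents p / 2 and p - 2 of the small mean are both at most p - 1 - be.
   The constant 7 below is 1 + 2 (2 + 1). *)
move=> eta eta0 n0; pose be := Num.min 1 (p / 2 - 1).
have be0 : 0 < be by rewrite lt_min; apply/andP; split; lra.
have [b1 b2] : be <= 1 /\ be <= p / 2 - 1 by rewrite !ge_min !lexx orbT.
have [|t0 ht0] := powR_small be0 eta0 (C := 7); first by [].
pose a := (maxn t0 n0).+1; pose n := (3 * a)%N.
have n1 : 1 <= n%:R :> R by rewrite ler1n; lia.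
have np : 0 < n%:R :> R by apply: lt_le_trans n1.
have le1 u v : u <= v -> n%:R `^ u <= n%:R `^ v :> R by move=> ab; apply: ler_powR.
have d u v : n%:R `^ (u + v) = n%:R `^ u * n%:R `^ v :> R.
  by rewrite powRD// (gt_eqF np) implybT.
exists n, (@mpow _), (@mid _); split.
- by split; rewrite /n /a; lia.
- by split; [exact: mpow_homo|exact: mid_homo].
- move=> i j e; apply: (@pow4_sub_inj n R); rewrite /mid /mpow in e; lra.
- have n0' : (0 < n)%N by rewrite /n; lia.
  apply: pow_mean_le_trans (mpow_mean_le p2 n0').
  have h : 7 * n%:R `^ (- be) <= eta by apply: ht0; rewrite /n /a; lia.
  apply: le_trans (_ : 7 * n%:R `^ (- be) * n%:R `^ (p - 1) <= _); last first.
    by rewrite ler_wpM2r ?powR_ge0.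
  rewrite -[leRHS]mulrA -d; set z := n%:R `^ (- be + _).
  have q : n%:R ^+ 2 = n%:R `^ 2 :> R by rewrite (powR_mulrn 2 (ltW np)).
  have h1 : n%:R `^ (p / 2) <= z by apply: le1; lra.
  have h2 : n%:R `^ (p / 2 - 2) * n%:R `^ 2 <= z by rewrite -d; apply: le1; lra.
  have h3 : n%:R `^ (p - 4) * n%:R `^ 2 <= z by rewrite -d; apply: le1; lra.
  have g : 1 <= n%:R `^ 2 :> R by rewrite -q exprn_ege1.
  have k1 := ler_wpM2l (powR_ge0 n%:R (p / 2 - 2)) g.
  have k2 := ler_wpM2l (powR_ge0 n%:R (p - 4)) g.
  rewrite q; lra.
- have a0 : (0 < a)%N by [].
  move=> w L ow w0 iw hL; apply: filterS (mid_mean_ge p2 a0 ow w0 iw hL) => l.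
  set X := itg _; rewrite /n natrM powRM ?ler0n// mulrA divfK ?lt0r_neq0 ?powR_gt0//.
Qed.

Lemma inflating_ex p : 1 <= p -> p != 2 ->
  exists ga c : R, [/\ 0 < ga, 0 < c & inflating p ga c].
Proof.
move=> p1 np2; have [p2|p2] := ltP p 2.
  by exists (p / 2), (2 `^ (p - 4)); split; [lra|exact: powR_gt0|exact: inflating_lt2].
have {}p2 : 2 < p by rewrite lt_neqAle eq_sym np2.
by have [c c0 h] := inflating_gt2 p2; exists (p - 1), c; split => //; lra.
Qed.

End Config.

(** * Fourier transform of one soliton *)

Section BumpFamily.
Context {R : realType}.
Implicit Types (c x xi lam : R) (i m : nat).

Lemma tame_scale (f : R -> R) c : 0 < c -> tame f -> tame (fun x => f (c * x)).
Proof.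
move=> c0 [mf [C hC]]; apply: (@tame_le _ _ (fun x => C * bell (c * x))).
- apply: (measurableT_comp mf); apply: continuous_measurable_fun => x.
  by apply: cvgM; [exact: cvg_cst|exact: cvg_id].
- by apply: tameZ; exact: tame_bellZ.
- by move=> x; apply: le_trans (hC (c * x)) _; exact: ler_norm.
Qed.

Let k1 (_ : 'I_1) : R := 1.
Let g1 (_ : 'I_1) : R := Num.sqrt (2 * 1).
Let k10 (i : 'I_1) : 0 < k1 i. Proof. exact: ltr01. Qed.
Let k1I : injective k1. Proof. by move=> i j _; rewrite (ord1 i) (ord1 j). Qed.
Let g10 (i : 'I_1) : 0 < g1 i. Proof. by rewrite sqrtr_gt0 mulr_gt0. Qed.

Definition bumpF1 i : R -> R := fe k1 g1 (iter i (dx k1) (Re k1 0)) 0.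
(** The i-th derivative of [bump c], scaled from c = 1 so that bounds are explicit in [c]. *)
Definition bumpF c i x : R := c ^+ i.+1 * bumpF1 i (c * x).

Lemma bumpF1_0 : bumpF1 0 = bump 1.
Proof. by rewrite /bumpF1 /= -rs_fe bump_rs. Qed.

Lemma bumpF1_tame i : tame (bumpF1 i).
Proof. by apply: fe_tame => //; apply: mindeg_iter_dx; exact: mindeg_Re. Qed.

Lemma bumpF_0 c : bumpF c 0 = bump c.
Proof.
apply/funext => x; rewrite /bumpF bumpF1_0 expr1 /bump.
rewrite (_ : - (2 * 1) * (c * x) = - (2 * c) * x); last by ring.
ring.
Qed.

Lemma bumpF_nice c : 0 < c -> nice (bumpF c).
Proof.
move=> c0 i; split.
  by apply: tameZ; apply: (tame_scale c0); exact: bumpF1_tame.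
move=> x; have d : der (c * x) (bumpF1 i) (bumpF1 i.+1 (c * x)) by exact: fe_dx.
apply: der_eq (derZ _ (@der_comp _ x (bumpF1 i) (fun y => c * y) _ _ d (derZ c (der_id x)))) _.
by rewrite mulr1 mulrA mulrAC -exprSr.
Qed.

Lemma bump_gt0 c x : 0 < c -> 0 < bump c x.
Proof.
by move=> c0; rewrite /bump divr_gt0 ?mulr_gt0 ?expR_gt0 // ltr_wpDr ?exprn_ge0 ?expR_ge0.
Qed.

Lemma bumpF_bound i : exists2 C : R, 0 <= C & forall c x, 0 < c ->
  `|bumpF c i x| <= c ^+ i.+1 * C * bell (c * x).
Proof.
have [_ [C hC]] := bumpF1_tame i; exists `|C| => // c x c0.
rewrite /bumpF normrM ger0_norm ?exprn_ge0 ?(ltW c0)// -mulrA ler_wpM2l ?exprn_ge0 ?(ltW c0)//.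
by apply: le_trans (hC _) _; rewrite ler_wpM2r ?ler_norm// ltW// bell_gt0.
Qed.

Lemma itg_bumpF i : exists2 C : R, 0 <= C & forall c, 0 < c ->
  itg (fun x => `|bumpF c i x|) <= C * c ^+ i.
Proof.
have [C C0 hC] := bumpF_bound i; exists (C * pi); first by rewrite mulr_ge0// ltW// pi_gt0.
move=> c c0; apply: le_trans (_ : itg (fun x : R => c ^+ i.+1 * C * bell (c * x)) <= _).
  apply: le_itg => //; first by apply: tame_norm; exact: (bumpF_nice c0 i).1.
    by apply: tameZ; exact: tame_bellZ.
  by move=> x; exact: hC.
rewrite itgZ; last exact: tame_bellZ.
rewrite itg_bellZ// exprS le_eqVlt; apply/orP; left; apply/eqP; field; by rewrite gt_eqF.
Qed.

Definition fdeg (s : R) : nat := (Num.truncn (`|s| + 2)).+1.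

Lemma fdegP (s : R) : `|s| + 2 <= (fdeg s)%:R.
Proof. by apply: ltW; exact: truncnS_gt. Qed.

(** In the variable eta = xi / lam the bounds on the transform do not depend on lam; as lam <= 1,
    |xi| <= |eta|, and the decay in eta absorbs the weight. *)
Lemma wt_bump_upper (p s : R) : 1 <= p -> exists2 C : R, 0 < C & forall lam xi, 0 < lam -> lam <= 1 ->
  wt p s (modhat (bump lam) xi) xi <= C * bell (lam^-1 * xi).
Proof.
move=> p1; have [A A0 hA] := itg_bumpF 0; have [B B0 hB] := itg_bumpF (2 * fdeg s).
pose C := Num.sqrt (2 ^+ fdeg s * (2 * A * (2 * A + 2 * B))) `^ p.
exists (C + 1); first by rewrite ltr_wpDl ?powR_ge0.
move=> lam xi l0 l1; apply: le_trans (_ : C * bell (lam^-1 * xi) <= _); last first.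
  by rewrite ler_wpM2r ?lerDl// ltW// bell_gt0.
have nF := bumpF_nice l0.
apply: (wt_bound p1 (fdegP s) (modhat_ge0 _ _)).
- rewrite -bumpF_0; apply: le_trans (modhat_le _ (nF 0%N).1) _.
  by rewrite ler_wpM2l//; have := hA _ l0; rewrite expr0 mulr1.
- rewrite normrM exprMn -mulrA -bumpF_0 normfV exprVn ler_pdivrMl ?exprn_gt0 ?normr_gt0 ?gt_eqF//.
  apply: le_trans (modhat_decay _ _ nF) _.
  by have := hB _ l0; rewrite (gtr0_norm l0); lra.
- rewrite normrM ler_peMl// normfV (gtr0_norm l0).
  by rewrite invf_ge1.
Qed.

Lemma cos_ge_lin (t : R) : 1 - `|t| <= cos t.
Proof.
have [c _] := @der_MVT R cos (fun x => - sin x) 0 t (fun x => is_derive_cos x).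
rewrite cos0 subr0 => e; have : `|cos t - 1| <= `|t|.
  by rewrite e normrM normrN ler_piMl// sin_max.
by rewrite ler_norml => /andP[]; lra.
Qed.

(** From [bump c] <= c and the first trace identity. *)
Lemma itg_bump_ge1 c : 0 < c -> 1 <= itg (bump c).
Proof.
move=> c0; rewrite -(@ler_pM2l _ c)// mulr1 -[leLHS](itg_bump_sqr c0).
have tb := bump_tame c0; rewrite -itgZ//; apply: le_itg; [exact: bump_sqr_tame|exact: tameZ|move=> x].
by rewrite expr2 ler_wpM2r ?bump_le// ltW// bump_gt0.
Qed.

Lemma bump_moment : exists2 C : R, 0 < C & forall c x, 0 < c -> `|x| * bump c x <= C * bell (c * x).
Proof.
have e2 : (2 <= mindeg (Re k1 0))%N by exact: mindeg_Re.
have [M0 h0] := fe_decay k10 g10 k1I 0 0 e2; have [M2 h2] := fe_decay k10 g10 k1I 0 2 e2.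
have [M4 h4] := fe_decay k10 g10 k1I 0 4 e2.
have z : `|0 : R| <= 0 by rewrite normr0.
have {}h0 x := h0 0 x z; have {}h2 x := h2 0 x z; have {}h4 x := h4 0 x z.
have M00 : 0 <= M0 by apply: le_trans (h0 0).
have M20 : 0 <= M2 by apply: le_trans (h2 0).
have M40 : 0 <= M4 by apply: le_trans (h4 0).
exists (M0 + 2 * M2 + M4 + 1); first lra.
have main y : `|y| * bump 1 y <= (M0 + 2 * M2 + M4 + 1) * bell y.
  have b0 := bump_gt0 y (@ltr01 R).
  have hx j (M : R) : `|y ^+ j * fe k1 g1 (Re k1 0) 0 y| <= M -> `|y| ^+ j * bump 1 y <= M.
    by rewrite -/(bumpF1 0 y) bumpF1_0 normrM normrX (gtr0_norm b0).
  have {}h0 := hx _ _ (h0 y); have {}h2 := hx _ _ (h2 y); have {}h4 := hx _ _ (h4 y).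
  rewrite /bell ler_pdivlMr; last by rewrite ltr_wpDr// sqr_ge0.
  have y0 : 0 <= `|y| by [].
  rewrite -(real_normK (num_real y)); move: (`|y|) (bump 1 y) y0 b0 h0 h2 h4 => a b a0 b0 h0 h2 h4.
  have q : a <= 1 + a ^+ 2 by have := sqr_ge0 (a - 1); lra.
  have q1 := ler_wpM2r (ltW b0) q.
  have a2 : 0 <= 1 + a ^+ 2 by have := sqr_ge0 a; lra.
  apply: le_trans (ler_wpM2r a2 q1) _.
  rewrite (_ : _ * b * _ = a ^+ 0 * b + 2 * (a ^+ 2 * b) + a ^+ 4 * b); last by ring.
  lra.
move=> c x c0; have := main (c * x).
rewrite -(bumpF_0 c) /bumpF bumpF1_0 expr1 normrM (gtr0_norm c0); lra.
Qed.

(** Since cos(x xi) >= 1 - |x xi|, the cosine transform loses at most a first moment, of order xi /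
    lam, from its value at 0, which is at least 1. *)
Lemma wt_bump_lower (p s : R) : 1 <= p -> exists c0 e : R, [/\ 0 < c0, 0 < e &
  forall lam xi, 0 < lam -> lam <= 1 -> c0 * boxw (e * lam) xi <= wt p s (modhat (bump lam) xi) xi].
Proof.
move=> p1; have p0 : 0 <= p by exact: le_trans p1.
have [C C0 hC] := bump_moment.
have pi0 := @pi_gt0 R.
(* The second entry keeps the loss below 1/2; the first keeps xi <= 1, so that the weight is at
   least 2^(- |s|). *)
pose e : R := Num.min 1 (2 * C * pi)^-1.
have e0 : 0 < e by rewrite lt_min ltr01 invr_gt0 !mulr_gt0.
have [e1 e2] : e <= 1 /\ e <= (2 * C * pi)^-1 by rewrite !ge_min !lexx orbT.
exists ((2 `^ (- `|s|) / 2) `^ p), e; split => //.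
move=> lam xi l0 l1; rewrite /boxw indicE.
case: (boolP (_ \in _)) => [/set_mem|_]; last by rewrite mulr0 wt_ge0.
rewrite /= in_itv/= mulr1 => /andP[x0 xe].
have tb := bump_tame l0; have tl := @tame_bellZ R lam l0.
have half : 1 / 2 <= modhat (bump lam) xi.
  apply: le_trans (_ : fc (bump lam) xi <= _); last first.
    apply: le_trans (ler_norm _) _; rewrite -sqrtr_sqr ler_wsqrtr// lerDl sqr_ge0//.
  apply: le_trans (_ : itg (fun x => bump lam x - xi * C * bell (lam * x)) <= _); last first.
    apply: le_itg; [by apply: tameB => //; exact: tameZ|exact: tame_cosM|move=> x].
    have := cos_ge_lin (x * xi); rewrite normrM (ger0_norm x0) => hcos.
    have := ler_wpM2r (ltW (bump_gt0 x l0)) hcos.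
    have := ler_wpM2l x0 (hC lam x l0); lra.
  rewrite itgB//; last exact: tameZ.
  rewrite itgZ// itg_bellZ//; have i1 := itg_bump_ge1 l0.
  have : xi * C * (pi / lam) <= 1 / 2.
    rewrite mulrA ler_pdivrMr//.
    have : xi <= (2 * C * pi)^-1 * lam by apply: le_trans xe _; rewrite ler_wpM2r// ltW.
    rewrite mulrC ler_pdivlMr ?mulr_gt0//; lra.
  lra.
rewrite /wt; apply: ge0_ler_powR; rewrite ?nnegrE ?mulr_ge0 ?powR_ge0 ?invr_ge0 ?modhat_ge0//.
apply: ler_pM; rewrite ?powR_ge0 ?invr_ge0//; last by rewrite -[leLHS]div1r.
have xi1 : xi <= 1 by apply: le_trans xe _; rewrite -[leRHS]mulr1 ler_pM// ltW.
have J1 := japanese_ge1 xi.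
have J2 : japanese xi <= 2.
  rewrite /japanese -[leRHS]ger0_norm// -sqrtr_sqr ler_wsqrtr//.
  have : xi ^+ 2 <= 1 by rewrite expr_le1.
  lra.
apply: le_trans (_ : japanese xi `^ (- `|s|) <= _).
  rewrite !powRN lef_pV2 ?posrE ?powR_gt0//; last exact: lt_le_trans J1.
  by apply: ge0_ler_powR; rewrite ?nnegrE//; exact: le_trans J1.
by apply: ler_powR => //; rewrite lerNl -normrN ler_norm.
Qed.

Lemma bump_cvg (u : nat -> R) lam : 0 < lam -> (forall m, lam / 2 <= u m <= 2 * lam) ->
  u m @[m --> \oo] --> lam -> itg (fun x => `|bump (u m) x - bump lam x|) @[m --> \oo] --> 0.
Proof.
move=> l0 hu cu; have [C C0 hC] := bumpF_bound 0.
have u0 m : 0 < u m by have /andP[h _] := hu m; apply: lt_le_trans h; lra.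
have [bC hbC] : exists D : R, forall x, bell (lam / 2 * x) <= D * bell x.
  have l2 : 0 < lam / 2 by lra.
  have [_ [D hD]] := tame_bellZ l2.
  by exists D => x; apply: le_trans (hD x); exact: ler_norm.
have b c x : lam / 2 <= c -> c <= 2 * lam -> `|bump c x| <= 2 * lam * C * bell (lam / 2 * x).
  move=> h1 h2; have c0 : 0 < c by apply: lt_le_trans h1; lra.
  rewrite -bumpF_0; apply: le_trans (hC c x c0) _; rewrite expr1.
  apply: ler_pM; rewrite ?mulr_ge0 ?(ltW c0) ?(ltW (bell_gt0 _)) ?ler_wpM2r//.
  rewrite /bell lef_pV2 ?posrE; [|by rewrite ltr_wpDr// sqr_ge0..].
  rewrite lerD2l (exprMn _ (lam / 2) x) (exprMn _ c x) ler_wpM2r ?sqr_ge0// lerXn2r ?nnegrE//; [lra|exact: ltW].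
have <- : itg (fun _ : R => 0) = 0 :> R.
  rewrite -[RHS](mul0r (itg (bump lam))) -itgZ; last exact: bump_tame.
  by congr itg; apply/funext => x; rewrite mul0r.
apply: (@itg_cvg R (fun m x => `|bump (u m) x - bump lam x|) (fun=> 0) (4 * lam * C * bC)).
- move=> m; apply: continuous_measurable_fun => x.
  apply: (@continuous_comp _ _ _ (fun x : R => bump (u m) x - bump lam x) (fun y : R => `|y|)).
    by apply: cvgB; exact: bump_cont.
  exact: norm_continuous.
- move=> m x; rewrite normr_id; apply: le_trans (ler_normB _ _) _.
  have /andP[h1 h2] := hu m.
  have q1 := b (u m) x h1 h2; have q2 : `|bump lam x| <= 2 * lam * C * bell (lam / 2 * x) by apply: b; lra.
  have c4 : 0 <= 4 * lam * C by rewrite !mulr_ge0// ltW.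
  have := ler_wpM2l c4 (hbC x); rewrite mulrA; lra.
move=> x; apply: norm_cvg0; rewrite (_ : (fun m => _) = fun m => `|bump (u m) x - bump lam x|); last first.
  by apply/funext => m; rewrite normr_id.
apply/norm_cvg0P; rewrite -[X in _ --> X](subrr (bump lam x)).
apply: cvgB; last exact: cvg_cst.
have c2 : 2 * u m @[m --> \oo] --> 2 * lam by apply: cvgM => //; exact: cvg_cst.
have cn : - (2 * u m) * x @[m --> \oo] --> - (2 * lam) * x.
  by apply: cvgM; [exact: cvgN|exact: cvg_cst].
have cE : expR (- (2 * u m) * x) @[m --> \oo] --> expR (- (2 * lam) * x).
  exact: (cvg_comp _ _ cn (@continuous_expR R _)).
have cD : 1 + expR (- (2 * u m) * x) ^+ 2 @[m --> \oo] --> 1 + expR (- (2 * lam) * x) ^+ 2.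
  by apply: cvgD; [exact: cvg_cst|exact: cvgM].
rewrite /bump; apply: (cvgM (cvgM c2 cE)).
by apply: (cvgV _ cD); rewrite gt_eqF// ltr_wpDr// sqr_ge0.
Qed.

(** The threshold [a] depends on the function only through [B], so L^1 convergence within a family
    with bounded derivatives suffices. *)
Lemma NN_eps (p s B e : R) : 1 <= p -> 0 < e -> 0 <= B -> exists2 a : R, 0 < a & forall F, nice F ->
  itg (fun x => `|F 0%N x|) <= a -> itg (fun x => `|F (2 * fdeg s)%N x|) <= B ->
  NN p s (F 0%N) <= e.
Proof.
move=> p1 e0 B0; have p0 : 0 < p by lra.
have pi0 := @pi_gt0 R; pose r := (e / pi) `^ p^-1.
have r0 : 0 < r by rewrite powR_gt0// divr_gt0.
pose D : R := 2 ^+ fdeg s * (2 * (2 + 2 * B)).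
have D0 : 0 < D by rewrite mulr_gt0 ?exprn_gt0//; lra.
exists (Num.min 1 (r ^+ 2 / D)); first by rewrite lt_min ltr01 divr_gt0 ?exprn_gt0.
move=> F nF hA hB; apply: le_trans (NN_small p1 (fdegP s) nF hA hB) _.
set a := Num.min _ _ in hA *.
have [a1 a2] : a <= 1 /\ a <= r ^+ 2 / D by rewrite !ge_min !lexx orbT.
have a0 : 0 <= a by rewrite le_min ler01 divr_ge0 ?sqr_ge0// ltW.
rewrite -ler_pdivlMr// (_ : e / pi = r `^ p); last first.
  by rewrite -powRrM mulVf ?gt_eqF// powRr1// divr_ge0// ltW.
apply: ge0_ler_powR; rewrite ?nnegrE ?sqrtr_ge0 ?(ltW r0) ?(ltW p0)//.
rewrite -[leRHS]ger0_norm ?(ltW r0)// -sqrtr_sqr ler_wsqrtr//.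
move: a2; rewrite ler_pdivlMr// => a2; apply: le_trans a2.
rewrite /D [leRHS]mulrCA ler_wpM2l ?exprn_ge0//.
have := ler_wpM2l a0 a1; lra.
Qed.

End BumpFamily.

(** * Approximation by sums of translates *)

Section Errors.
Context {R : realType}.
Implicit Types (p s lam : R).

Lemma wtf_shifts p s n (y : 'I_n -> R) (f : R -> R) xi : continuous f -> tame f ->
  wtf p s (fun x => \sum_i f (x - y i)) xi = dsum y xi `^ p * wt p s (modhat f xi) xi.
Proof.
by move=> cf tf; rewrite /wtf modhat_shifts// wtM ?dsum_ge0 ?modhat_ge0.
Qed.

Lemma NN_opp p s f : tame f -> NN p s (fun x => - f x) = NN p s f.
Proof.
move=> tf; have e xi : modhat (fun x => - f x) xi = modhat f xi.
  have <- : (fun x => -1 * f x) = (fun x => - f x) by apply/funext => x; rewrite mulN1r.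
  by rewrite modhatZ// normrN1 mul1r.
rewrite /NN; suff -> : wtf p s (fun x => - f x) = wtf p s f by [].
by apply/funext => xi; rewrite /wtf e.
Qed.

Lemma NN_perturb p s (F M E1 E2 : nat -> R -> R) e : 1 <= p ->
  nice F -> nice M -> nice E1 -> nice E2 ->
  (forall x, F 0%N x = M 0%N x + (E1 0%N x + E2 0%N x)) ->
  NN p s (E1 0%N) <= e -> NN p s (E2 0%N) <= e ->
  NN p s (F 0%N) <= 2 `^ p * (NN p s (M 0%N) + 2 `^ p * (e + e)) /\
  NN p s (M 0%N) <= 2 `^ p * (NN p s (F 0%N) + 2 `^ p * (e + e)).
Proof.
move=> p1 nF nM n1 n2 eq h1 h2.
have tp : 0 <= 2 `^ p :> R by exact: powR_ge0.
have n12 := niceD n1 n2; have n12' := niceZ (-1) n12.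
have hE := le_trans (NN_D_le s p1 n1 n2) (ler_wpM2l tp (lerD h1 h2)).
have e1 : F 0%N = fun x => M 0%N x + (E1 0%N x + E2 0%N x) by exact/funext.
have e2 : M 0%N = fun x => F 0%N x + (-1 * (E1 0%N x + E2 0%N x)).
  by apply/funext => x; rewrite eq mulN1r addrK.
have eN : (fun x => -1 * (E1 0%N x + E2 0%N x)) = fun x => - (E1 0%N x + E2 0%N x).
  by apply/funext => x; rewrite mulN1r.
split.
  rewrite {1}e1; apply: le_trans (NN_D_le s p1 nM n12) _.
  exact: (ler_wpM2l tp (lerD (lexx _) hE)).
rewrite {1}e2; apply: le_trans (NN_D_le s p1 nF n12') _.
rewrite eN (NN_opp _ _ (n12 0%N).1).
exact: (ler_wpM2l tp (lerD (lexx _) hE)).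
Qed.

Lemma itg_shift_norm (f : R -> R) b : continuous f -> tame f ->
  itg (fun x => `|f (x - b)|) = itg (fun x => `|f x|).
Proof.
move=> cf tf; apply: (@itg_shift _ (fun x => `|f x|) (- b)); last exact: tame_norm.
move=> x; apply: (@continuous_comp _ _ _ f (fun y : R => `|y|)); first exact: cf.
exact: norm_continuous.
Qed.

Lemma itg_sum_norm n (h : 'I_n -> R -> R) : (forall i, tame (h i)) ->
  itg (fun x => `|\sum_i h i x|) <= \sum_i itg (fun x => `|h i x|).
Proof.
move=> th; rewrite -itg_sum; last by move=> i; exact: tame_norm.
apply: le_itg; [by apply: tame_norm; exact: tame_sum|by apply: tame_sum => i; exact: tame_norm|].
by move=> x; exact: ler_norm_sum.
Qed.

Lemma nice_cont (F : nat -> R -> R) i : nice F -> continuous (F i).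
Proof. by move=> nF x; exact: der_cont ((nF i).2 x). Qed.

Definition trainF n (c y : 'I_n -> R) i x := \sum_j bumpF (c j) i (x - y j).

Lemma trainF_nice n (c y : 'I_n -> R) : (forall j, 0 < c j) -> nice (trainF c y).
Proof. move=> c0; apply: (@nice_sum _ n (fun j i x => bumpF (c j) i (x - y j))) => j.
exact: (nice_shift (y j) (bumpF_nice (c0 j))). Qed.

Lemma trainF_0 n (c y : 'I_n -> R) x : trainF c y 0 x = \sum_j bump (c j) (x - y j).
Proof. by apply: eq_bigr => j _; rewrite bumpF_0. Qed.

Lemma itg_trainF i K : exists2 C : R, 0 <= C & forall n (c y : 'I_n -> R),
  (forall j, 0 < c j) -> (forall j, c j <= K) -> itg (fun x => `|trainF c y i x|) <= n%:R * C.
Proof.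
have [C C0 hC] := @itg_bumpF R i.
exists (C * `|K| ^+ i); first by rewrite mulr_ge0// exprn_ge0.
move=> n c y c0 cK; have nb j := bumpF_nice (c0 j).
apply: le_trans (itg_sum_norm _) _; first by move=> j; exact: (nice_shift (y j) (nb j) i).1.
apply: le_trans (_ : \sum_(j < n) C * `|K| ^+ i <= _); last by rewrite sumr_const card_ord mulr_natl.
apply: ler_sum => j _; rewrite itg_shift_norm; [|exact: nice_cont|exact: (nb j i).1].
apply: le_trans (hC _ (c0 j)) _; rewrite ler_wpM2l// lerXn2r ?nnegrE ?(ltW (c0 j))//.
by apply: le_trans (cK j) _; exact: ler_norm.
Qed.

(** Uniform in the positions [y], because the detuning is frozen before the spacing is chosen. *)
Lemma detune_error p s lam n (c : nat -> 'I_n -> R) e : 1 <= p -> 0 < e -> 0 < lam ->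
  (forall m j, lam / 2 <= c m j <= 2 * lam) -> (forall j, c m j @[m --> \oo] --> lam) ->
  \forall m \near \oo, forall y : 'I_n -> R,
    NN p s (fun x => trainF (c m) y 0 x - trainF (fun=> lam) y 0 x) <= e.
Proof.
move=> p1 e0 l0 hc hl; have [C C0 hC] := itg_trainF (2 * fdeg s) (2 * lam).
have c0 m j : 0 < c m j by have /andP[h _] := hc m j; apply: lt_le_trans h; lra.
have B0 : 0 <= 2 * (n%:R * C) by rewrite !mulr_ge0.
have [a a0 ha] := NN_eps s p1 e0 B0.
have cv : \sum_j itg (fun x => `|bump (c m j) x - bump lam x|) @[m --> \oo] --> 0.
  by apply: cvg0_sum => j; apply: bump_cvg.
move/cvgrPdist_le : cv => /(_ _ a0); apply: filterS => m hm y.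
pose F i x := trainF (c m) y i x + -1 * trainF (fun=> lam) y i x.
have n1 := trainF_nice y (c0 m); have n2 := trainF_nice (c := fun=> lam) y (fun=> l0).
have nF : nice F by apply: niceD => //; exact: niceZ.
have eF i x : F i x = trainF (c m) y i x - trainF (fun=> lam) y i x by rewrite /F mulN1r.
rewrite (_ : (fun x => _) = F 0%N); last by apply/funext => x.
apply: ha => //.
  have tj j : tame (fun x => bump (c m j) x - bump lam x) by apply: tameB; exact: bump_tame.
  have cj j : continuous (fun x => bump (c m j) x - bump lam x).
    by move=> x; apply: cvgB; exact: bump_cont.
  rewrite (_ : F 0%N = fun x => \sum_j (bump (c m j) (x - y j) - bump lam (x - y j))); last first.
    by apply/funext => x; rewrite eF !trainF_0 -sumrB.
  apply: le_trans (itg_sum_norm _) _.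
    by move=> j; exact: (tame_shift (- y j) (tj j)).
  have -> : \sum_j itg (fun x => `|bump (c m j) (x - y j) - bump lam (x - y j)|) =
     \sum_j itg (fun x => `|bump (c m j) x - bump lam x|).
    by apply: eq_bigr => j _; rewrite (itg_shift_norm (y j) (cj j) (tj j)).
  by move: hm; rewrite sub0r normrN; apply: le_trans; exact: ler_norm.
apply: le_trans (_ : itg (fun x => `|trainF (c m) y (2 * fdeg s) x|) +
   itg (fun x => `|trainF (fun=> lam) y (2 * fdeg s) x|) <= _).
  rewrite -itgD; [|apply: tame_norm; exact: (n1 _).1|apply: tame_norm; exact: (n2 _).1].
  apply: le_itg; first by apply: tame_norm; exact: (nF _).1.
    by apply: tameD; apply: tame_norm; [exact: (n1 _).1|exact: (n2 _).1].
  by move=> x; rewrite eF; exact: ler_normB.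
rewrite mulrDl mul1r lerD//; apply: hC => // j; last lra.
by have /andP[] := hc m j.
Qed.

Section Profile.
Context (n : nat) (k : 'I_n -> R).
Hypotheses (k0 : forall i, 0 < k i) (kI : injective k).

Definition profileF (g : 'I_n -> R) i := fe k g (iter i (dx k) (Re k 0)) 0.

Lemma profileF_nice g : (forall i, 0 < g i) -> nice (profileF g).
Proof.
move=> g0 i; split; last by move=> x; exact: fe_dx.
by apply: fe_tame => //; apply: mindeg_iter_dx; exact: mindeg_Re.
Qed.

Lemma profileF_0 g : profileF g 0 = rs k g.
Proof. by rewrite rs_fe. Qed.

(** With m a positive lower bound of the k_i: m^2 R_0 <= R_2, and the trace identities give that the
    integral of R_2 is twice that of R_0^3, hence at most 2 K^2. *)
Lemma itg_rs_le : exists C : R, forall g, (forall i, 0 < g i) -> itg (rs k g) <= C.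
Proof.
have [m m0 hm] := pos_lbound k0; pose K := \sum_i k i.
have K0 : 0 <= K by exact: sum_k_ge0.
exists ((m ^+ 2)^-1 * (2 * (K * K))) => g g0.
have tr := rs_tame k0 kI g0.
have m2 : 0 < m ^+ 2 by rewrite exprn_gt0.
have tr2 : tame (fun x => rs k g x * rs k g x).
  apply: (tameM tr tr.1 (M := K)) => x; rewrite ger0_norm ?rs_ge0//; exact: rs_le.
rewrite ler_pdivlMl// -itgZ//.
apply: le_trans (_ : itg (betas k g) <= _).
  apply: le_itg; [exact: tameZ|exact: betas_tame|move=> x].
  rewrite /betas /Rsum rsE mulr_sumr; apply: ler_sum => i _.
  by rewrite ler_wpM2r ?rho_ge0// lerXn2r ?nnegrE ?(ltW m0) ?(ltW (k0 i)) ?hm.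
rewrite itg_betas// ler_wpM2l// -[X in _ <= K * X](itg_rs_sqr k0 kI g0).
rewrite -itgZ; last by rewrite (_ : (fun x => _) = fun x => rs k g x * rs k g x).
apply: le_itg; [exact: rs_cube_tame|by apply: tameZ|move=> x].
by rewrite exprS ler_wpM2r ?sqr_ge0// rs_le.
Qed.

Lemma itg_profileF i : exists2 C : R, 0 <= C & forall g, (forall i, 0 < g i) ->
  itg (fun x => `|profileF g i x|) <= C.
Proof.
have [D hD] := itg_rs_le.
have e2 : (2 <= mindeg (iter i (dx k) (Re k 0)))%N by apply: mindeg_iter_dx; exact: mindeg_Re.
have [C C0 hC] := eval_bound2 (\sum_i k i) e2.
exists (C * `|D|); first by rewrite mulr_ge0.
move=> g g0; have tr := rs_tame k0 kI g0.
apply: le_trans (_ : itg (fun x => C * rs k g x) <= _); last first.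
  rewrite itgZ// ler_wpM2l//; apply: le_trans (hD _ g0) _; exact: ler_norm.
apply: le_itg; [by apply: tame_norm; exact: (profileF_nice g0 i).1|exact: tameZ|move=> x].
by apply: hC; exact: rs_le.
Qed.

End Profile.

Lemma profile_error p s n (k gamma : 'I_n -> R) (y : nat -> 'I_n -> R) e : 1 <= p -> 0 < e ->
  (forall i, 0 < k i) -> injective k -> (forall i, 0 < gamma i) ->
  (forall j (a : nat -> 'I_n -> R) (z : R), 0 < z ->
    (forall m i, 0 < a m i) -> (forall m, a m j = z) ->
    (forall i : 'I_n, (i < j)%N -> a m i @[m --> \oo] --> 0) ->
    (forall i : 'I_n, (j < i)%N -> (a m i)^-1 @[m --> \oo] --> 0) ->
    forall i, ps k (a m) i ^+ 2 + qs k (a m) i ^+ 2 @[m --> \oo] -->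
      if i == j then 2 * k j * (gamma j * z ^+ 2) / (1 + (gamma j * z ^+ 2) ^+ 2) else 0) ->
  (forall i j : 'I_n, (i < j)%N -> y m j - y m i @[m --> \oo] --> +oo) ->
  \forall m \near \oo,
    NN p s (fun x => profileF k (phase k gamma (y m)) 0 x - trainF k (y m) 0 x) <= e.
Proof.
move=> p1 e0 k0 kI gam0 glim ysep.
have [C C0 hC] := itg_trainF (2 * fdeg s) (\sum_i k i).
have [D D0 hD] := itg_profileF k0 kI (2 * fdeg s).
have kK j : k j <= \sum_i k i by apply: le_sum1 => i; exact: ltW.
have B0 : 0 <= D + n%:R * C by rewrite addr_ge0 ?mulr_ge0.
have [a a0 ha] := NN_eps s p1 e0 B0.
have cv : \sum_i itg (fun x => `|rho k (phase k gamma (y m)) i x - bump (k i) (x - y m i)|)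
    @[m --> \oo] --> 0.
  by apply: cvg0_sum => i; exact: (rho_bump_cvg k0 kI gam0 glim ysep).
move/cvgrPdist_le : cv => /(_ _ a0); apply: filterS => m hm.
set g := phase k gamma (y m) in hm *.
have g0 i : 0 < g i by exact: phase_gt0.
pose F i x := profileF k g i x + -1 * trainF k (y m) i x.
have n1 := profileF_nice k0 kI g0; have n2 := trainF_nice (y m) k0.
have nF : nice F by apply: niceD => //; exact: niceZ.
have eF i x : F i x = profileF k g i x - trainF k (y m) i x by rewrite /F mulN1r.
rewrite (_ : (fun x => _) = F 0%N); last by apply/funext => x.
apply: ha => //.
  rewrite (_ : F 0%N = fun x => \sum_i (rho k g i x - bump (k i) (x - y m i))); last first.
    by apply/funext => x; rewrite eF profileF_0 rsE trainF_0 -sumrB.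
  apply: le_trans (itg_sum_norm _) _.
    move=> i; apply: tameB; first exact: rho_tame.
    exact: (tame_shift (- y m i) (bump_tame (k0 i))).
  by move: hm; rewrite sub0r normrN; apply: le_trans; exact: ler_norm.
apply: le_trans (_ : itg (fun x => `|profileF k g (2 * fdeg s) x|) +
   itg (fun x => `|trainF k (y m) (2 * fdeg s) x|) <= _).
  rewrite -itgD; [|apply: tame_norm; exact: (n1 _).1|apply: tame_norm; exact: (n2 _).1].
  apply: le_itg; first by apply: tame_norm; exact: (nF _).1.
    by apply: tameD; apply: tame_norm; [exact: (n1 _).1|exact: (n2 _).1].
  by move=> x; rewrite eF; exact: ler_normB.
by rewrite lerD//; [exact: hD|exact: hC].
Qed.

End Errors.

(** * Norm inflation *)

Section Inflation.
Context {R : realType}.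
Implicit Types (p s lam : R).

Lemma niceB (F H : nat -> R -> R) : nice F -> nice H -> nice (fun i x => F i x - H i x).
Proof.
move=> nF nH i; split; first exact: tameB (nF i).1 (nH i).1.
by move=> x; apply: derB; [exact: (nF i).2|exact: (nH i).2].
Qed.

Lemma NN_scale p s c F : 1 <= p -> nice F -> NN p s (fun x => c * F 0%N x) = `|c| `^ p * NN p s (F 0%N).
Proof.
move=> p1 nF; rewrite /NN -itgZ; last exact: wtf_tame.
suff -> : wtf p s (fun x => c * F 0%N x) = fun xi => `|c| `^ p * wtf p s (F 0%N) xi by [].
by apply/funext => xi; rewrite /wtf modhatZ ?wtM ?modhat_ge0//; exact: (nF 0%N).1.
Qed.

Lemma profile_train p s n (k g y : 'I_n -> R) lam e : 1 <= p -> 0 < lam ->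
  (forall i, 0 < k i) -> injective k -> (forall i, 0 < g i) ->
  NN p s (fun x => profileF k g 0 x - trainF k y 0 x) <= e ->
  NN p s (fun x => trainF k y 0 x - trainF (fun=> lam) y 0 x) <= e ->
  NN p s (profileF k g 0) <= 2 `^ p * (NN p s (trainF (fun=> lam) y 0) + 2 `^ p * (e + e)) /\
  NN p s (trainF (fun=> lam) y 0) <= 2 `^ p * (NN p s (profileF k g 0) + 2 `^ p * (e + e)).
Proof.
move=> p1 l0 k0 kI g0 h1 h2.
have n1 := profileF_nice k0 kI g0; have n2 := trainF_nice y k0.
have n3 := @trainF_nice R n (fun=> lam) y (fun=> l0).
have aux (a b c : R) : a = c + ((a - b) + (b - c)) by ring.
apply: (NN_perturb p1 n1 n3 (niceB n1 n2) (niceB n2 n3) _ h1 h2) => x.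
exact: aux.
Qed.

Lemma wtf_train p s n (y : 'I_n -> R) lam xi : 0 < lam ->
  wtf p s (trainF (fun=> lam) y 0) xi = dsum y xi `^ p * wt p s (modhat (bump lam) xi) xi.
Proof.
move=> l0; rewrite -(wtf_shifts p s y xi (bump_cont l0) (bump_tame l0)).
by rewrite (_ : trainF _ y 0 = fun x => \sum_i bump lam (x - y i))//; apply/funext => x; rewrite trainF_0.
Qed.

Lemma NN_train_le p s : 1 <= p -> exists2 C : R, 0 < C & forall n (y : 'I_n -> R) lam,
  0 < lam -> lam <= 1 ->
  NN p s (trainF (fun=> lam) y 0) <= C * itg (fun xi => bell (lam^-1 * xi) * dsum y xi `^ p).
Proof.
move=> p1; have p0 : 0 <= p by lra.
have [C C0 hC] := wt_bump_upper s p1; exists C => // n y lam l0 l1.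
have li0 : 0 < lam^-1 by rewrite invr_gt0.
have td := tame_dsum y p0 (tame_bellZ li0).
rewrite /NN -itgZ//; apply: le_itg; [|exact: tameZ|move=> xi].
  exact: (wtf_tame s p1 (@trainF_nice R n (fun=> lam) y (fun=> l0))).
rewrite wtf_train// mulrC mulrA ler_wpM2r ?powR_ge0//; exact: hC.
Qed.

Lemma NN_train_ge p s : 1 <= p -> exists c e : R, [/\ 0 < c, 0 < e & forall n (y : 'I_n -> R) lam,
  0 < lam -> lam <= 1 ->
  c * itg (fun xi => boxw (e * lam) xi * dsum y xi `^ p) <= NN p s (trainF (fun=> lam) y 0)].
Proof.
move=> p1; have p0 : 0 <= p by lra.
have [c [e [c0 e0 hc]]] := wt_bump_lower s p1; exists c, e; split => // n y lam l0 l1.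
have td := tame_dsum y p0 (boxw_tame (e * lam)).
rewrite /NN -itgZ//; apply: le_itg; [exact: tameZ| |move=> xi].
  exact: (wtf_tame s p1 (@trainF_nice R n (fun=> lam) y (fun=> l0))).
rewrite wtf_train// mulrA mulrC ler_wpM2l ?powR_ge0//; exact: hc.
Qed.

Lemma al_phase n (k gamma y : 'I_n -> R) t x :
  al k (phase k gamma y) t x = al k (phase k gamma (fun i => y i + 4 * k i ^+ 2 * t)) 0 x.
Proof.
apply/funext => i; rewrite /al /phase -!mulrA -!expRD mulr0.
congr (_ * expR _); ring.
Qed.

(** The flow only moves the centre parameters, so results on profiles at time 0 apply at every
    time. *)
Lemma soliton_profile n (k gamma y : 'I_n -> R) t :
  soliton k (phase k gamma y) t =
  fun x => -2 * profileF k (phase k gamma (fun i => y i + 4 * k i ^+ 2 * t)) 0 x.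
Proof.
apply/funext => x; rewrite /soliton profileF_0 /pp /qq al_phase.
by rewrite -/(pp k _ 0 x) -/(qq k _ 0 x) /rs rrE.
Qed.

Lemma sqrt_near1 (d : R) : `|d| <= 1 / 4 -> 1 / 2 <= Num.sqrt (1 + d) <= 2.
Proof.
rewrite ler_norml => /andP[d1 d2]; apply/andP; split.
  rewrite -[leLHS]ger0_norm// -sqrtr_sqr ler_wsqrtr//; lra.
rewrite -[leRHS]ger0_norm// -sqrtr_sqr ler_wsqrtr//; lra.
Qed.

Lemma itg_bellV lam : 0 < lam -> itg (fun xi => bell (lam^-1 * xi)) = pi * lam.
Proof. by move=> l0; rewrite itg_bellZ ?invr_gt0// invrK. Qed.

Lemma detuning n (d : 'I_n -> R) lam : 0 < lam -> injective d ->
  exists (de : nat -> R) (k : nat -> 'I_n -> R), [/\ forall m, 0 < de m,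
    forall m j, k m j ^+ 2 = lam ^+ 2 * (1 + de m * d j), forall m, injective (k m),
    forall m j, lam / 2 <= k m j <= 2 * lam & forall j, k m j @[m --> \oo] --> lam].
Proof.
(* This makes |de_m d_j| <= 1/4, so that the square roots stay between 1/2 and 2. *)
move=> l0 dI; pose D : R := 4 * (1 + \sum_j `|d j|).
have S0 : 0 <= \sum_j `|d j| by apply: sumr_ge0.
have D0 : 0 < D by rewrite mulr_gt0//; lra.
pose de m : R := D^-1 * m.+1%:R^-1.
have de0 m : 0 < de m by rewrite mulr_gt0 ?invr_gt0.
have sm m j : `|de m * d j| <= 1 / 4.
  rewrite normrM (gtr0_norm (de0 m)) /de -mulrA ler_pdivrMl//.
  apply: le_trans (_ : `|d j| <= _).
    by rewrite ler_piMl// invf_le1// ler1n.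
  by have := @le_sum1 R n (fun j => `|d j|) j (fun=> normr_ge0 _); rewrite /D; lra.
pose k m j := lam * Num.sqrt (1 + de m * d j).
have hk m j : 1 / 2 <= Num.sqrt (1 + de m * d j) <= 2 by exact: sqrt_near1.
have pk m j : 0 <= 1 + de m * d j by have := sm m j; rewrite ler_norml => /andP[]; lra.
exists de, k; split => //.
- by move=> m j; rewrite /k exprMn sqr_sqrtr.
- move=> m i j /(mulfI (lt0r_neq0 l0)) e; apply: dI.
  have : Num.sqrt (1 + de m * d i) ^+ 2 = Num.sqrt (1 + de m * d j) ^+ 2 by rewrite e.
  by rewrite !sqr_sqrtr// => /addrI /(mulfI (lt0r_neq0 (de0 m))).
- move=> m j; have /andP[h1 h2] := hk m j; rewrite /k; apply/andP; split.
    by have := ler_wpM2l (ltW l0) h1; rewrite mulrA mulr1.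
  by rewrite [leRHS]mulrC ler_wpM2l// ltW.
move=> j; have h0 : de m * d j @[m --> \oo] --> 0 * d j.
  apply: cvgM; last exact: cvg_cst.
  by rewrite -(mulr0 D^-1); apply: cvgM; [exact: cvg_cst|exact: cvg_harmonic].
have h1 : 1 + de m * d j @[m --> \oo] --> 1 + 0 * d j by apply: cvgD => //; exact: cvg_cst.
have h2 := cvg_comp _ _ h1 (@sqrt_continuous R _).
have h3 : k m j @[m --> \oo] --> lam * Num.sqrt (1 + 0 * d j) by apply: cvgM => //; exact: cvg_cst.
by move: h3; rewrite mul0r addr0 sqrtr1 mulr1.
Qed.

Lemma dsum_shift n (y : 'I_n -> R) b xi : dsum (fun i => y i + b) xi = dsum y xi.
Proof. by rewrite !dsumE modsq_shift. Qed.

Lemma homo_gap n (m : 'I_n -> nat) (L : nat -> R) (i j : 'I_n) : {homo m : i j / (i < j)%N} ->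
  (i < j)%N -> L l @[l --> \oo] --> +oo -> L l * (m j)%:R - L l * (m i)%:R @[l --> \oo] --> +oo.
Proof.
move=> hm ij hL; rewrite (_ : (fun l => _) = fun l => ((m j)%:R - (m i)%:R) * L l + 0); last first.
  by apply/funext => l; rewrite addr0 mulrBl (mulrC (L l)) (mulrC (L l)).
by apply: cvgy_scale => //; rewrite subr_gt0 ltr_nat; exact: hm.
Qed.

(** The detuning is frozen first. Both separation errors and both averages are then under control
    for all large spacings, and one spacing serves all four. *)
Lemma two_trains p s n (m0 m1 : 'I_n -> nat) (V0 V1 lam b e : R) : 1 <= p ->
  {homo m0 : i j / (i < j)%N} -> {homo m1 : i j / (i < j)%N} ->
  injective (fun j => (m1 j)%:R - (m0 j)%:R : R) ->
  pow_mean_le p m0 V0 -> pow_mean_ge p m1 V1 -> 0 < lam -> 0 < b -> 0 < e ->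
  exists (k g0 g1 y0 y1 : 'I_n -> R) (T : R),
    [/\ [/\ forall i, 0 < k i, injective k, forall i, 0 < g0 i & forall i, 0 < g1 i],
        soliton k g0 0 = (fun x => -2 * profileF k g0 0 x) /\
        soliton k g0 T = (fun x => -2 * profileF k g1 0 x),
        [/\ NN p s (fun x => profileF k g0 0 x - trainF k y0 0 x) <= e,
            NN p s (fun x => trainF k y0 0 x - trainF (fun=> lam) y0 0 x) <= e,
            NN p s (fun x => profileF k g1 0 x - trainF k y1 0 x) <= e &
            NN p s (fun x => trainF k y1 0 x - trainF (fun=> lam) y1 0 x) <= e],
        itg (fun xi => bell (lam^-1 * xi) * dsum y0 xi `^ p) <= V0 * (pi * lam) &
        V1 * b <= itg (fun xi => boxw b xi * dsum y1 xi `^ p)].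
Proof.
move=> p1 hm0 hm1 dI hV0 hV1 l0 b0 e0.
have [de [kk [de0 kk2 kkI kkb kkl]]] := detuning l0 dI.
have [q _ hq] := detune_error s p1 e0 l0 kkb kkl.
have {}hq := hq q (leqnn q).
set k := kk q in hq; pose d := de q.
have k0 i : 0 < k i by have /andP[h _] := kkb q i; apply: lt_le_trans h; rewrite divr_gt0.
have kI : injective k by exact: kkI.
have [gamma [gam0 glim]] := local_limit k0 kI.
pose L l : R := l%:R.
have hL : L l @[l --> \oo] --> +oo by exact: cvgr_idn.
pose y0 l (i : 'I_n) := mscale m0 (L l) i.
(* The translation L / d is the distance covered at the reference speed 4 lam^2; moduli of
   exponential sums do not see it. *)
pose y1 l (i : 'I_n) := mscale m1 (L l) i + L l / d.
have sep0 (i j : 'I_n) : (i < j)%N -> y0 l j - y0 l i @[l --> \oo] --> +oo by move=> ij; exact: homo_gap.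
have sep1 (i j : 'I_n) : (i < j)%N -> y1 l j - y1 l i @[l --> \oo] --> +oo.
  move=> ij; rewrite (_ : (fun l => _) = fun l => L l * (m1 j)%:R - L l * (m1 i)%:R); first exact: homo_gap.
  by apply/funext => l; rewrite /y1 /mscale opprD addrACA subrr addr0.
have E0 := profile_error s p1 e0 k0 kI gam0 glim sep0.
have E1 := profile_error s p1 e0 k0 kI gam0 glim sep1.
have li0 : 0 < lam^-1 by rewrite invr_gt0.
have w0 : 0 < itg (fun xi : R => bell (lam^-1 * xi)) by rewrite itg_bellV// mulr_gt0// pi_gt0.
have A0 := hV0 _ L (oscillating_bell li0) (fun x => ltW (bell_gt0 _)) w0 hL.
have w1 : 0 < itg (boxw b) by rewrite itg_boxw.
have A1 := hV1 _ L (oscillating_boxw b0) (boxw_ge0 b) w1 hL.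
have [l [[h0 h1] [h2 h3]]] := @filter_ex _ _ _ _ (filterI (filterI E0 E1) (filterI A0 A1)).
(* 4 lam^2 d T = L, so the relative displacements are L times the differences of the two
   configurations. *)
pose T := L l / (4 * lam ^+ 2 * d).
have eT : (fun i => y0 l i + 4 * k i ^+ 2 * T) = y1 l.
  apply/funext => i; rewrite /y0 /y1 /mscale (kk2 q i) /T /d; field.
  by rewrite !gt_eqF.
exists k, (phase k gamma (y0 l)), (phase k gamma (y1 l)), (y0 l), (y1 l), T; split.
- by split => //; move=> i; exact: phase_gt0.
- split; rewrite soliton_profile; last by rewrite eT.
  rewrite (_ : (fun i => y0 l i + 4 * k i ^+ 2 * 0) = y0 l)//.
  by apply/funext => i; rewrite mulr0 addr0.
- by split; [exact: h0|exact: hq|exact: h1|exact: hq].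
- by move: h2; rewrite itg_bellV.
- move: h3; rewrite (itg_boxw b0) => h3; apply: le_trans h3 _.
  by rewrite le_eqVlt; apply/orP; left; apply/eqP; congr itg; apply/funext => xi; rewrite dsum_shift.
Qed.

Lemma inflation p s a A : 1 <= p -> p != 2 -> 0 < a -> 0 < A ->
  exists (u : R -> R -> R) (T : R) (F G : nat -> R -> R),
    [/\ schwartz_solution u, nice F /\ nice G, F 0%N = u 0 /\ G 0%N = u T,
        NN p s (F 0%N) <= a & A <= NN p s (G 0%N)].
Proof.
move=> p1 np2 a0 A0.
have [ga [c [ga0 c0 hinf]]] := inflating_ex p1 np2.
have [C C0 hC] := NN_train_le s p1; have [c1 [e1 [c10 e10 hc]]] := NN_train_ge s p1.
have pi0 := @pi_gt0 R; pose P : R := 2 `^ p.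
have P0 : 0 < P by exact: powR_gt0.
(* Makes the lower bound for the train at time T equal to A + P, of which P is reserved for the
   errors. *)
pose La := (A + P) / (c1 * c * e1).
have La0 : 0 < La by rewrite divr_gt0 ?mulr_gt0//; exact: addr_gt0.
(* The train at time 0 then contributes a / 2; in the next choice the first entry keeps the errors
   at time 0 within a / 2, the second those at time T within P. *)
pose eta := a / (2 * P ^+ 2 * C * pi * La).
have P20 : 0 < P ^+ 2 by exact: exprn_gt0.
have P30 : 0 < 4 * P ^+ 3 by rewrite mulr_gt0// exprn_gt0.
have eta0 : 0 < eta by apply: divr_gt0 => //; do 4 apply: mulr_gt0 => //.
pose e := Num.min (a / (4 * P ^+ 3)) (2 * P)^-1.
have e0 : 0 < e by rewrite lt_min divr_gt0// invr_gt0 mulr_gt0.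
have [ea eb] : e <= a / (4 * P ^+ 3) /\ e <= (2 * P)^-1 by rewrite !ge_min !lexx orbT.
have ha : a / 2 + 2 * P ^+ 3 * e <= a by move: ea; rewrite ler_pdivlMr//; lra.
have hP : P * (P * (e + e)) <= P.
  rewrite ger_pMr//; move: eb; rewrite -[X in _ <= X]div1r ler_pdivlMr ?mulr_gt0//; lra.
have hA x y : A + P <= x + y -> y <= P -> A <= x by lra.
have [n0 hn0] := powR_small ga0 (@ltr01 R) La0.
have [n [m0 [m1 [[np nn0] [hm0 hm1] dI hV0 hV1]]]] := hinf eta eta0 n0.
pose N : R := n%:R `^ ga; have N0 : 0 < N by rewrite powR_gt0// ltr0n.
pose lam := La / N.
have l0 : 0 < lam by rewrite divr_gt0.
have l1 : lam <= 1 by have := hn0 n nn0; rewrite powRN.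
have b0 : 0 < e1 * lam by rewrite mulr_gt0.
have [k [g0 [g1 [y0 [y1 [T [[k0 kI g00 g10] [u0 uT] [r1 r2 r3 r4] U V]]]]]]] :=
  two_trains s p1 hm0 hm1 dI hV0 hV1 l0 b0 e0.
have [B0 _] := profile_train p1 l0 k0 kI g00 r1 r2.
have [_ B1] := profile_train p1 l0 k0 kI g10 r3 r4.
have nF := profileF_nice k0 kI g00; have nG := profileF_nice k0 kI g10.
exists (soliton k g0), T, (fun i x => -2 * profileF k g0 i x), (fun i x => -2 * profileF k g1 i x); split.
- exact: soliton_schwartz.
- by split; exact: niceZ.
- by rewrite u0 uT.
- rewrite (NN_scale s (-2) p1 nF) normrN normr_nat -/P.
  have h1 := le_trans (hC n y0 lam l0 l1) (ler_wpM2l (ltW C0) U).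
  have h2 := le_trans B0 (ler_wpM2l (ltW P0) (lerD h1 (lexx _))).
  apply: le_trans (ler_wpM2l (ltW P0) h2) _; rewrite -/P -/N.
  have -> : P * (P * (C * (eta * N * (pi * lam)) + P * (e + e))) = a / 2 + 2 * P ^+ 3 * e.
    rewrite /eta /lam; move: (@pi R) pi0 => q q0; by field; rewrite !gt_eqF.
  exact: ha.
- rewrite (NN_scale s (-2) p1 nG) normrN normr_nat -/P.
  have h1 := le_trans (ler_wpM2l (ltW c10) V) (hc n y1 lam l0 l1).
  have h2 := le_trans h1 B1; move: h2; rewrite -/P -/N mulrDr.
  have -> : c1 * (c * N * (e1 * lam)) = A + P.
    by rewrite /lam /La; field; rewrite !gt_eqF.
  move=> h2; exact: (hA _ _ h2 hP).
Qed.

Lemma FLnorm_pow p s r (u : R -> R) F : 1 <= p -> 0 < r -> nice F -> F 0%N = u ->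
  (NN p s (F 0%N) <= r `^ p / norm_cst `^ p -> (FLnorm p s u <= r%:E)%E) /\
  (r `^ p / norm_cst `^ p <= NN p s (F 0%N) -> (r%:E <= FLnorm p s u)%E).
Proof.
move=> p1 r0 nF <-; have p0 : 0 < p by lra.
have c0 : 0 < @norm_cst R `^ p by rewrite powR_gt0// norm_cst_gt0.
have rE : r = (r `^ p) `^ p^-1 by rewrite -powRrM mulfV ?gt_eqF// powRr1// ltW.
have q0 : 0 <= p^-1 by rewrite invr_ge0 ltW.
rewrite FLnormE// !lee_fin {2 4}rE; set x := NN _ _ _.
have x0 : 0 <= x by exact: NN_ge0.
split=> h; apply: le_powR => //; first by rewrite mulr_ge0// ltW.
- by rewrite mulrC -ler_pdivlMr.
- exact: powR_ge0.
- by rewrite mulrC -ler_pdivrMr.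
Qed.

End Inflation.

Theorem theorem1p1 (R : realType) (p s : R) (hp : 1 <= p) (hp2 : p != 2) :
  exists u : nat -> R -> R -> R,
    [/\ forall n, schwartz_solution (u n),
        FLnorm p s (u n 0) @[n --> \oo] --> 0%E &
        ereal_sup (range (fun t : R => FLnorm p s (u n t))) @[n --> \oo]
          --> +oo%E].
Proof.
(* [inflation] is applied to the p-th powers of 1 / (n + 1) and n + 1, corrected by the
   normalisation of the transform. *)
have ex (n : nat) : exists u : R -> R -> R, schwartz_solution u /\
    (FLnorm p s (u 0%R) <= (n.+1%:R^-1)%:E)%E /\ exists T, (n.+1%:R%:E <= FLnorm p s (u T))%E.
  have r0 : 0 < n.+1%:R :> R by rewrite ltr0n.
  have ri : 0 < n.+1%:R^-1 :> R by rewrite invr_gt0.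
  have c0 : 0 < @norm_cst R `^ p by rewrite powR_gt0// norm_cst_gt0.
  have a0 : 0 < n.+1%:R^-1 `^ p / norm_cst `^ p :> R by rewrite divr_gt0// powR_gt0.
  have A0 : 0 < n.+1%:R `^ p / norm_cst `^ p :> R by rewrite divr_gt0// powR_gt0.
  have [u [T [F [G [hu [nF nG] [F0 GT] hF hG]]]]] := inflation s hp hp2 a0 A0.
  exists u; split => //; split; first exact: (FLnorm_pow s hp ri nF F0).1.
  by exists T; exact: (FLnorm_pow s hp r0 nG GT).2.
have [u hu] := choice ex; exists u; split.
- by move=> n; have [] := hu n.
- apply: (@squeeze_cvge _ _ _ _ (fun=> 0%E) _ (fun n => (n.+1%:R^-1)%:E)).
  + by near=> n; have [_ [h _]] := hu n; rewrite h andbT; exact: Lnorm_ge0.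
  + exact: cvg_cst.
  + by apply: cvg_EFin; [near=> n|exact: cvg_harmonic].
- apply/cvgeyPge => A; near=> n; have [_ [_ [T hT]]] := hu n.
  apply: le_trans (_ : (n.+1%:R%:E <= _)%E).
    rewrite lee_fin; apply: le_trans (_ : n%:R <= _); last by rewrite ler_nat.
    near: n; exact: nbhs_infty_ger.
  by apply: le_trans hT _; apply: ereal_sup_ubound; exists T.
Unshelve. all: by end_near. Qed.
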